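(* Let $n\ge1$, let $q\ge0$ be a homogeneous polynomial of degree $2m$ on $\mathbb R^n$ and $p\ge0$ a non-trivial homogeneous polynomial of degree $2s$ on $\mathbb R^n$, both with real coefficients, with $m>s\ge0$ integers. Assume either (a) $q$ does not vanish on the unit sphere $S^{n-1}$, or (b) $q$ vanishes on $S^{n-1}$, the maximal order of vanishing of $q|_{S^{n-1}}$ is $j$, and $\frac{2s-2m+j}{j}+s<0$. Then there exist $\lambda>0$ and a solution $f$ of $-\Delta f+(q(t)-\lambda p(t))f=0$ on all of $\mathbb R^n$ such that (1) $f(t)>0$ for all $t$ and $f(0)=1$, and (2) $0<f(t)<C(1+|t|)^{(m+1)(n-1)}$ for all $t\in\mathbb R^n$, for some constant $C$.
   Context: The order of vanishing of $q|_{S^{n-1}}$ at a zero $\omega\in S^{n-1}$ is the smallest $k$ such that some derivative of order $k$ of $q|_{S^{n-1}}$ (in local coordinates on $S^{n-1}$) is nonzero at $\omega$; the maximal order of vanishing is the maximum of these orders over all zeros of $q|_{S^{n-1}}$. *)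

(* Defs.v *)
From HB Require Import structures.
From mathcomp Require Import all_boot all_order all_algebra.
From mathcomp Require Import all_classical all_reals all_analysis.
From mathcomp Require mpoly.
Set Implicit Arguments. Unset Strict Implicit. Unset Printing Implicit Defensive.
Import Order.TTheory GRing.Theory Num.Theory numFieldNormedType.Exports.
Local Open Scope ring_scope.
Local Open Scope classical_set_scope.

(* Activate the canonical instances of mpoly (equality, zmodule) without
   importing mpoly's notations, which clash with MathComp-Analysis. *)
Canonical mpoly.mpoly_mpoly__canonical__eqtype_Equality.
Canonical mpoly.mpoly_mpoly__canonical__choice_Choice.
Canonical mpoly.mpoly_mpoly__canonical__Algebra_BaseAddUMagma.
Canonical mpoly.mpoly_mpoly__canonical__Algebra_Nmodule.
Canonical mpoly.mpoly_mpoly__canonical__Algebra_Zmodule.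

Section Defs.
Context {R : realType}.

Definition evalp {n : nat} (p : mpoly.mpoly n R) (t : 'rV[R]_n) : R :=
  mpoly.meval (fun i => t ord0 i) p.

Definition homogeneous {n : nat} (d : nat) (p : mpoly.mpoly n R) : bool :=
  p \is @mpoly.ishomog1 n R d (mpoly.mpoly_mdeg__canonical__mpoly_Measure n).

Definition dotv {n : nat} (x y : 'rV[R]_n) : R := \sum_(i < n) x ord0 i * y ord0 i.
Definition enorm {n : nat} (t : 'rV[R]_n) : R := Num.sqrt (dotv t t).

Definition unit_sphere (n : nat) : set 'rV[R]_n := [set t | dotv t t = 1].
End Defs.
Arguments unit_sphere {R} n.
Section Defs2.
Context {R : realType}.

Definition basisv {n : nat} (i : 'I_n) : 'rV[R]_n := delta_mx 0 i.

Definition laplacian {n : nat} (f : 'rV[R]_n -> R) (t : 'rV[R]_n) : R :=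
  \sum_(i < n) 'D_(basisv i) ('D_(basisv i) f) t.

Definition iter_partial {k : nat} (idx : seq 'I_k) (g : 'rV[R]_k -> R)
  : 'rV[R]_k -> R :=
  foldr (fun i h => 'D_(basisv i) h) g idx.

Definition tangent_frame {n : nat} (omega : 'rV[R]_n) (B : 'M[R]_(n.-1, n)) : Prop :=
  B *m B^T = 1%:M /\ B *m omega^T = 0.

(** local coordinates on S^{n-1} around omega (inverse of the gnomonic
    projection onto the tangent plane):  u in R^{n-1} |->
    (omega + u B) / sqrt(1 + |u|^2);  it maps 0 to omega. *)
Definition sphere_chart {n : nat} (omega : 'rV[R]_n) (B : 'M[R]_(n.-1, n))
  (u : 'rV[R]_(n.-1)) : 'rV[R]_n :=
  (Num.sqrt (1 + dotv u u))^-1 *: (omega + u *m B).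

Definition vanishing_order {n : nat} (q : mpoly.mpoly n R) (omega : 'rV[R]_n)
  (k : nat) : Prop :=
  exists B : 'M[R]_(n.-1, n), tangent_frame omega B /\
    let g := fun u => evalp q (sphere_chart omega B u) in
    (exists idx : seq 'I_(n.-1), size idx = k /\ iter_partial idx g 0 != 0) /\
    (forall idx : seq 'I_(n.-1), (size idx < k)%N -> iter_partial idx g 0 = 0).

Definition max_vanishing_order {n : nat} (q : mpoly.mpoly n R) (j : nat) : Prop :=
  (forall omega, unit_sphere n omega -> evalp q omega = 0 ->
     exists k, vanishing_order q omega k /\ (k <= j)%N) /\
  (exists omega, unit_sphere n omega /\ evalp q omega = 0 /\
     vanishing_order q omega j).

End Defs2.

(* Main.v *)
(* Put w = 1 + |t|^2. The hypothesis on the order of vanishing says that at each point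
   of the sphere some derivative of q of order at most j is nonzero, where
   j (s + 1) < 2 (m - s). Let G_l be the sum of the squares of the derivatives of q of
   order l, weighted by powers of w^s, and D the sum of 1 and all G_l. Where G_l/D is
   not small, either q is large or some G_i/D with i < l has a large Laplacian; hence,
   for suitable small e_l, the function Z = (2 - sum e_l G_l/D)/w satisfies
   -Lap Z + (q - L p) Z >= 1/w outside a ball, for any prescribed L.

   On the lattice points of spacing 1/H in a box, minimising a quadratic form gives
   a nonnegative ground state u of -Lap_H u + (q + delta) u = lam p u, and a test
   function supported where p > 0 bounds lam by a fixed L. By the discrete maximum
   principle u/Z attains its maximum in a fixed ball, so u can be normalised to
   u <= Z with equality at a point of that ball. Interior gradient estimates bound
   all difference quotients of u, and the limit of u along an ultrafilter on H is
   a C^2 solution f with 0 <= f <= Z <= 2/w which is not identically zero. The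
   strong maximum principle gives f > 0, and it also excludes lam = 0, since f would
   then be subharmonic and tend to 0 at infinity. *)
Require Import Defs.
From HB Require Import structures.
From mathcomp Require Import all_boot all_order all_algebra.
From mathcomp Require Import all_classical all_reals all_analysis.
From mathcomp Require Import ring lra zify.
From mathcomp Require mpoly.
Import Order.TTheory GRing.Theory Num.Theory numFieldNormedType.Exports.
Set Implicit Arguments. Unset Strict Implicit. Unset Printing Implicit Defensive.
Local Open Scope ring_scope.
Local Open Scope classical_set_scope.

(** * Smooth functions and polynomials *)

(** Along directions where [q] vanishes, [q - L p] may tend to minus infinity, so [q] alone confines
    nothing; what confines is that [q] cannot stay small near a point where one of its derivatives
    is large. The term to beat, [L p], is [O(w^s)]; hence the scale [mm = kap^2 w^s] and, with
    [N = 2m], the weight [mm^(N-l)] on squared derivatives of order [l]. Each derivative then costs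
    [sqrt mm], and the Laplacian of [G_l/D] gains [2 mm G_(l+1)/D]. For [q] to reach size [mm]
    wherever [G_0/D] is not small, [D] must dominate [mm^(N+2)]. On a ray [G_l] can grow like
    [(mm |t|^2)^(N-l)], so this asks for [N - l > s (l + 2)] for [l <= j]: exactly the hypothesis.
    The factor [kap] is fixed last, since the constants in the bounds on [G_l/D] do not contain it.
    The lattice replaces elliptic existence and regularity theory: the ground state is a
    finite-dimensional extremal problem, and bounds on differences follow from the equation. As [Z]
    is fixed before the mesh, contact of [u] with [Z] in a fixed ball keeps the limit from
    vanishing. *)

Canonical mpoly.mpoly_multinom__canonical__eqtype_Equality.
Canonical mpoly.mpoly_multinom__canonical__choice_Choice.

Section Smooth.
Context {R : realType} {n : nat}.
Implicit Types (f g : 'rV[R]_n -> R) (t : 'rV[R]_n) (i : 'I_n).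

(** A syntactic class in place of infinite differentiability: the differentiation rules show that it
    is closed under [pd], so derivatives of every order exist without further argument. It contains
    the polynomials, [1 / wgt], the barriers and the supersolution. *)
Inductive smooth : ('rV[R]_n -> R) -> Prop :=
| smooth_cst c : smooth (fun=> c)
| smooth_coord i : smooth (fun t => t ord0 i)
| smooth_add f g : smooth f -> smooth g -> smooth (fun t => f t + g t)
| smooth_mul f g : smooth f -> smooth g -> smooth (fun t => f t * g t)
| smooth_inv f : smooth f -> (forall t, f t != 0) ->
    smooth (fun t => (f t)^-1).

Lemma smooth_differentiable f t : smooth f -> differentiable f t.
Proof.
elim=> {f} [c|i|f g _ df _ dg|f g _ df _ dg|f _ df f0].
- exact: differentiable_cst.
- exact: differentiable_coord.
- exact: differentiableD.
- exact: differentiableM.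
- exact: differentiableV.
Qed.

Lemma smooth_continuous f : smooth f -> continuous f.
Proof. by move=> sf t; apply/differentiable_continuous/smooth_differentiable. Qed.

Definition pd i f : 'rV[R]_n -> R := 'D_(basisv i) f.
Arguments pd : simpl never.

Lemma smooth_derivable f t v : smooth f -> derivable f t v.
Proof. by move=> sf; apply/diff_derivable/smooth_differentiable. Qed.
Hint Resolve smooth_derivable : core.

Lemma pd_cst i c : pd i (fun=> c) = fun=> 0.
Proof. by apply/funext => t; rewrite /pd derive_cst. Qed.

Lemma pd_coord i k : pd i (fun t => t ord0 k) = fun=> (k == i)%:R.
Proof.
apply/funext => t; rewrite /pd deriveE; last exact: differentiable_coord.
have lf : linear (fun t : 'rV[R]_n => t ord0 k : R^o).
  by move=> a u v; rewrite !mxE.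
pose F := GRing.isLinear.Build _ _ _ _ _ lf.
pose G : {linear 'rV[R]_n -> R^o} := HB.pack (fun t : 'rV[R]_n => t ord0 k : R^o) F.
rewrite -[X in 'd X _]/(G : _ -> _) diff_lin; first by rewrite /= !mxE eqxx.
exact: (@coord_continuous _ _ _ ord0 k).
Qed.

Lemma pdD i f g : smooth f -> smooth g ->
  pd i (fun t => f t + g t) = fun t => pd i f t + pd i g t.
Proof.
move=> sf sg; apply/funext => t.
by rewrite /pd -[LHS]/('D_(basisv i) (f \+ g) t) deriveD; auto.
Qed.

Lemma pdM i f g : smooth f -> smooth g ->
  pd i (fun t => f t * g t) = fun t => pd i f t * g t + f t * pd i g t.
Proof.
move=> sf sg; apply/funext => t.
rewrite /pd -[LHS]/('D_(basisv i) (f * g) t) deriveM; auto.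
by rewrite /GRing.scale /=; ring.
Qed.

Lemma pdV i f : smooth f -> (forall t, f t != 0) ->
  pd i (fun t => (f t)^-1) = fun t => - pd i f t * ((f t)^-1 * (f t)^-1).
Proof.
move=> sf f0; apply/funext => t.
by rewrite /pd deriveV; auto; rewrite /GRing.scale /= expr2 invfM; ring.
Qed.

Lemma smooth_opp f : smooth f -> smooth (fun t => - f t).
Proof.
move=> sf; rewrite (_ : (fun t => _) = fun t => -1 * f t).
  by apply: smooth_mul => //; exact: smooth_cst.
by apply/funext => t; rewrite mulN1r.
Qed.

Lemma pdZ i c f : smooth f -> pd i (fun t => c * f t) = fun t => c * pd i f t.
Proof.
move=> sf; rewrite pdM//; last exact: smooth_cst.
by rewrite pd_cst; apply/funext => t; rewrite mul0r add0r.
Qed.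

Lemma pdN i f : smooth f -> pd i (fun t => - f t) = fun t => - pd i f t.
Proof.
move=> sf; rewrite (_ : (fun t => - f t) = fun t => -1 * f t).
  by rewrite pdZ//; apply/funext => t; rewrite mulN1r.
by apply/funext => t; rewrite mulN1r.
Qed.

Lemma smooth_pd i f : smooth f -> smooth (pd i f).
Proof.
elim=> {f} [c|k|f g sf df sg dg|f g sf df sg dg|f sf df f0].
- by rewrite pd_cst; exact: smooth_cst.
- by rewrite pd_coord; exact: smooth_cst.
- by rewrite pdD//; exact: smooth_add.
- by rewrite pdM//; apply: smooth_add; exact: smooth_mul.
- rewrite pdV//; apply: smooth_mul; first exact: smooth_opp.
  by apply: smooth_mul; exact: smooth_inv.
Qed.

Lemma smooth_sum I (s : seq I) (P : pred I) (F : I -> 'rV[R]_n -> R) :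
  (forall a, smooth (F a)) -> smooth (fun t => \sum_(a <- s | P a) F a t).
Proof.
move=> sF; elim: s => [|a s IH].
  rewrite (_ : (fun t => _) = fun=> 0); first exact: smooth_cst.
  by apply/funext => t; rewrite big_nil.
rewrite (_ : (fun t => _) =
  fun t => (if P a then F a t else 0) + \sum_(b <- s | P b) F b t).
  by apply: smooth_add => //; case: (P a) => //; exact: smooth_cst.
by apply/funext => t; rewrite big_cons; case: ifP => // _; rewrite add0r.
Qed.

Lemma pd_sum i I (s : seq I) (F : I -> 'rV[R]_n -> R) :
  (forall a, smooth (F a)) ->
  pd i (fun t => \sum_(a <- s) F a t) = fun t => \sum_(a <- s) pd i (F a) t.
Proof.
move=> sF; elim: s => [|a s IH].
  rewrite (_ : (fun t => \sum_(_ <- _) _) = fun=> 0).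
    by rewrite pd_cst; apply/funext => t; rewrite big_nil.
  by apply/funext => t; rewrite big_nil.
rewrite (_ : (fun t => _) = fun t => F a t + \sum_(b <- s) F b t).
  rewrite pdD//; last exact: smooth_sum.
  by apply/funext => t; rewrite big_cons IH.
by apply/funext => t; rewrite big_cons.
Qed.

Lemma smooth_exp f k : smooth f -> smooth (fun t => f t ^+ k).
Proof.
move=> sf; elim: k => [|k IH].
  by rewrite (_ : (fun t => _) = fun=> 1); [exact: smooth_cst|apply/funext].
rewrite (_ : (fun t => _) = fun t => f t * f t ^+ k); first exact: smooth_mul.
by apply/funext => t; rewrite exprS.
Qed.

Lemma pd_exp i f k : smooth f ->
  pd i (fun t => f t ^+ k) = fun t => k%:R * f t ^+ k.-1 * pd i f t.
Proof.
move=> sf; elim: k => [|k IH].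
  rewrite (_ : (fun t => f t ^+ 0) = fun=> 1); last exact/funext.
  by rewrite pd_cst; apply/funext => t; rewrite !mul0r.
rewrite (_ : (fun t => f t ^+ k.+1) = fun t => f t * f t ^+ k); last first.
  by apply/funext => t; rewrite exprS.
rewrite pdM//; last exact: smooth_exp.
rewrite IH; apply/funext => t /=; case: k {IH} => [|k] /=.
  by rewrite !expr0; ring.
by rewrite -[in RHS]natr1 exprS; ring.
Qed.

Lemma smooth_prod I (s : seq I) (F : I -> 'rV[R]_n -> R) :
  (forall a, smooth (F a)) -> smooth (fun t => \prod_(a <- s) F a t).
Proof.
move=> sF; elim: s => [|a s IH].
  rewrite (_ : (fun t => _) = fun=> 1); first exact: smooth_cst.
  by apply/funext => t; rewrite big_nil.
rewrite (_ : (fun t => _) = fun t => F a t * \prod_(b <- s) F b t).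
  exact: smooth_mul.
by apply/funext => t; rewrite big_cons.
Qed.

Lemma smooth_iter_partial a f : smooth f -> smooth (iter_partial a f).
Proof. by move=> sf; elim: a => //= i a; exact: smooth_pd. Qed.

Lemma laplacianE f t : laplacian f t = \sum_(i < n) pd i (pd i f) t.
Proof. by []. Qed.

Lemma smooth_evalp (q : mpoly.mpoly n R) : smooth (evalp q).
Proof.
rewrite (_ : evalp q = fun t => \sum_(mm <- mpoly.msupp q)
   mpoly.mcoeff mm q * \prod_(i <- enum 'I_n) t ord0 i ^+ mpoly.fun_of_multinom mm i).
  apply: smooth_sum => mm; apply: smooth_mul; first exact: smooth_cst.
  by apply: smooth_prod => i; apply: smooth_exp; exact: smooth_coord.
apply/funext => t; rewrite /evalp mpoly.mevalE; apply: eq_bigr => mm _.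
by congr (_ * _); rewrite big_enum.
Qed.

Lemma evalp_homogeneous d (q : mpoly.mpoly n R) c t : homogeneous d q ->
  evalp q (c *: t) = c ^+ d * evalp q t.
Proof.
move=> hq; rewrite /evalp !mpoly.mevalE big_distrr /= big_seq [RHS]big_seq.
apply: eq_bigr => mm mms.
have <- : mpoly.mdeg mm = d.
  by move: hq => /mpoly.dhomogP/(_ mm mms).
rewrite mulrCA; congr (_ * _); rewrite mpoly.mdegE -prodrXr -big_split /=.
by apply: eq_bigr => i _; rewrite !mxE exprMn.
Qed.

Lemma pd_monomial i (mm : mpoly.multinom n) :
  pd i (fun t => \prod_(k < n) t ord0 k ^+ mpoly.fun_of_multinom mm k) =
  fun t => (mpoly.fun_of_multinom mm i)%:R *
    \prod_(k < n) t ord0 k ^+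
      mpoly.fun_of_multinom (mpoly.mnm_sub mm (mpoly.mnm1 i)) k.
Proof.
set e := mpoly.fun_of_multinom mm.
(* [g] collects the variables other than the differentiated one. If [e i = 0], the truncated
   exponent is harmless because the coefficient in front is zero. *)
pose g t := \prod_(k <- [seq k <- enum 'I_n | k != i]) t ord0 k ^+ e k.
have sg : smooth g.
  by apply: smooth_prod => k; apply: smooth_exp; exact: smooth_coord.
have gE t : \prod_(k < n | k != i) t ord0 k ^+ e k = g t.
  by rewrite /g big_filter big_enum_cond.
have pg : pd i g = fun=> 0.
  have : all (fun k => k != i) [seq k <- enum 'I_n | k != i].
    by apply/allP => k; rewrite mem_filter => /andP[].
  rewrite /g; elim: [seq k <- _ | _] => [_|k s IH /= /andP[ki si]].
    rewrite (_ : (fun t => _) = fun=> 1) ?pd_cst//.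
    by apply/funext => t; rewrite big_nil.
  rewrite (_ : (fun t => _) =
    fun t => t ord0 k ^+ e k * \prod_(j <- s) t ord0 j ^+ e j).
    rewrite pdM; last 2 first.
    - by apply: smooth_exp; exact: smooth_coord.
    - by apply: smooth_prod => j; apply: smooth_exp; exact: smooth_coord.
    rewrite IH// pd_exp; last exact: smooth_coord.
    by apply/funext => t; rewrite pd_coord (negbTE ki) mulr0 mul0r mulr0 addr0.
  by apply/funext => t; rewrite big_cons.
rewrite (_ : (fun t => _) = fun t => t ord0 i ^+ e i * g t); last first.
  by apply/funext => t; rewrite (bigD1 i)//= gE.
rewrite pdM//; last by apply: smooth_exp; exact: smooth_coord.
rewrite pg pd_exp; last exact: smooth_coord.
apply/funext => t; rewrite pd_coord eqxx mulr1 mulr0 addr0 -mulrA.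
congr (_ * _); rewrite (bigD1 i)//=.
rewrite mpoly.mnmBE mpoly.mnm1E eqxx subn1; congr (_ * _).
rewrite -gE; apply: eq_bigr => k ki.
by rewrite mpoly.mnmBE mpoly.mnm1E eq_sym (negbTE ki) subn0.
Qed.

Lemma pd_evalp i (q : mpoly.mpoly n R) :
  pd i (evalp q) = evalp (mpoly.mderiv i q).
Proof.
have sm (mm : mpoly.multinom n) :
    smooth (fun t => \prod_(k < n) t ord0 k ^+ mpoly.fun_of_multinom mm k).
  rewrite (_ : (fun t => _) =
    fun t => \prod_(k <- enum 'I_n) t ord0 k ^+ mpoly.fun_of_multinom mm k).
    by apply: smooth_prod => k; apply: smooth_exp; exact: smooth_coord.
  by apply/funext => t; rewrite big_enum.
rewrite (_ : evalp q = fun t => \sum_(mm <- mpoly.msupp q)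
   mpoly.mcoeff mm q * \prod_(k < n) t ord0 k ^+ mpoly.fun_of_multinom mm k).
  rewrite pd_sum; last by move=> mm; apply: smooth_mul => //; exact: smooth_cst.
  apply/funext => t; rewrite /evalp /mpoly.mderiv.
  rewrite (big_morph _ (mpoly.mevalD _) (mpoly.meval0 _)).
  apply: eq_bigr => mm _; rewrite mpoly.mevalZ mpoly.mevalX.
  rewrite pdZ// pd_monomial; ring.
by apply/funext => t; rewrite /evalp mpoly.mevalE.
Qed.

(** Induction on the degree of the monomial: differentiation moves the coefficient to a monomial of
    lower degree, multiplied by a positive integer, and the derivative again vanishes identically.
    The constant coefficient is the value at 0. *)
Lemma mcoeff_evalp0 (q : mpoly.mpoly n R) mm :
  (forall t, evalp q t = 0) -> mpoly.mcoeff mm q = 0.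
Proof.
have [k] := ubnP (mpoly.mdeg mm); elim: k => // k IH in mm q * => mk q0.
have [i mi|m0] := pickP (fun i => mpoly.fun_of_multinom mm i != 0%N).
  pose m' := mpoly.mnm_sub mm (mpoly.mnm1 i).
  have mE : mpoly.mnm_add m' (mpoly.mnm1 i) = mm.
    by apply: mpoly.submK; rewrite mpoly.lep1mP.
  have := mpoly.mcoeff_deriv i m' q; rewrite mE IH.
  - by move/esym/eqP; rewrite mulrn_eq0 /= => /eqP.
  - by move: mk; rewrite -[in X in X -> _]mE mpoly.mdegD mpoly.mdeg1 addn1 ltnS.
  - move=> t; rewrite -pd_evalp (_ : evalp q = fun=> 0) ?pd_cst//.
    exact/funext.
have -> : mm = mpoly.mnm0.
  apply/mpoly.mnmP => i; rewrite mpoly.mnm0E; apply/eqP.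
  by have /negbFE := m0 i.
rewrite -[RHS](q0 0) /evalp.
rewrite (_ : (fun i => _) = fun=> 0); last by apply/funext => i; rewrite mxE.
rewrite mpoly.mevalE.
have [q0s|q0s] := boolP (mpoly.mnm0 \in mpoly.msupp q).
  rewrite (bigD1_seq _ q0s)/=; last exact: mpoly.msupp_uniq.
  rewrite (big1 _ _ (fun i => _ ^+ _)) ?mulr1.
    rewrite big1 ?addr0// => m' m'0.
    have [i mi|m0'] := pickP (fun i => mpoly.fun_of_multinom m' i != 0%N).
      by rewrite (bigD1 i)//= expr0n (negbTE mi) mul0r mulr0.
    case/eqP: m'0; apply/mpoly.mnmP => i; rewrite mpoly.mnm0E; apply/eqP.
    by have /negbFE := m0' i.
  by move=> i _; rewrite mpoly.mnm0E expr0.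
rewrite (mpoly.memN_msupp_eq0 q0s) big_seq big1// => m' m's.
have [i mi|m0'] := pickP (fun i => mpoly.fun_of_multinom m' i != 0%N).
  by rewrite (bigD1 i)//= expr0n (negbTE mi) mul0r mulr0.
case/negP: q0s; rewrite (_ : mpoly.mnm0 = m')//.
apply/mpoly.mnmP => i; rewrite mpoly.mnm0E; apply/esym/eqP.
by have /negbFE := m0' i.
Qed.

Lemma evalp_neq0 (q : mpoly.mpoly n R) : q != 0 -> exists t, evalp q t != 0.
Proof.
move=> q0; apply: contrapT => H; case/eqP: q0; apply/mpoly.mpolyP => mm.
rewrite mpoly.mcoeff0; apply: mcoeff_evalp0 => t.
by apply/eqP; apply: contrapT => /negP h; apply: H; exists t.
Qed.

End Smooth.
Arguments pd : simpl never.

(** * The maximum principle and gradient bounds on the lattice *)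

Section Lattice.
Context {R : realType} {n : nat}.
Implicit Types (x y z : 'rV[int]_n) (v : 'rV[int]_n -> R) (i k : 'I_n) (N : nat).

Definition ev i : 'rV[int]_n := delta_mx 0 i.

Definition inbox N x : bool := [forall i, `|x 0 i| <= N%:Z].

Lemma inboxP N x : reflect (forall i, `|x 0 i| <= N%:Z) (inbox N x).
Proof. exact: forallP. Qed.

(** Both [dif] and [lap1] use unit spacing; the powers of the mesh number are supplied later by [dq]
    and [lapq]. *)
Definition dif i v x : R := v (x + ev i) - v x.
Definition lap1 v x : R :=
  \sum_i (v (x + ev i) + v (x - ev i) - 2 * v x).

Lemma ev_eq i k : ev i 0 k = (k == i)%:R.
Proof. by rewrite mxE eqxx. Qed.

Definition box_pt N (t : 'rV['I_N.*2.+1]_n) : 'rV[int]_n :=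
  \row_i ((t 0 i : nat)%:Z - N%:Z).

Lemma box_pt_inj N : injective (@box_pt N).
Proof.
move=> s t /rowP st; apply/rowP => i; have := st i; rewrite !mxE.
by move=> h; apply/val_inj => /=; lia.
Qed.

Lemma box_pt_in N t : inbox N (@box_pt N t).
Proof.
by apply/inboxP => i; rewrite mxE; have := ltn_ord (t 0 i); lia.
Qed.

Lemma box_ptP N x : inbox N x -> exists t, x = @box_pt N t.
Proof.
move/inboxP => xN; exists (\row_i inord (absz (x 0 i + N%:Z))).
apply/rowP => i; rewrite !mxE inordK; have := xN i; first lia.
by lia.
Qed.

Lemma box_argmax N (S : pred 'rV[int]_n) v :
  (exists2 x, inbox N x & S x) ->
  exists x, [/\ inbox N x, S x & forall y, inbox N y -> S y -> v y <= v x].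
Proof.
move=> [_ /box_ptP[t0 ->] St0].
case: (@arg_maxP _ _ _ t0 (fun t => S (@box_pt N t)) (fun t => v (box_pt t)) St0).
move=> t St tmax; exists (box_pt t); split=> //; first exact: box_pt_in.
by move=> _ /box_ptP[s ->]; exact: tmax.
Qed.

(** This reflection exchanges [0] and [ev i], so the difference of [v] along that edge becomes a
    value of the odd function [phi = v - v \o refl i]. *)
Definition refl i x : 'rV[int]_n :=
  \row_k (if k == i then 1 - x 0 k else x 0 k).

Lemma reflD i x k :
  refl i (x + ev k) = if k == i then refl i x - ev k else refl i x + ev k.
Proof.
case: eqVneq => [->|ki]; apply/rowP => l; rewrite !mxE !eqxx /=.
  by case: eqVneq => _ /=; lia.
by case: (eqVneq l i) => [->|_] //; rewrite eq_sym (negbTE ki) /=; lia.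
Qed.

Lemma reflB i x k :
  refl i (x - ev k) = if k == i then refl i x + ev k else refl i x - ev k.
Proof.
case: eqVneq => [->|ki]; apply/rowP => l; rewrite !mxE !eqxx /=.
  by case: eqVneq => _ /=; lia.
by case: (eqVneq l i) => [->|_] //; rewrite eq_sym (negbTE ki) /=; lia.
Qed.

Lemma lap1_refl i v x : lap1 (v \o refl i) x = lap1 v (refl i x).
Proof.
apply: eq_bigr => k _ /=; rewrite reflD reflB; case: ifP => // _.
by rewrite [X in X - _]addrC.
Qed.

Lemma sqD x k (s : int) :
  \sum_l (((x + s *: ev k) 0 l)%:~R : R) ^+ 2 =
  \sum_l (x 0 l)%:~R ^+ 2 + (2 * (x 0 k)%:~R * s%:~R + s%:~R ^+ 2).
Proof.
rewrite (bigD1 k)//= [in RHS](bigD1 k)//= !mxE !eqxx mulr1 rmorphD /=.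
rewrite (eq_bigr (fun l => (x 0 l)%:~R ^+ 2)) => [|l lk].
  ring.
by rewrite !mxE eqxx (negbTE lk) mulr0 addr0.
Qed.

(* Reflecting [v] across the hyperplane [x_i = 1/2] gives a function that is odd
   across it, and the quadratic barrier [psi] bounds it by the maximum principle. *)
Lemma dif_le v N (M F : R) i : (0 < N)%N -> 0 < M -> 0 <= F ->
  (forall x, inbox N.+1 x -> `|v x| <= M) ->
  (forall x, inbox N x -> `|lap1 v x| <= F) ->
  v (ev i) - v 0 <= (2 * n%:R + 3) * M / N%:R + F * N%:R.
Proof.
move=> N0 M0 F0 vM vF.
have N0R : (0 : R) < N%:R by rewrite ltr0n.
have N1R : (1 : R) <= N%:R by rewrite ler1n.
have NN0 : (0 : R) < N%:R ^+ 2 by rewrite exprn_gt0.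
(* [A] makes the quadratic part of [psi] at least [2 M], the trivial bound on [phi], once a
   coordinate reaches [N] in absolute value. [K] makes the Laplacian of [psi] equal to [- 2 F - A],
   strictly below the lower bound [- 2 F] for that of [phi]. *)
pose A : R := 2 * M / N%:R ^+ 2.
have A0 : 0 < A by rewrite divr_gt0// mulr_gt0.
pose K : R := n%:R * A + F + A / 2.
have K0 : 0 < K.
  rewrite /K; apply: ltr_wpDl; last by rewrite divr_gt0.
  by rewrite addr_ge0// mulr_ge0// ltW.
pose psi x : R := A * (\sum_l (x 0 l)%:~R ^+ 2)
  + K * ((x 0 i)%:~R * (N%:R - (x 0 i)%:~R)).
pose phi x : R := v x - v (refl i x).
have psi_lap x : lap1 psi x = 2 * n%:R * A - 2 * K.
  rewrite /lap1 (eq_bigr (fun k => 2 * A - (if k == i then 2 * K else 0))).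
    rewrite big_split /= sumrN -big_mkcond /= big_pred1_eq sumr_const card_ord.
    by rewrite -mulr_natr; ring.
  move=> k _; rewrite /psi.
  have -> : x + ev k = x + 1 *: ev k by rewrite scale1r.
  have -> : x - ev k = x + (-1) *: ev k by rewrite scaleN1r.
  rewrite !sqD !mxE eqxx /=; case: eqVneq => _; rewrite /= ?eqxx /=.
    by rewrite !(mulr1, rmorphD, rmorphN, mulr0, addr0) /=; ring.
  by rewrite !(mulr1, rmorphD, rmorphN, mulr0, addr0) /=; ring.
have phi_lap x : inbox N x -> inbox N (refl i x) -> - (2 * F) <= lap1 phi x.
  move=> xN rN; have -> : lap1 phi x = lap1 v x - lap1 v (refl i x).
    rewrite -lap1_refl /lap1 -sumrB; apply: eq_bigr => k _ /=.
    by rewrite /phi; ring.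
  have := vF _ xN; have := vF _ rN; rewrite !ler_norml => /andP[_ h1] /andP[h2 _].
  lra.
have psi0 x : 0 <= x 0 i -> x 0 i <= N%:Z -> 0 <= psi x.
  move=> x0 xN; rewrite addr_ge0//.
    by rewrite mulr_ge0 ?(ltW A0)// sumr_ge0// => l _; rewrite sqr_ge0.
  rewrite mulr_ge0 ?(ltW K0)// mulr_ge0 ?ler0z// subr_ge0.
  by rewrite -[leRHS]/((N%:Z)%:~R) ler_int.
have psiB x : 0 <= x 0 i -> x 0 i <= N%:Z -> (exists k, `|x 0 k| = N%:Z) ->
    2 * M <= psi x.
  move=> x0 xN [k xk].
  rewrite -[leLHS]addr0 lerD//; last first.
    rewrite mulr_ge0 ?(ltW K0)// mulr_ge0 ?ler0z// subr_ge0.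
    by rewrite -[leRHS]/((N%:Z)%:~R) ler_int.
  rewrite (bigD1 k)//= mulrDr -[leLHS]addr0 lerD//.
    have -> : ((x 0 k)%:~R : R) ^+ 2 = N%:R ^+ 2.
      by rewrite -real_normK ?num_real// -intr_norm xk.
    by rewrite /A mulfVK// gt_eqF.
  by rewrite mulr_ge0 ?(ltW A0)// sumr_ge0// => l _; rewrite sqr_ge0.
have boxS x : inbox N x -> inbox N.+1 x.
  by move/inboxP => h; apply/inboxP => k; have := h k; clear; lia.
have rbox x : inbox N x -> 0 <= x 0 i -> inbox N.+1 (refl i x).
  move/inboxP => h x0; apply/inboxP => k; have := h k; rewrite mxE.
  by move: x0; clear; case: eqVneq => [->|_]; lia.
have phiM x : inbox N x -> 0 <= x 0 i -> phi x <= 2 * M.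
  move=> xN x0; have := vM _ (boxS _ xN); have := vM _ (rbox _ xN x0).
  by rewrite !ler_norml /phi => /andP[h1 h2] /andP[h3 h4]; lra.
have psie : psi (ev i) <= (2 * n%:R + 3) * M / N%:R + F * N%:R.
  rewrite /psi (bigD1 i)//= ev_eq eqxx (eq_bigr (fun=> 0)) => [|l li]; last first.
    by rewrite ev_eq (negbTE li) /= expr0n.
  rewrite sumr_const mul0rn addr0 /= expr1n mulr1 mul1r.
  have AN : A * N%:R = 2 * M / N%:R.
    by rewrite /A; field; rewrite gt_eqF.
  have KN : K * N%:R = n%:R * (2 * M / N%:R) + F * N%:R + M / N%:R.
    by rewrite /K 2!mulrDl -AN; congr (_ + _ + _); [ring|rewrite /A; field; rewrite gt_eqF].
  have -> : (2 * n%:R + 3) * M / N%:R = n%:R * (2 * M / N%:R) + M / N%:R + 2 * M / N%:R :> R.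
    by ring.
  rewrite mulrBr KN mulr1.
  have : A <= 2 * M / N%:R.
    by rewrite -AN ler_peMr// ltW.
  by lra.
apply: le_trans psie.
have -> : v (ev i) - v 0 = phi (ev i).
  rewrite /phi; congr (_ - v _); apply/rowP => k; rewrite !mxE eqxx.
  by case: eqVneq => _ /=; rewrite ?subrr.
rewrite leNgt; apply/negP => lt_psi.
have eN : inbox N (ev i).
  by apply/inboxP => k; rewrite ev_eq; move: N0; clear; case: (k == i) => /=; lia.
have [z [zN zi zmax]] := @box_argmax N (fun x => 1 <= x 0 i) (fun x => phi x - psi x)
  (ex_intro2 _ _ (ev i) eN (eq_ind_r (fun c => 1 <= c) (lexx 1) (etrans (ev_eq i i)
     (congr1 (fun b : bool => b%:R) (eqxx i))))).
have zpos : psi z < phi z.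
  rewrite -subr_gt0; apply: lt_le_trans (zmax _ eN _); first by rewrite subr_gt0.
  by rewrite ev_eq eqxx.
have zNi : z 0 i <= N%:Z by move/inboxP: (zN) => /(_ i); clear; lia.
have z0 : 0 <= z 0 i by move: zi; clear; lia.
have zint k : `|z 0 k| < N%:Z.
  rewrite lt_neqAle (inboxP _ _ zN k) andbT; apply/negP => /eqP zk.
  have := psiB z z0 zNi (ex_intro _ k zk); have := phiM z zN z0.
  by move: zpos; lra.
have phi0 : 0 < phi z := le_lt_trans (psi0 z z0 zNi) zpos.
have nbD k : phi (z + ev k) - psi (z + ev k) <= phi z - psi z.
  apply: zmax.
    apply/inboxP => l; rewrite !mxE eqxx /=; have := inboxP _ _ zN l.
    by have := zint l; clear; case: (l == k) => /=; lia.
  by rewrite mxE ev_eq; move: zi; clear; case: (i == k) => /=; lia.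
have nbB k : phi (z - ev k) - psi (z - ev k) <= phi z - psi z.
  have zkN : inbox N (z - ev k).
    apply/inboxP => l; have -> : (z - ev k) 0 l = z 0 l - (l == k)%:R by rewrite !mxE eqxx.
    have := inboxP _ _ zN l; have := zint l.
    by clear; case: (l == k) => /=; lia.
  have [h|h] := lerP 1 ((z - ev k) 0 i); first exact: zmax.
  (* The only neighbour of [z] outside the half box is its mirror image, in the layer [x_i = 0].
     There [phi] takes the value [- phi z < 0] while [psi] is nonnegative. *)
  have hk : i = k.
    apply/eqP; apply: contraLR h => ik; rewrite -leNgt mxE mxE ev_eq (negbTE ik) /=.
    by rewrite subr0.
  have z1 : z 0 i = 1.
    by move: h zi; rewrite mxE mxE ev_eq -hk eqxx /=; clear; lia.
  have zr : phi (z - ev k) = - phi z.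
    have hr : refl i z = z - ev k.
      apply/rowP => l; rewrite !mxE eqxx /= -hk.
      by case: eqVneq => [->|_]; rewrite /= ?z1; clear; lia.
    have hr' : refl i (z - ev k) = z by rewrite reflB -hk eqxx hr -hk subrK.
    by rewrite /phi hr' hr opprB.
  have : 0 <= psi (z - ev k).
    by apply: psi0; rewrite mxE mxE ev_eq -hk eqxx z1 /=; clear; lia.
  by rewrite zr; move: zpos phi0; lra.
(* At the maximum the Laplacian of [phi - psi] is at most 0, whereas the two values computed above
   make it at least [A > 0]. *)
have : lap1 phi z - lap1 psi z <= 0.
  rewrite /lap1 -sumrB sumr_le0// => k _.
  by have := nbD k; have := nbB k; lra.
have rN : inbox N (refl i z).
  apply/inboxP => k; rewrite mxE; have := zint k; move: (zi); clear; case: eqP => [->|_]; lia.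
have := phi_lap z zN rN; rewrite psi_lap /K.
by move: A0; lra.
Qed.

Lemma dif_norm_le v N (M F : R) i : (0 < N)%N -> 0 < M -> 0 <= F ->
  (forall x, inbox N.+1 x -> `|v x| <= M) ->
  (forall x, inbox N x -> `|lap1 v x| <= F) ->
  `|v (ev i) - v 0| <= (2 * n%:R + 3) * M / N%:R + F * N%:R.
Proof.
move=> N0 M0 F0 vM vF; rewrite ler_norml; apply/andP; split; last exact: dif_le.
rewrite lerNl opprB -[v 0]opprK addrC.
apply: (@dif_le (fun x => - v x)) => // x xN; first by rewrite normrN vM.
rewrite (_ : lap1 _ _ = - lap1 v x) ?normrN ?vF//.
by rewrite /lap1 -sumrN; apply: eq_bigr => k _; ring.
Qed.

(* Walk from [x] to [y] by unit steps that decrease the l1 distance to [y]. *)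
Lemma lattice_lip v (C : R) K y : inbox K y ->
  forall x, inbox K x ->
  (forall z i, inbox K z ->
     \sum_l `|z 0 l - y 0 l| <= \sum_l `|x 0 l - y 0 l| ->
     `|dif i v z| <= C) ->
  `|v x - v y| <= C * (\sum_l `|x 0 l - y 0 l|)%:~R.
Proof.
move=> yK x.
have [m] := ubnP (absz (\sum_l `|x 0 l - y 0 l|)).
elim: m => // m IH in x * => lexm xK hC.
have s0 (z : 'rV[int]_n) : 0 <= \sum_l `|z 0 l - y 0 l| by apply: sumr_ge0.
have [i xi|xy] := pickP (fun i => x 0 i != y 0 i); last first.
  have -> : x = y by apply/rowP => i; have /negbFE/eqP := xy i.
  by rewrite subrr normr0 big1 ?mulr0// => l _; rewrite subrr normr0.
pose s : int := if x 0 i < y 0 i then 1 else -1.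
pose x' := x + s *: ev i.
have x'E l : x' 0 l = x 0 l + s * (l == i)%:R by rewrite !mxE eqxx.
have x'K : inbox K x'.
  apply/inboxP => l; rewrite x'E; have := inboxP _ _ xK l; have := inboxP _ _ yK l.
  by case: eqP => [->|_] /=; rewrite ?mulr0 ?addr0// mulr1 /s; move/eqP: xi; clear; case: ltP => /=; lia.
have sumE : \sum_l `|x 0 l - y 0 l| = \sum_l `|x' 0 l - y 0 l| + 1.
  rewrite (bigD1 i)//= [in RHS](bigD1 i)//= x'E eqxx.
  rewrite [in RHS](eq_bigr (fun l => `|x 0 l - y 0 l|)) => [|l li].
    rewrite addrAC; congr (_ + _).
    by rewrite mulr1 /s; move/eqP: xi; clear; case: ltP => /=; lia.
  by rewrite x'E (negbTE li) mulr0 addr0.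
have step : `|v x - v x'| <= C.
  rewrite /x' /s; case: ifP => h.
    by rewrite scale1r -normrN opprB; apply: hC.
  rewrite scaleN1r.
  have -> : v x - v (x - ev i) = dif i v (x - ev i) by rewrite /dif subrK.
  apply: hC.
    by have := x'K; rewrite /x' /s h scaleN1r.
  have -> : x - ev i = x' by rewrite /x' /s h scaleN1r.
  by rewrite sumE lerDl.
have := IH x' _ x'K _.
move=> /(_ _ _)/wrap[]; first by move: (s0 x') lexm; rewrite sumE; move: (\sum_l `|x' 0 l - y 0 l|) => S; clear; lia.
  by move=> z k zK zx; apply: hC => //; rewrite (le_trans zx)// sumE lerDl.
move=> IH'; rewrite sumE rmorphD /= mulrDr mulr1.
have -> : v x - v y = (v x' - v y) + (v x - v x') by ring.
by apply: le_trans (ler_normD _ _) _; exact: lerD.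
Qed.

End Lattice.

(** * Ground states on lattice boxes *)

Section Compactness.
Context {R : realType} {n : nat}.

Lemma compact_box (r : R) : compact [set t : 'rV[R]_n | forall i, `|t ord0 i| <= r].
Proof.
have := @rV_compact R n (fun=> `[- r, r]%classic) (fun=> @segment_compact _ _ _).
congr compact; apply/seteqP; split=> t /= h i; have := h i.
  by rewrite in_itv /= ler_norml.
by rewrite ler_norml in_itv.
Qed.

Lemma box_EVT_max (f : 'rV[R]_n -> R) (C : set 'rV[R]_n) (r : R) :
  continuous f -> closed C -> C !=set0 ->
  (forall t, C t -> forall i, `|t ord0 i| <= r) ->
  exists2 t0, C t0 & forall t, C t -> f t <= f t0.
Proof.
move=> cf cC C0 Cr.
have compC : compact C.
  exact: (subclosed_compact cC (@compact_box r) Cr).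
have [t0] := EVT_max_rV C0 compC (continuous_subspaceT cf).
rewrite inE => Ct0 t0max; exists t0 => // t Ct; apply: t0max; exact/mem_set.
Qed.

Lemma box_EVT_min (f : 'rV[R]_n -> R) (C : set 'rV[R]_n) (r : R) :
  continuous f -> closed C -> C !=set0 ->
  (forall t, C t -> forall i, `|t ord0 i| <= r) ->
  exists2 t0, C t0 & forall t, C t -> f t0 <= f t.
Proof.
move=> cf cC C0 Cr.
have [|t0 Ct0 h] := @box_EVT_max (fun t => - f t) C r _ cC C0 Cr.
  by move=> t; apply: continuousN; exact: cf.
by exists t0 => // t /h; rewrite lerN2.
Qed.

Lemma closed_le_fun (f g : 'rV[R]_n -> R) : continuous f -> continuous g ->
  closed [set t | f t <= g t].
Proof.
move=> cf cg.
rewrite (_ : [set t | _] = (fun t => f t - g t) @^-1` [set x | x <= 0]).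
  apply: preimage_closed; last exact: closed_le.
  by move=> t _; apply: (@continuousB _ _ _ f g); [exact: cf|exact: cg].
by apply/seteqP; split=> t /=; rewrite subr_le0.
Qed.

Lemma closed_eq_fun (f g : 'rV[R]_n -> R) : continuous f -> continuous g ->
  closed [set t | f t = g t].
Proof.
move=> cf cg.
rewrite (_ : [set t | _] = [set t | f t <= g t] `&` [set t | g t <= f t]).
  by apply: closedI; exact: closed_le_fun.
apply/seteqP; split=> t /=; first by move=> ->.
by move=> [h1 h2]; apply/eqP; rewrite eq_le h1 h2.
Qed.

End Compactness.

Section QuadraticGroundState.
Context {R : realType} {N : nat}.
Variables (A : 'I_N -> 'I_N -> R) (p : 'I_N -> R) (delta : R).

Definition bil (u v : 'I_N -> R) : R := \sum_i \sum_j u i * A i j * v j.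
Definition wsq (v : 'I_N -> R) : R := \sum_i p i * v i ^+ 2.

Hypothesis Asym : forall i j, A i j = A j i.
Hypothesis Aoff : forall i j, i != j -> A i j <= 0.
Hypothesis delta0 : 0 < delta.
Hypothesis Acoer : forall v, delta * (\sum_i v i ^+ 2) <= bil v v.
Hypothesis p_ge0 : forall i, 0 <= p i.
Hypothesis p_gt0 : exists i, 0 < p i.

Lemma bil_lin u v t g : bil (fun i => u i + t * g i) v = bil u v + t * bil g v.
Proof.
rewrite /bil mulr_sumr -big_split; apply: eq_bigr => i _ /=.
rewrite mulr_sumr -big_split; apply: eq_bigr => j _ /=; ring.
Qed.

Lemma bilC u v : bil u v = bil v u.
Proof.
rewrite /bil exchange_big; apply: eq_bigr => i _; apply: eq_bigr => j _.
by rewrite Asym; ring.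
Qed.

Lemma bilZ c u : bil (fun i => c * u i) (fun i => c * u i) = c ^+ 2 * bil u u.
Proof.
rewrite /bil mulr_sumr; apply: eq_bigr => i _; rewrite mulr_sumr.
by apply: eq_bigr => j _; ring.
Qed.

Lemma wsqZ c u : wsq (fun i => c * u i) = c ^+ 2 * wsq u.
Proof. by rewrite /wsq mulr_sumr; apply: eq_bigr => i _; ring. Qed.

(** Vanishing of the first variation at an extremum, tested at [t = a / (|b| + 1)]. *)
Lemma quadratic_le0 (a b : R) : (forall t, 2 * t * a + t ^+ 2 * b <= 0) -> a = 0.
Proof.
move=> h; apply/eqP; apply: contraT => a0.
have c0 : 0 < `|b| + 1 by rewrite ltr_wpDl.
have := h (a / (`|b| + 1)).
have -> : 2 * (a / (`|b| + 1)) * a + (a / (`|b| + 1)) ^+ 2 * b =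
  a ^+ 2 / (`|b| + 1) ^+ 2 * (2 * `|b| + 2 + b).
  by field; rewrite gt_eqF.
apply: contraTT => _; rewrite -ltNge mulr_gt0//.
  by apply: divr_gt0; [rewrite exprn_even_gt0|rewrite exprn_gt0].
by have := ler_norm (- b); rewrite normrN; have := normr_ge0 b; lra.
Qed.

(** The weight [p] may vanish, so [wsq] is maximised on a level set of the coercive form [bil],
    which is compact, instead of [bil] being minimised on a level set of [wsq]. The eigenvalue is
    the inverse of the maximum; the last clause lets test functions bound it from above. *)
Lemma quadratic_ground_state : exists (lam : R) (u : 'I_N -> R),
  [/\ 0 < lam, forall i, 0 <= u i, exists i, 0 < u i,
      forall i, \sum_j A i j * u j = lam * p i * u i
    & forall v, lam * wsq v <= bil v v].
Proof.
pose E (t : 'rV[R]_N) := bil (fun i => t ord0 i) (fun i => t ord0 i).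
pose P (t : 'rV[R]_N) := wsq (fun i => t ord0 i).
have cE : continuous E.
  apply: smooth_continuous; apply: smooth_sum => i; apply: smooth_sum => j.
  apply: smooth_mul; last exact: smooth_coord.
  by apply: smooth_mul; [exact: smooth_coord|exact: smooth_cst].
have cP : continuous P.
  apply: smooth_continuous; apply: smooth_sum => i; apply: smooth_mul.
    exact: smooth_cst.
  by apply: smooth_exp; exact: smooth_coord.
have Egt0 (v : 'I_N -> R) : (exists i, v i != 0) -> 0 < bil v v.
  move=> [i vi]; apply: lt_le_trans (Acoer v); rewrite mulr_gt0//.
  rewrite (bigD1 i)//= ltr_pwDl ?exprn_even_gt0//.
  by apply: sumr_ge0 => k _; rewrite sqr_ge0.
have Enorm (v : 'I_N -> R) : (exists i, v i != 0) ->
    exists c, c ^+ 2 * bil v v = 1.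
  move=> /Egt0 Ev; exists (Num.sqrt (bil v v))^-1.
  by rewrite exprVn sqr_sqrtr ?(ltW Ev)// mulVf// gt_eqF.
have [i0 pi0] := p_gt0.
have O0 : [set t | E t = 1] !=set0.
  have [|c hc] := Enorm (fun i => (i == i0)%:R).
    by exists i0; rewrite eqxx oner_eq0.
  exists (\row_i (c * (i == i0)%:R)); apply: etrans hc; rewrite /= /E -bilZ.
  by rewrite /bil; apply: eq_bigr => i _; apply: eq_bigr => j _; rewrite !mxE.
have Obd t : E t = 1 -> forall i, `|t ord0 i| <= delta^-1 + 1.
  move=> Et i; have := Acoer (fun i => t ord0 i).
  rewrite -/(E t) Et mulrC -ler_pdivlMr// mul1r (bigD1 i)//= => h.
  have h1 : t ord0 i ^+ 2 <= delta^-1.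
    by apply: le_trans h; rewrite lerDl sumr_ge0// => k _; rewrite sqr_ge0.
  have d0 : 0 < delta^-1 by rewrite invr_gt0.
  have := sqr_ge0 (`|t ord0 i| - 1); rewrite sqrrB1 real_normK ?num_real//.
  by rewrite -mulr_natr; move: h1; lra.
have cl : closed [set t | E t = 1].
  by apply: closed_eq_fun => //; exact: cst_continuous.
have [t0 /= Et0 t0max] := box_EVT_max cP cl O0 Obd.
pose mu := P t0.
have PE v : wsq v <= mu * bil v v.
  have [v0|v0] := pselect (exists i, v i != 0); last first.
    have v00 i : v i = 0.
      by apply/eqP/negPn/negP => vi; apply: v0; exists i.
    rewrite /wsq /bil !big1 ?mulr0// => i _; rewrite v00 ?expr0n ?mulr0//.
    by rewrite big1// => j _; rewrite !mul0r.
  have [c hc] := Enorm v v0.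
  have /t0max : E (\row_i (c * v i)) = 1.
    apply: etrans hc; rewrite -bilZ /E /bil.
    by apply: eq_bigr => i _; apply: eq_bigr => j _; rewrite !mxE.
  have -> : P (\row_i (c * v i)) = c ^+ 2 * wsq v.
    by rewrite -wsqZ /P /wsq; apply: eq_bigr => i _; rewrite !mxE.
  rewrite -/mu => h; have := Egt0 v v0.
  move: h; have -> : bil v v = (c ^+ 2)^-1.
    have c0 : c ^+ 2 != 0 by apply/eqP => c0; move: hc; rewrite c0 mul0r => /esym/eqP; rewrite oner_eq0.
    by apply: (mulfI c0); rewrite hc mulfV.
  by move=> h; rewrite invr_gt0 => c0; rewrite ler_pdivlMr// mulrC.
have mu0 : 0 < mu.
  have /Egt0 h : exists i, (i == i0)%:R != 0 :> R by exists i0; rewrite eqxx oner_eq0.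
  rewrite -(pmulr_lgt0 _ h); apply: lt_le_trans (PE _).
  rewrite /wsq (bigD1 i0)//= eqxx expr1n mulr1 ltr_pwDl// sumr_ge0// => i _.
  by rewrite mulr_ge0// sqr_ge0.
(* Passing to absolute values keeps [wsq] and, as the off-diagonal entries of [A] are nonpositive,
   does not increase [bil]. So the maximiser may be taken nonnegative. *)
pose u i := `|t0 ord0 i|.
have Pu : wsq u = mu.
  by apply: eq_bigr => i _; rewrite /u real_normK ?num_real.
have Eu : bil u u = 1.
  apply/eqP; rewrite eq_le; apply/andP; split; last first.
    by have := PE u; rewrite Pu -[leLHS]mulr1 ler_pM2l.
  rewrite -Et0; apply: ler_sum => i _; apply: ler_sum => j _; rewrite /u.
  have [->|ij] := eqVneq i j.
    by rewrite mulrAC [leRHS]mulrAC -!expr2 real_normK ?num_real.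
  rewrite mulrAC [leRHS]mulrAC -normrM mulrC [leRHS]mulrC.
  by rewrite ler_wnM2l ?Aoff// ler_norm.
have upos : exists i, 0 < u i.
  apply: contrapT => H; have u0 i : u i = 0.
    have : 0 <= u i by exact: normr_ge0.
    rewrite le_eqVlt => /orP[/eqP//|ui]; exfalso; apply: H; by exists i.
  by move: mu0; rewrite -Pu /wsq big1 ?ltxx// => i _; rewrite u0 expr0n mulr0.
(* The Euler-Lagrange equation at index [k], from varying [u] along the indicator [g] of [k]. *)
have euler k : p k * u k = mu * \sum_j A k j * u j.
  pose g i : R := (i == k)%:R.
  have gl (w : 'I_N -> R) : \sum_i g i * w i = w k.
    rewrite (bigD1 k)//= /g eqxx mul1r big1 ?addr0// => i ik.
    by rewrite (negbTE ik) mul0r.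
  have Bg : bil g u = \sum_j A k j * u j.
    rewrite /bil -(gl (fun i => \sum_j A i j * u j)); apply: eq_bigr => i _.
    by rewrite mulr_sumr; apply: eq_bigr => j _; rewrite mulrA.
  rewrite -Bg; apply/eqP; rewrite -subr_eq0; apply/eqP.
  apply: (@quadratic_le0 _ (wsq g - mu * bil g g)) => t.
  have := PE (fun i => u i + t * g i).
  rewrite bil_lin !(bilC _ (fun i => u i + t * g i)) !bil_lin Eu [bil u g]bilC.
  have -> : wsq (fun i => u i + t * g i) = mu + 2 * t * (p k * u k) + t ^+ 2 * wsq g.
    rewrite -Pu -(gl (fun i => p i * u i)) /wsq !mulr_sumr -!big_split.
    by apply: eq_bigr => i _ /=; ring.
  by rewrite -subr_le0; congr (_ <= 0); ring.
exists mu^-1, u; split=> //; first by rewrite invr_gt0.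
  by move=> i; exact: normr_ge0.
  by move=> i; rewrite -mulrA euler mulrA mulVf ?mul1r// gt_eqF.
by move=> v; rewrite mulrC ler_pdivrMr// mulrC.
Qed.

End QuadraticGroundState.

Section LatticeGroundState.
Context {R : realType} {n : nat}.
Variables (N : nat) (b delta : R) (q p : 'rV[int]_n -> R).
Hypotheses (b0 : 0 < b) (delta0 : 0 < delta).
Hypotheses (q_ge0 : forall x, 0 <= q x) (p_ge0 : forall x, 0 <= p x).

Local Notation T := 'rV['I_N.*2.+1]_n.
Let pt (i : 'I_#|{: T}|) : 'rV[int]_n := box_pt (enum_val i).

Let pt_inj : injective pt.
Proof. by move=> i j /box_pt_inj/enum_val_inj. Qed.

Let ptP x : inbox N x -> exists i, x = pt i.
Proof.
by move/box_ptP => [t ->]; exists (enum_rank t); rewrite /pt enum_rankK.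
Qed.

Let ext (v : 'I_#|{: T}| -> R) (x : 'rV[int]_n) : R := \sum_j (x == pt j)%:R * v j.

Let ext_pt v i : ext v (pt i) = v i.
Proof.
rewrite /ext (bigD1 i)//= eqxx mul1r big1 ?addr0// => j ji.
by rewrite (inj_eq pt_inj) eq_sym (negbTE ji) mul0r.
Qed.

Let ext_out v x : ~~ inbox N x -> ext v x = 0.
Proof.
move=> xN; rewrite /ext big1// => j _; case: eqP => [xj|_]; last by rewrite mul0r.
by case/negP: xN; rewrite xj; exact: box_pt_in.
Qed.

(** The adjacency matrix of the lattice. With it, [A] below represents [- b * lap1 + q + delta] on
    functions extended by zero outside the box. *)
Let W (x y : 'rV[int]_n) : R := \sum_k ((x + ev k == y)%:R + (x - ev k == y)%:R).

Let WC x y : W x y = W y x.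
Proof.
apply: eq_bigr => k _; rewrite addrC; congr (_%:R + _%:R).
  by rewrite subr_eq eq_sym.
by rewrite eq_sym -subr_eq.
Qed.

Let A i j : R := (i == j)%:R * (b * 2 * n%:R + q (pt i) + delta)
                 - b * W (pt i) (pt j).

Let sumWv v x : \sum_j W x (pt j) * v j = lap1 (ext v) x + 2 * n%:R * ext v x.
Proof.
have -> : 2 * n%:R * ext v x = \sum_(k < n) 2 * ext v x.
  by rewrite sumr_const card_ord -mulr_natr; ring.
rewrite /lap1 -big_split /= /W (eq_bigr (fun j => \sum_k
   ((x + ev k == pt j)%:R * v j + (x - ev k == pt j)%:R * v j))); last first.
  by move=> j _; rewrite mulr_suml; apply: eq_bigr => k _; rewrite mulrDl.
rewrite exchange_big; apply: eq_bigr => k _ /=.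
by rewrite big_split /= -/(ext v _) -/(ext v _); ring.
Qed.

Let sumAv v i : \sum_j A i j * v j =
  - b * lap1 (ext v) (pt i) + (q (pt i) + delta) * ext v (pt i).
Proof.
rewrite /A (eq_bigr (fun j => (i == j)%:R * (b * 2 * n%:R + q (pt i) + delta) * v j
   - b * (W (pt i) (pt j) * v j))); last by move=> j _; ring.
rewrite sumrB -mulr_sumr sumWv (bigD1 i)//= eqxx big1 ?ext_pt; first by rewrite /=; ring.
by move=> j ji; rewrite eq_sym (negbTE ji) !mul0r.
Qed.

Let W_ge0 x y : 0 <= W x y.
Proof. by apply: sumr_ge0 => k _; rewrite addr_ge0. Qed.

Let sumW_le x : \sum_j W x (pt j) <= 2 * n%:R.
Proof.
have le1 y : \sum_j (y == pt j)%:R <= 1 :> R.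
  have [/existsP[i /eqP ->]|/existsPn h] := boolP [exists i, y == pt i].
    rewrite (bigD1 i)//= eqxx big1 ?addr0// => j ji.
    by rewrite (inj_eq pt_inj) eq_sym (negbTE ji).
  by rewrite big1// => j _; rewrite (negbTE (h j)).
rewrite /W exchange_big /=.
have -> : 2 * n%:R = \sum_(k < n) (2 : R) by rewrite sumr_const card_ord mulr_natr.
apply: ler_sum => k _; rewrite big_split /=.
by have := le1 (x + ev k); have := le1 (x - ev k); lra.
Qed.

(** By [v_i v_j <= v_i^2 / 2 + v_j^2 / 2] and symmetry, the adjacency part is controlled by the row
    sums of [W]. Edges leaving the box only lower these below [2 n], so the diagonal term
    [b * 2 * n] absorbs them and [delta] is left over. *)
Let Acoer v : delta * (\sum_i v i ^+ 2) <= bil A v v.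
Proof.
have WV : \sum_i \sum_j W (pt i) (pt j) * (v i * v j) <= 2 * n%:R * \sum_i v i ^+ 2.
  apply: (@le_trans _ _ (\sum_i \sum_j W (pt i) (pt j) *
     (v i ^+ 2 / 2 + v j ^+ 2 / 2))).
    apply: ler_sum => i _; apply: ler_sum => j _; apply: ler_wpM2l => //.
    by have := sqr_ge0 (v i - v j); rewrite sqrrB -mulr_natr; lra.
  have h : \sum_i \sum_j W (pt i) (pt j) * (v i ^+ 2 / 2) <= n%:R * \sum_i v i ^+ 2.
    rewrite mulr_sumr; apply: ler_sum => i _; rewrite -mulr_suml.
    have -> : n%:R * v i ^+ 2 = 2 * n%:R * (v i ^+ 2 / 2) by field.
    by rewrite ler_wpM2r// divr_ge0// sqr_ge0.
  have -> : \sum_i \sum_j W (pt i) (pt j) * (v i ^+ 2 / 2 + v j ^+ 2 / 2) =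
     \sum_i \sum_j W (pt i) (pt j) * (v i ^+ 2 / 2)
     + \sum_i \sum_j W (pt i) (pt j) * (v i ^+ 2 / 2).
    rewrite [X in _ = _ + X]exchange_big -big_split; apply: eq_bigr => i _ /=.
    rewrite -big_split; apply: eq_bigr => j _ /=.
    by rewrite [W (pt j) _]WC; ring.
  by lra.
have -> : bil A v v = \sum_i (b * 2 * n%:R + q (pt i) + delta) * v i ^+ 2
   - b * \sum_i \sum_j W (pt i) (pt j) * (v i * v j).
  rewrite mulr_sumr -sumrB; apply: eq_bigr => i _.
  rewrite mulr_sumr /A (bigD1 i)//= [in RHS](bigD1 i)//= eqxx opprD addrA.
  rewrite -sumrN; congr (_ + _); first by rewrite /=; ring.
  apply: eq_bigr => j ji; rewrite eq_sym (negbTE ji) /=; ring.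
apply: (@le_trans _ _ (\sum_i (b * 2 * n%:R + q (pt i) + delta) * v i ^+ 2
   - b * (2 * n%:R * \sum_i v i ^+ 2))); last first.
  by rewrite lerB// ler_wpM2l// ltW.
rewrite !mulr_sumr -sumrB; apply: ler_sum => i _.
have : 0 <= q (pt i) * v i ^+ 2 by rewrite mulr_ge0// sqr_ge0.
by lra.
Qed.

(** In the application [b] is the square of the mesh number. The last clause is the Rayleigh bound
    in pointwise form: its inequalities are asked only where [v > 0], because every summand of the
    two quadratic forms carries a factor [v x]. *)
Lemma lattice_ground_state : (exists2 x, inbox N x & 0 < p x) ->
  exists (lam : R) (u : 'rV[int]_n -> R),
  [/\ 0 < lam /\ (forall x, 0 <= u x), forall x, ~~ inbox N x -> u x = 0,
      exists x, 0 < u x,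
      forall x, inbox N x ->
        - b * lap1 u x + (q x + delta) * u x = lam * p x * u x
    & forall (v : 'rV[int]_n -> R) c L, (forall x, ~~ inbox N x -> v x = 0) ->
        (forall x, 0 <= v x) -> (exists x, 0 < v x) -> 0 < c ->
        (forall x, 0 < v x -> c <= p x) ->
        (forall x, 0 < v x -> - b * lap1 v x + (q x + delta) * v x <= L * v x) ->
        lam <= L / c].
Proof.
move=> [_ /ptP[i0 ->] pi0].
have [|i j ij|||lam [u [lam0 u0 upos eqn lamE]]] :=
  @quadratic_ground_state R _ A (p \o pt) delta _ _ delta0 Acoer.
- move=> i j; rewrite /A WC; case: eqVneq => [->//|ij].
  by rewrite !mul0r.
- by rewrite /A (negbTE ij) mul0r add0r oppr_le0 mulr_ge0// ltW.
- by move=> i /=.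
- by exists i0.
exists lam, (ext u); split.
- by split=> // x; apply: sumr_ge0 => j _; rewrite mulr_ge0.
- exact: ext_out.
- by have [i ui] := upos; exists (pt i); rewrite ext_pt.
- by move=> _ /ptP[i ->]; rewrite -sumAv eqn ext_pt.
move=> v c L vout v0 [x vx] c0 vc vL.
have vE : v = ext (v \o pt).
  apply/funext => y; have [/ptP[i ->]|yN] := boolP (inbox N y).
    by rewrite ext_pt.
  by rewrite ext_out ?vout.
have [i xi] : exists i, x = pt i.
  apply: ptP; apply: contraLR vx => xN; by rewrite vout ?ltxx.
have s0 : 0 < \sum_i v (pt i) ^+ 2.
  rewrite (bigD1 i)//= -xi ltr_pwDl ?exprn_gt0// sumr_ge0// => k _.
  by rewrite sqr_ge0.
have := lamE (v \o pt).
have le1 : bil A (v \o pt) (v \o pt) <= L * \sum_i v (pt i) ^+ 2.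
  rewrite mulr_sumr; apply: ler_sum => k _ /=.
  rewrite (eq_bigr (fun j => v (pt k) * (A k j * v (pt j)))); last by move=> j _; ring.
  rewrite -mulr_sumr (sumAv (v \o pt)) -vE.
  have := v0 (pt k); rewrite le_eqVlt => /orP[/eqP <-|vk].
    by rewrite expr2 !(mulr0, mul0r).
  by have h := vL _ vk; rewrite expr2 [leRHS]mulrCA ler_pM2l.
have le2 : c * \sum_i v (pt i) ^+ 2 <= wsq (p \o pt) (v \o pt).
  rewrite mulr_sumr; apply: ler_sum => k _ /=.
  have := v0 (pt k); rewrite le_eqVlt => /orP[/eqP <-|vk].
    by rewrite expr0n !mulr0.
  by rewrite ler_wpM2r ?sqr_ge0// vc.
move=> le3; rewrite ler_pdivlMr//.
rewrite -(ler_pM2r s0) -mulrA; apply: le_trans le1; apply: le_trans le3.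
by rewrite ler_pM2l.
Qed.

End LatticeGroundState.

(** * Compactly supported test functions on the lattice *)

Section Bump.
Context {R : realType}.

Definition bump (y : R) : R := if `|y| < 1 then (1 - y ^+ 2) ^+ 2 else 0.

Lemma bumpN y : bump (- y) = bump y.
Proof. by rewrite /bump normrN sqrrN. Qed.

Lemma bump_ge0 y : 0 <= bump y.
Proof. by rewrite /bump; case: ifP => // _; rewrite sqr_ge0. Qed.

Lemma bump_gt0 y : (0 < bump y) = (`|y| < 1).
Proof.
rewrite /bump; case: ifP => [|_]; last by rewrite ltxx.
rewrite ltr_norml => /andP[h1 h2]; rewrite exprn_gt0//.
by nra.
Qed.

(** The bound has to be a multiple of [bump y] itself, right up to the edge of the support; it holds
    because [(1 - y^2)^2] is convex near the edge. Inside, the estimate reduces to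
    [4 - 12 y^2 <= 9 (1 - y^2)^2], that is [0 <= (3 y^2 - 1)^2 + 4]. *)
Lemma bump_diff (y a : R) : 0 < a -> a <= 1 / 10 -> `|y| < 1 ->
  2 * bump y - bump (y + a) - bump (y - a) <= 9 * a ^+ 2 * bump y.
Proof.
move=> a0 a1; wlog y0 : y / 0 <= y.
  move=> H y1; have [/H|yn] := lerP 0 y; first exact.
  have := H (- y); rewrite normrN bumpN => /(_ _ y1).
  have -> : bump (- y + a) = bump (y - a) by rewrite -bumpN opprD opprK.
  have -> : bump (- y - a) = bump (y + a) by rewrite -bumpN opprB opprK addrC.
  by move=> /(_ ltac:(lra)); lra.
rewrite ger0_norm// => y1.
have -> : bump y = (1 - y ^+ 2) ^+ 2 by rewrite /bump ger0_norm// y1.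
have -> : bump (y - a) = (1 - (y - a) ^+ 2) ^+ 2.
  rewrite /bump ifT// ltr_norml; apply/andP; split; lra.
have [ya|ya] := ltrP (y + a) 1.
  have -> : bump (y + a) = (1 - (y + a) ^+ 2) ^+ 2.
    rewrite /bump ifT// ltr_norml; apply/andP; split; lra.
  have -> : 2 * (1 - y ^+ 2) ^+ 2 - (1 - (y + a) ^+ 2) ^+ 2 - (1 - (y - a) ^+ 2) ^+ 2
     = a ^+ 2 * (4 - 12 * y ^+ 2 - 2 * a ^+ 2) by ring.
  have -> : 9 * a ^+ 2 * (1 - y ^+ 2) ^+ 2 = a ^+ 2 * (9 * (1 - y ^+ 2) ^+ 2) by ring.
  rewrite ler_wpM2l ?sqr_ge0//.
  have := sqr_ge0 a; have := sqr_ge0 (3 * y ^+ 2 - 1); lra.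
have -> : bump (y + a) = 0 by rewrite /bump ifF// ger0_norm ?ltNge ?ya//; lra.
apply: (@le_trans _ _ 0); last by rewrite mulr_ge0 ?sqr_ge0// mulr_ge0 ?sqr_ge0.
(* With [y + a] outside the support, [2 bump y <= bump (y - a)] is enough. It follows by squaring
   [h1], since [(7 / 5)^2 < 2]. *)
have h1 : 2 * (1 - y ^+ 2) <= (1 - (y - a) ^+ 2) * (7 / 5).
  have -> : 1 - y ^+ 2 = (1 - y) * (1 + y) by ring.
  have -> : 1 - (y - a) ^+ 2 = (1 - y + a) * (1 + y - a) by ring.
  have : 2 * (1 - y) * (1 + y - a) <= (1 - y + a) * (1 + y - a).
    by rewrite ler_wpM2r//; lra.
  have : (1 - y) * (1 + y) * (18 / 20) <= (1 - y) * (1 + y - a).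
    by rewrite -mulrA ler_wpM2l//; lra.
  have : 0 <= (1 - y) * (1 + y) by rewrite mulr_ge0//; lra.
  lra.
have h0 : 0 <= 1 - y ^+ 2 by nra.
nra.
Qed.

End Bump.

Section TestFunction.
Context {R : realType} {n : nat}.

Definition bumps (a : R) (k0 x : 'rV[int]_n) : R :=
  \prod_i bump (a * (x 0 i - k0 0 i)%:~R).

Lemma bumps_ge0 a k0 x : 0 <= bumps a k0 x.
Proof. by apply: prodr_ge0 => i _; exact: bump_ge0. Qed.

Lemma bumps_gt0 a k0 x : 0 < bumps a k0 x ->
  forall i, `|a * (x 0 i - k0 0 i)%:~R| < 1.
Proof.
move=> h i; rewrite -bump_gt0 lt_neqAle bump_ge0 andbT eq_sym.
by apply: contraTneq h => h; rewrite /bumps (bigD1 i)//= h mul0r ltxx.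
Qed.

(** A step along one axis changes a single factor of the product; the one-dimensional estimate
    applies with the remaining factors as a nonnegative constant. *)
Lemma bumps_lap a k0 x : 0 < a -> a <= 1 / 10 -> 0 < bumps a k0 x ->
  - lap1 (bumps a k0) x <= 9 * n%:R * a ^+ 2 * bumps a k0 x.
Proof.
move=> a0 a1 /bumps_gt0 hx.
have -> : 9 * n%:R * a ^+ 2 * bumps a k0 x = \sum_(k < n) 9 * a ^+ 2 * bumps a k0 x.
  by rewrite sumr_const card_ord -mulr_natr; ring.
rewrite /lap1 -sumrN; apply: ler_sum => k _.
pose P := \prod_(i | i != k) bump (a * (x 0 i - k0 0 i)%:~R).
have P0 : 0 <= P by apply: prodr_ge0 => i _; exact: bump_ge0.
have h (s : int) : bumps a k0 (x + s *: ev k) =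
    bump (a * (x 0 k - k0 0 k)%:~R + s%:~R * a) * P.
  rewrite /bumps (bigD1 k)//= !mxE !eqxx mulr1; congr (bump _ * _).
    by rewrite addrAC rmorphD /=; ring.
  by apply: eq_bigr => i ik; rewrite !mxE eqxx (negbTE ik) mulr0 addr0.
have := h 1; have := h (-1); have := h 0.
rewrite scaleN1r scale0r scale1r addr0 mulrN1z mulN1r mul0r mul1r addr0.
move=> -> -> ->; have := bump_diff a0 a1 (hx k).
by move=> /(ler_wpM2r P0); lra.
Qed.

End TestFunction.

(** * Lattice functions with bounded difference quotients *)

Section LatticeSequences.
Context {R : realType} {n : nat}.
Variable H : nat -> nat.
Hypothesis H0 : forall k, (0 < H k)%N.
Local Notation lseq := (nat -> 'rV[int]_n -> R).
Implicit Types (u v w : lseq) (r m k : nat) (i j : 'I_n).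

Let HR k : 0 < (H k)%:R :> R. Proof. by rewrite ltr0n. Qed.

(** In physical coordinates [inbox (r * H k)] is the cube of half-side [r]. Bounds are asked only
    for large [k], because the [k]-th equation holds only in a cube that grows with [k]. *)
Definition lb v := forall r, exists (C : R) k0, forall k, (k0 <= k)%N ->
  forall x, inbox (r * H k) x -> `|v k x| <= C.

Definition dq i v : lseq := fun k x => (H k)%:R * dif i (v k) x.
Definition lapq v : lseq := fun k x => (H k)%:R ^+ 2 * lap1 (v k) x.
Definition sh (y : 'rV[int]_n) v : lseq := fun k x => v k (x + y).

(** The discrete counterpart of a local [C^m] bound, uniform in the mesh. *)
Fixpoint cb m v : Prop :=
  lb v /\ if m is m'.+1 then forall i, cb m' (dq i v) else True.

Lemma cb_lb m v : cb m v -> lb v. Proof. by case: m => [|m] []. Qed.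

Lemma inboxW r r' (x : 'rV[int]_n) : (r <= r')%N -> inbox r x -> inbox r' x.
Proof.
by move=> rr /inboxP h; apply/inboxP => i; move: (h i) rr; clear; lia.
Qed.

Lemma inbox_add r r' (x y : 'rV[int]_n) : inbox r x -> inbox r' y -> inbox (r + r') (x + y).
Proof.
move=> /inboxP h /inboxP h'; apply/inboxP => i; rewrite mxE.
by rewrite (le_trans (ler_normD _ _))// PoszD lerD.
Qed.

Lemma ev_box i : inbox 1 (ev i).
Proof. by apply/inboxP => j; rewrite ev_eq; clear; case: (j == i). Qed.

Lemma inbox_opp r (x : 'rV[int]_n) : inbox r (- x) = inbox r x.
Proof. by apply: eq_forallb => i; rewrite mxE normrN. Qed.

Lemma lb_sh y v : inbox 1 y -> lb v -> lb (sh y v).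
Proof.
move=> y1 bv r; have [C [k0 h]] := bv r.+1; exists C, k0 => k kk x xr.
apply: h => //; rewrite mulSn addnC; apply: inbox_add xr (inboxW _ y1).
exact: H0.
Qed.

(** An interior gradient estimate at physical scale one: [dif_norm_le] is applied in a box of [H k]
    lattice steps around each point, and the factor [H k] of the quotient cancels the [1 / H k] of
    that bound. *)
Lemma lb_dq v i : lb v -> lb (lapq v) -> lb (dq i v).
Proof.
(* [r.+2] leaves room for the translated box of [H k] steps and for one further layer of lattice
   points. *)
move=> bv bl r; have [C1 [k1 h1]] := bv r.+2; have [C2 [k2 h2]] := bl r.+2.
exists ((2 * n%:R + 3) * (`|C1| + 1) + `|C2|), (maxn k1 k2) => k.
rewrite geq_max => /andP[kk1 kk2] x xr.
rewrite /dq normrM ger0_norm ?(ltW (HR k))//.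
have hv : `|dif i (v k) x| <= (2 * n%:R + 3) * (`|C1| + 1) / (H k)%:R
    + `|C2| / (H k)%:R ^+ 2 * (H k)%:R.
  have -> : dif i (v k) x = v k (x + ev i) - v k (x + 0) by rewrite addr0.
  apply: (@dif_norm_le _ _ (fun z => v k (x + z))) => //.
  - move=> z zH; apply: (@le_trans _ _ `|C1|); last by rewrite lerDl.
    apply: le_trans (ler_norm _); apply: h1 => //.
    apply: (@inboxW (r * H k + (H k).+1)); last exact: inbox_add.
    by have := H0 k; rewrite !mulSn; clear; lia.
  - move=> z zH.
    have -> : lap1 (fun z => v k (x + z)) z = lapq v k (x + z) / (H k)%:R ^+ 2.
      rewrite /lapq mulrC mulKf ?gt_eqF ?exprn_gt0//.
      by rewrite /lap1; apply: eq_bigr => j _; rewrite !addrA.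
    rewrite normrM normfV [`|_ ^+ 2|]ger0_norm ?exprn_ge0//.
    rewrite ler_wpM2r ?invr_ge0 ?exprn_ge0//.
    apply: le_trans (ler_norm _); apply: h2 => //.
    apply: (@inboxW (r * H k + H k)); last exact: inbox_add.
    by rewrite !mulSn; clear; lia.
apply: le_trans (ler_wpM2l (ltW (HR k)) hv) _.
by rewrite le_eqVlt; apply/orP; left; apply/eqP; field; rewrite gt_eqF.
Qed.

Lemma lapq_dq i v : lapq (dq i v) = dq i (lapq v).
Proof.
apply/funext => k; apply/funext => x; rewrite /lapq /dq /dif /lap1.
rewrite -mulrBr -sumrB [RHS]mulrCA; congr (_ * _); rewrite mulr_sumr.
apply: eq_bigr => j _.
by rewrite ![x + ev i + _]addrAC; ring.
Qed.

(** Since [lapq] commutes with [dq], the gradient estimate can be applied to the difference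
    quotients of [v] in turn. *)
Lemma cb_next m v : cb m v -> cb m (lapq v) -> cb m.+1 v.
Proof.
elim: m v => [|m IH] v.
  by move=> [bv _] [bl _]; split=> // i; split=> //; exact: lb_dq.
move=> [bv dv] [bl dl]; split=> // i; apply: IH; first exact: dv.
by rewrite lapq_dq; exact: dl.
Qed.

Lemma cb_sh m y v : inbox 1 y -> cb m v -> cb m (sh y v).
Proof.
move=> y1; elim: m v => [|m IH] v [bv dv]; split=> //; try exact: lb_sh.
move=> i; have -> : dq i (sh y v) = sh y (dq i v); last exact/IH/dv.
by apply/funext => k; apply/funext => x; rewrite /dq /sh /dif addrAC.
Qed.

Lemma lb_add v w : lb v -> lb w -> lb (fun k x => v k x + w k x).
Proof.
move=> bv bw r; have [C1 [k1 h1]] := bv r; have [C2 [k2 h2]] := bw r.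
exists (C1 + C2), (maxn k1 k2) => k; rewrite geq_max => /andP[kk1 kk2] x xr.
by apply: le_trans (ler_normD _ _) _; rewrite lerD ?h1 ?h2.
Qed.

Lemma lb_mul v w : lb v -> lb w -> lb (fun k x => v k x * w k x).
Proof.
move=> bv bw r; have [C1 [k1 h1]] := bv r; have [C2 [k2 h2]] := bw r.
exists (C1 * C2), (maxn k1 k2) => k; rewrite geq_max => /andP[kk1 kk2] x xr.
by rewrite normrM ler_pM ?h1 ?h2.
Qed.

Lemma cb_add m v w : cb m v -> cb m w -> cb m (fun k x => v k x + w k x).
Proof.
elim: m v w => [|m IH] v w [bv dv] [bw dw]; split=> //; try exact: lb_add.
move=> i.
have -> : dq i (fun k x => v k x + w k x) = (fun k x => dq i v k x + dq i w k x).
  by apply/funext => k; apply/funext => x; rewrite /dq /dif; ring.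
by apply: IH; [exact: dv|exact: dw].
Qed.

Lemma cbW m v : cb m.+1 v -> cb m v.
Proof.
by elim: m v => [|m IH] v [bv dv]; split=> // i; exact/IH/dv.
Qed.

(** The discrete Leibniz rule evaluates one factor at the shifted point, which is why bounds must be
    stable under [sh]. *)
Lemma cb_mul m v w : cb m v -> cb m w -> cb m (fun k x => v k x * w k x).
Proof.
elim: m v w => [|m IH] v w cv cw; have [bv dv] := cv; have [bw dw] := cw.
  by split=> //; exact: lb_mul.
split=> [|i]; first exact: lb_mul.
have -> : dq i (fun k x => v k x * w k x) =
    (fun k x => sh (ev i) v k x * dq i w k x + dq i v k x * w k x).
  by apply/funext => k; apply/funext => x; rewrite /dq /sh /dif; ring.
apply: cb_add; apply: IH; [|exact: dw|exact: dv|exact: cbW].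
by apply: cb_sh; [exact: ev_box|exact: cbW].
Qed.

Lemma cb_cst m (c : nat -> R) (C : R) :
  (forall k, `|c k| <= C) -> cb m (fun k _ => c k).
Proof.
elim: m c C => [|m IH] c C hc; split=> //; try by move=> r; exists C, 0%N.
move=> i; have -> : dq i (fun k _ => c k) = fun k _ => 0.
  by apply/funext => k; apply/funext => x; rewrite /dq /dif subrr mulr0.
by apply: (IH (fun=> 0) 0) => k; rewrite normr0.
Qed.

Lemma cb_coord m i : cb m (fun k x => (x 0 i)%:~R / (H k)%:R).
Proof.
have b0 : lb (fun k x => (x 0 i)%:~R / (H k)%:R).
  move=> r; exists r%:R, 0%N => k _ x /inboxP/(_ i) xr.
  rewrite normrM normfV [`|(H k)%:R|]ger0_norm// ler_pdivrMr// -natrM.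
  by rewrite -intr_norm -[leRHS]/((r * H k)%N%:Z%:~R) ler_int.
case: m => [|m]; split=> // j.
have -> : dq j (fun k x => (x 0 i)%:~R / (H k)%:R) = fun k _ => (i == j)%:R.
  apply/funext => k; apply/funext => x; rewrite /dq /dif -mulrBl mulrCA mulfV.
    by rewrite mulr1 mxE ev_eq rmorphD /= addrC addKr; case: (i == j).
  by rewrite gt_eqF.
by apply: (@cb_cst m _ 1) => k; case: (i == j); rewrite ?normr1 ?normr0.
Qed.

Definition loc_eq v w := forall r, exists k0, forall k, (k0 <= k)%N ->
  forall x, inbox (r * H k) x -> v k x = w k x.

Lemma loc_eq_dq i v w : loc_eq v w -> loc_eq (dq i v) (dq i w).
Proof.
move=> e r; have [k0 h] := e r.+1; exists k0 => k kk x xr.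
rewrite /dq /dif !h//; first by apply: inboxW xr; rewrite mulSn leq_addl.
rewrite mulSn addnC; apply: inbox_add xr (inboxW _ (ev_box i)); exact: H0.
Qed.

Lemma cb_loc_eq m v w : loc_eq v w -> cb m v -> cb m w.
Proof.
elim: m v w => [|m IH] v w e [bv dv]; split=> //.
- move=> r; have [C [k0 h]] := bv r; have [k1 h1] := e r.
  exists C, (maxn k0 k1) => k; rewrite geq_max => /andP[kk0 kk1] x xr.
  by rewrite -h1// h.
- move=> r; have [C [k0 h]] := bv r; have [k1 h1] := e r.
  exists C, (maxn k0 k1) => k; rewrite geq_max => /andP[kk0 kk1] x xr.
  by rewrite -h1// h.
- by move=> i; apply: IH (dv i); exact: loc_eq_dq.
Qed.

(** Bootstrap: if the quotients of [u] up to order [m] are bounded, so are those of [V u], which is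
    the Laplacian of [u], and [cb_next] gains one order. *)
Lemma cb_regularity u V : lb u -> (forall m, cb m V) ->
  loc_eq (fun k x => V k x * u k x) (lapq u) -> forall m, cb m u.
Proof.
move=> bu cV e; elim=> [|m IH]; first by split.
by apply: cb_next => //; apply: cb_loc_eq e _; exact: cb_mul.
Qed.

Definition pos k (x : 'rV[int]_n) : 'rV[R]_n := \row_i ((x 0 i)%:~R / (H k)%:R).

Lemma cb_evalp m (q : mpoly.mpoly n R) : cb m (fun k x => evalp q (pos k x)).
Proof.
have c0 c : cb m (fun _ _ => c) by apply: (@cb_cst m _ `|c|).
have -> : (fun k x => evalp q (pos k x)) = fun k x =>
  \sum_(mm <- mpoly.msupp q) mpoly.mcoeff mm q *
   \prod_(i <- enum 'I_n) ((x 0 i)%:~R / (H k)%:R) ^+ mpoly.fun_of_multinom mm i.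
  apply/funext => k; apply/funext => x; rewrite /evalp mpoly.mevalE.
  apply: eq_bigr => mm _; congr (_ * _); rewrite big_enum /=.
  by apply: eq_bigr => i _; rewrite mxE.
elim: (mpoly.msupp q) => [|mm s IH].
  rewrite (_ : (fun k x => _) = fun _ _ => 0)//.
  by apply/funext => k; apply/funext => x; rewrite big_nil.
rewrite (_ : (fun k x => _) = fun k (x : 'rV[int]_n) => mpoly.mcoeff mm q *
   \prod_(i <- enum 'I_n) ((x 0 i)%:~R / (H k)%:R) ^+ mpoly.fun_of_multinom mm i +
  \sum_(mm <- s) mpoly.mcoeff mm q *
   \prod_(i <- enum 'I_n) ((x 0 i)%:~R / (H k)%:R) ^+ mpoly.fun_of_multinom mm i); last first.
  by apply/funext => k; apply/funext => x; rewrite big_cons.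
apply: cb_add => //; apply: cb_mul => //.
elim: (enum _) => [|i t IHt].
  rewrite (_ : (fun k x => _) = fun _ _ => 1)//.
  by apply/funext => k; apply/funext => x; rewrite big_nil.
rewrite (_ : (fun k x => _) = fun k (x : 'rV[int]_n) =>
   ((x 0 i)%:~R / (H k)%:R) ^+ mpoly.fun_of_multinom mm i *
   \prod_(i <- t) ((x 0 i)%:~R / (H k)%:R) ^+ mpoly.fun_of_multinom mm i); last first.
  by apply/funext => k; apply/funext => x; rewrite big_cons.
apply: cb_mul => //; elim: (mpoly.fun_of_multinom mm i) => [|d IHd]; first exact: (c0 1).
rewrite (_ : (fun k x => _) = fun k (x : 'rV[int]_n) =>
   ((x 0 i)%:~R / (H k)%:R) * ((x 0 i)%:~R / (H k)%:R) ^+ d); last first.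
  by apply/funext => k; apply/funext => x; rewrite exprS.
by apply: cb_mul => //; exact: cb_coord.
Qed.

End LatticeSequences.

(** * Ultralimits of lattice functions *)

Section QuadraticApproximation.
Context {R : realType} {n : nat}.

Lemma coord_le_norm (x : 'rV[R]_n) i : `|x ord0 i| <= `|x|.
Proof.
rewrite [leRHS]/Num.norm /= mx_normrE.
by apply/bigmax_geP; right => /=; exists (ord0, i).
Qed.

(** A quadratic remainder is the form of regularity that survives the passage from the lattice to
    the limit, so differentiability is deduced from it. *)
Lemma quad_differentiable (f : 'rV[R]_n -> R) (c : 'I_n -> R) (C : R) (t : 'rV[R]_n) :
  (forall t' : 'rV[R]_n, (forall i, `|t' ord0 i - t ord0 i| <= 1) ->
    `|f t' - f t - \sum_i (t' ord0 i - t ord0 i) * c i|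
      <= C * (\sum_i `|t' ord0 i - t ord0 i|) ^+ 2) ->
  differentiable f t /\ forall i, 'D_(basisv i) f t = c i.
Proof.
move=> hf.
pose G0 (h : 'rV[R]_n) : R := \sum_i h ord0 i * c i.
have lG : linear G0.
  move=> a u v; rewrite /G0 /GRing.scale /= mulr_sumr -big_split.
  by apply: eq_bigr => i _ /=; rewrite !mxE; ring.
pose GL := GRing.isLinear.Build _ _ _ _ _ lG.
pose G : {linear 'rV[R]_n -> R} := HB.pack G0 GL.
have cG : continuous (G : 'rV[R]_n -> R).
  have sG : smooth G0.
    apply: smooth_sum => i; apply: smooth_mul; first exact: smooth_coord.
    exact: smooth_cst.
  exact: (smooth_continuous sG).
have dG := @diff_unique _ _ _ f G t cG.
match type of dG with ?P -> _ => have fG : P end.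
  apply/eqaddoP => e e0 /=.
  have K0 : 0 < `|C| * n%:R ^+ 2 + 1 by rewrite ltr_wpDl// mulr_ge0// exprn_ge0.
  near=> h.
  have h1 i : `|h ord0 i| <= `|h| by exact: coord_le_norm.
  have hle1 : `|h| <= 1 by near: h; exact: (@nbhs0_le R 'rV[R]_n 1 ltr01).
  have hleK : `|h| <= e / (`|C| * n%:R ^+ 2 + 1).
    by near: h; apply: (@nbhs0_le R 'rV[R]_n); rewrite divr_gt0.
  have hE i : (h + t) ord0 i - t ord0 i = h ord0 i by rewrite mxE addrK.
  have -> : (f \o shift t - (cst (f t) + G)) h =
      f (h + t) - f t - \sum_i ((h + t) ord0 i - t ord0 i) * c i.
    rewrite /= -[LHS]/(f (h + t) - (f t + G0 h)) opprD addrA; congr (_ - _).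
    by apply: eq_bigr => i _; rewrite hE.
  apply: le_trans (hf _ _) _; first by move=> i; rewrite hE (le_trans (h1 i)).
  have s1 : \sum_i `|(h + t) ord0 i - t ord0 i| <= n%:R * `|h|.
    rewrite (_ : n%:R * `|h| = \sum_(i < n) `|h|); last first.
      by rewrite sumr_const card_ord mulr_natl.
    by apply: ler_sum => i _; rewrite hE.
  apply: (@le_trans _ _ (`|C| * (n%:R * `|h|) ^+ 2)).
    apply: (@le_trans _ _ (`|C| * (\sum_i `|(h + t) ord0 i - t ord0 i|) ^+ 2)).
      by rewrite ler_wpM2r ?ler_norm// sqr_ge0.
    by rewrite ler_wpM2l// lerXn2r// nnegrE ?sumr_ge0// mulr_ge0.
  rewrite exprMn expr2 mulrA mulrA -expr2 ler_wpM2r//.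
  move: hleK; rewrite ler_pdivlMr// mulrC mulrDl mul1r.
  by have := normr_ge0 h; lra.
have {}dG := dG fG.
have df : differentiable f t by apply/diff_locallyP; rewrite dG.
split=> // i; rewrite deriveE// dG /= /G0 (bigD1 i)//= mxE !eqxx mul1r.
by rewrite big1 ?addr0// => k ki; rewrite mxE (negbTE ki) mul0r.
Unshelve. all: by end_near. Qed.

End QuadraticApproximation.

Section Ultralimit.
Context {R : realType} (F : set_system nat) {FU : UltraFilter F}.

(** A bounded sequence pushes the ultrafilter into a compact interval, where it converges to its
    cluster point. One ultrafilter thus gives limits at all points and for all difference quotients
    at once, with no diagonal extraction. *)
Lemma ultra_cvg (a : nat -> R) (C : R) :
  F [set k | `|a k| <= C] -> exists l : R, a @ F --> l.
Proof.
move=> aC.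
have cC := @segment_compact R (- C) C.
have : (a @ F) `[- C, C]%classic.
  rewrite /fmap /=; apply: filterS aC => k /= h.
  by rewrite in_itv /= -ler_norml.
move=> /cC[p [_ clp]]; exists p => B Bp.
have [//|nB] := in_ultra_setVsetC (a @^-1` B) FU.
by have [x []] := clp (~` B) B nB Bp.
Qed.

Lemma ucv_le (a b : nat -> R) (l m : R) : F [set k | a k <= b k] ->
  a @ F --> l -> b @ F --> m -> l <= m.
Proof.
move=> ab al bm; rewrite -subr_ge0.
have ba : (b k - a k @[k --> F]) --> m - l by apply: cvgB.
apply: (cvgr_to_ge ba).
by apply: filterS ab => k /=; rewrite subr_ge0.
Qed.

Lemma ucv_norm_le (a b : nat -> R) (l m : R) : F [set k | `|a k| <= b k] ->
  a @ F --> l -> b @ F --> m -> `|l| <= m.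
Proof.
move=> ab al bm; rewrite ler_norml; apply/andP; split.
  have := @ucv_le (fun k => - b k) a (- m) l; apply => //; last exact: cvgN.
  by apply: filterS ab => k /=; rewrite ler_norml => /andP[].
by apply: ucv_le al bm; apply: filterS ab => k /=; rewrite ler_norml => /andP[].
Qed.

Lemma ucv_sum n (a : 'I_n -> nat -> R) (l : 'I_n -> R) : (forall i, a i @ F --> l i) ->
  (fun k => \sum_i a i k) @ F --> \sum_i l i.
Proof.
move=> h; elim: (index_enum _) => [|i s IH].
  rewrite big_nil (_ : (fun k => _) = fun=> 0); first exact: cvg_cst.
  by apply/funext => k; rewrite big_nil.
rewrite big_cons (_ : (fun k => _) = fun k => a i k + \sum_(i <- s) a i k).
  exact: (cvgD (h i) IH).
by apply/funext => k; rewrite big_cons.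
Qed.

End Ultralimit.

Section LatticeLimits.
Context {R : realType} {n : nat} (F : set_system nat) {FU : UltraFilter F}.
Variable H : nat -> nat.
Hypothesis Hk : forall k, (k < H k)%N.
Hypothesis Fev : forall k0, F [set k | (k0 <= k)%N].
Local Notation lseq := (nat -> 'rV[int]_n -> R).
Implicit Types (u v w : lseq) (r m k : nat) (i j : 'I_n) (t : 'rV[R]_n).

Let H0 k : (0 < H k)%N. Proof. exact: leq_ltn_trans (Hk k). Qed.
Let HR k : 0 < (H k)%:R :> R. Proof. by rewrite ltr0n. Qed.

Definition flo k t : 'rV[int]_n := \row_i Num.floor (t ord0 i * (H k)%:R).

Lemma flo_dist k t i : `|t ord0 i - pos H k (flo k t) ord0 i| <= (k.+1%:R)^-1.
Proof.
rewrite !mxE; apply: (@le_trans _ _ ((H k)%:R^-1)); last first.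
  by rewrite lef_pV2 ?posrE// ler_nat.
have -> : t ord0 i - (Num.floor (t ord0 i * (H k)%:R))%:~R / (H k)%:R =
   (t ord0 i * (H k)%:R - (Num.floor (t ord0 i * (H k)%:R))%:~R) / (H k)%:R.
  by rewrite mulrBl mulfK// gt_eqF.
rewrite normrM normfV [`|(H k)%:R|]ger0_norm ?(ltW (HR k))// ler_pdivrMr//.
rewrite mulVf ?gt_eqF//.
have := floor_le_tmp (t ord0 i * (H k)%:R); have := floorD1_gt (t ord0 i * (H k)%:R).
rewrite rmorphD /= => h1 h2; rewrite ler_norml; apply/andP; split; lra.
Qed.

Lemma flo_box k t r : (forall i, `|t ord0 i| <= r%:R) -> inbox (r.+1 * H k) (flo k t).
Proof.
move=> tr; apply/inboxP => i; rewrite -(ler_int R) intr_norm.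
rewrite -[leRHS]/((r.+1 * H k)%:R) natrM -ler_pdivrMr//.
have := flo_dist k t i; rewrite !mxE => h.
have h1 : (k.+1%:R)^-1 <= 1 :> R by rewrite invf_le1// ler1n.
have -> : `|(Num.floor (t ord0 i * (H k)%:R))%:~R| / (H k)%:R =
   `|(Num.floor (t ord0 i * (H k)%:R))%:~R / (H k)%:R| :> R.
  by rewrite normrM normfV [`|(H k)%:R|]ger0_norm// ltW.
have -> : r.+1%:R = r%:R + 1 :> R by rewrite natr1.
have := ler_normD (t ord0 i) ((Num.floor (t ord0 i * (H k)%:R))%:~R / (H k)%:R - t ord0 i).
rewrite addrC subrK distrC; have := tr i; move: h h1.
by move: (_ / _) => b; move: (k.+1%:R^-1) => c; move: (r%:R) => d; lra.
Qed.

Lemma bounded_coord t : exists r, forall i, `|t ord0 i| <= r%:R.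
Proof.
exists (Num.truncn `|t|).+1 => i; apply: le_trans (coord_le_norm t i) _.
exact/ltW/truncnS_gt.
Qed.

Lemma small_inv (e : R) : 0 < e -> F [set k | (k.+1%:R)^-1 <= e].
Proof.
move=> e0; apply: filterS (Fev (Num.truncn e^-1)) => k /= kk.
rewrite -[leRHS]invrK lef_pV2 ?posrE ?invr_gt0//.
by apply: le_trans (ltW (truncnS_gt _)) _; rewrite ler_nat.
Qed.

Lemma pos_flo_cvg t : (pos H k (flo k t)) @[k --> F] --> t.
Proof.
apply/cvgrPdist_le => e e0; apply: filterS (small_inv e0) => k /= ke.
rewrite [leLHS]/Num.norm /= mx_normrE; apply/bigmax_leP; split; first exact: ltW.
by move=> [a i] _ /=; rewrite (ord1 a); have := flo_dist k t i; rewrite !mxE => h; exact: le_trans ke.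
Qed.

(** [lim] is total and may return a default value; [fl_cvg] shows that under [lb H v] this is a
    genuine limit. *)
Definition fl v t : R := lim (v k (flo k t) @[k --> F]).

Lemma cvg_limE (a : nat -> R) (l : R) : a @ F --> l -> lim (a @ F) = l.
Proof. by move=> h; apply: cvg_lim => //; exact: Rhausdorff. Qed.

Lemma fl_bound v t : lb H v -> exists C : R, F [set k | `|v k (flo k t)| <= C].
Proof.
move=> bv; have [r tr] := bounded_coord t; have [C [k0 h]] := bv r.+1.
by exists C; apply: filterS (Fev k0) => k /= kk; apply: h => //; exact: flo_box.
Qed.

Lemma fl_cvg v t : lb H v -> v k (flo k t) @[k --> F] --> fl v t.
Proof.
move=> /(fl_bound t)[C h]; have [l hl] := ultra_cvg h.
by rewrite /fl (cvg_limE hl).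
Qed.

Lemma fl_eq v t (l : R) : v k (flo k t) @[k --> F] --> l -> fl v t = l.
Proof. exact: cvg_limE. Qed.

Lemma fl_cvg_dist (t t' : 'rV[R]_n) i :
  ((flo k t' ord0 i)%:~R - (flo k t ord0 i)%:~R) / (H k)%:R @[k --> F]
    --> t' ord0 i - t ord0 i.
Proof.
have h (s : 'rV[R]_n) : pos H k (flo k s) ord0 i @[k --> F] --> s ord0 i.
  apply/cvgrPdist_le => e e0; apply: filterS (small_inv e0) => k /= ke.
  by apply: le_trans ke; exact: flo_dist.
rewrite (_ : (fun k => _) =
  fun k => pos H k (flo k t') ord0 i - pos H k (flo k t) ord0 i).
  exact: cvgB.
by apply/funext => k; rewrite !mxE mulrBl.
Qed.

Lemma lb_uniform (w : 'I_n -> lseq) : (forall i, lb H (w i)) ->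
  forall r, exists (C : R) k0, 0 <= C /\ forall i k, (k0 <= k)%N ->
  forall x, inbox (r * H k) x -> `|w i k x| <= C.
Proof.
move=> bw r; have [f hf] := choice (fun i => bw i r).
have [g hg] := choice hf.
exists (\sum_i `|f i|), (\max_i g i)%N; split.
  by apply: sumr_ge0.
move=> i k kk x xr; apply: (@le_trans _ _ (f i)).
  by apply: hg => //; apply: leq_trans kk; exact: leq_bigmax.
by apply: le_trans (ler_norm _) _; rewrite (bigD1 i)//= lerDl sumr_ge0.
Qed.

(** [lattice_lip] is used twice: on the first differences, whose own differences are bounded by [C],
    and on [v] minus its linear part at [x]. *)
Lemma lattice_taylor v k r (C : R) (x y : 'rV[int]_n) : 0 <= C ->
  (forall i j z, inbox r z -> `|dif i (dif j (v k)) z| <= C) ->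
  inbox r x -> inbox r y ->
  `|v k y - v k x - \sum_i ((y ord0 i)%:~R - (x ord0 i)%:~R) * dif i (v k) x|
    <= 2 * C * (\sum_i `|(y ord0 i)%:~R - (x ord0 i)%:~R|) ^+ 2.
Proof.
move=> C0 hC xr yr.
pose dd (z s : 'rV[int]_n) : int := \sum_l `|z 0 l - s 0 l|.
pose wz (z : 'rV[int]_n) : R := v k z - \sum_i (z 0 i)%:~R * dif i (v k) x.
have dE i z : dif i wz z = dif i (v k) z - dif i (v k) x.
  have SE : \sum_l ((z + ev i) 0 l)%:~R * dif l (v k) x =
      \sum_l (z 0 l)%:~R * dif l (v k) x + dif i (v k) x.
    rewrite (bigD1 i)//= [in RHS](bigD1 i)//= mxE ev_eq eqxx rmorphD /=.
    rewrite (eq_bigr (fun l => (z 0 l)%:~R * dif l (v k) x)) => [|l li].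
      by ring.
    by rewrite mxE ev_eq (negbTE li) addr0.
  by rewrite {1}/dif /wz SE /(dif i (v k) z); ring.
have ddC z s : dd z s = dd s z by apply: eq_bigr => l _; rewrite distrC.
have ddT z s s' : dd z s' <= dd z s + dd s s'.
  rewrite /dd -big_split; apply: ler_sum => l _ /=.
  by rewrite (le_trans _ (ler_normD _ _))// addrA subrK.
have dd0 z s : 0 <= dd z s by apply: sumr_ge0.
have lipd j z : inbox r z -> `|dif j (v k) z - dif j (v k) x| <= C * (dd z x)%:~R.
  move=> zr; apply: (@lattice_lip _ _ (dif j (v k)) C r x xr z zr).
  by move=> s i sr _; exact: hC.
(* Points of the path are no farther from [y] than [x] is, hence within [2 * dd x y] of [x]. This
   explains both the restriction built into [lattice_lip] and the factor 2. *)
have := @lattice_lip _ _ wz (C * (2 * dd x y)%:~R) r y yr x xr.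
move=> /(_ _)/wrap[].
  move=> z i zr zd; rewrite dE; apply: le_trans (lipd i z zr) _.
  rewrite ler_wpM2l// ler_int; apply: le_trans (ddT z y x) _.
  by rewrite (ddC y x) mulr2n mulrDl mul1r lerD2r.
have -> : wz x - wz y =
   - (v k y - v k x - \sum_i ((y ord0 i)%:~R - (x ord0 i)%:~R) * dif i (v k) x).
  have -> : \sum_i ((y ord0 i)%:~R - (x ord0 i)%:~R) * dif i (v k) x =
      \sum_i (y 0 i)%:~R * dif i (v k) x - \sum_i (x 0 i)%:~R * dif i (v k) x.
    by rewrite -sumrB; apply: eq_bigr => i _; rewrite mulrBl.
  by rewrite /wz; ring.
rewrite normrN; move=> h; apply: le_trans h _.
have -> : \sum_i `|(y ord0 i)%:~R - (x ord0 i)%:~R| = (dd x y)%:~R :> R.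
  rewrite ddC /dd rmorph_sum /=; apply: eq_bigr => i _.
  by rewrite intr_norm rmorphB.
have -> : (2 * dd x y)%:~R = 2 * (dd x y)%:~R :> R by rewrite rmorphM.
by rewrite le_eqVlt; apply/orP; left; apply/eqP; ring.
Qed.

(** Second differences are of size [C / H^2] and lattice distances of size [H], so the lattice
    remainder bound is free of the mesh and passes to the limit. *)
Lemma fl_taylor v : cb H 2 v -> forall r, exists C : R, forall t t' : 'rV[R]_n,
  (forall i, `|t ord0 i| <= r%:R) -> (forall i, `|t' ord0 i| <= r%:R) ->
  `|fl v t' - fl v t - \sum_i (t' ord0 i - t ord0 i) * fl (dq H i v) t|
    <= C * (\sum_i `|t' ord0 i - t ord0 i|) ^+ 2.
Proof.
move=> [bv dv] r.
have bd i : lb H (dq H i v) by have [] := dv i.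
have bdd i j : lb H (dq H i (dq H j v)) by have [_ /(_ i)[]] := dv j.
have [f hf] := choice (fun j => @lb_uniform (fun i => dq H i (dq H j v)) (bdd^~ j) r.+1).
have [g hg] := choice hf.
pose C := \sum_j `|f j|; pose k0 := (\max_j g j)%N.
have C0 : 0 <= C by exact: sumr_ge0.
have hC i j k x : (k0 <= k)%N -> inbox (r.+1 * H k) x -> `|dq H i (dq H j v) k x| <= C.
  move=> kk xr; apply: (@le_trans _ _ (f j)).
    by apply: (hg j).2 => //; apply: leq_trans kk; exact: leq_bigmax.
  by apply: le_trans (ler_norm _) _; rewrite /C (bigD1 j)//= lerDl sumr_ge0.
exists (2 * C) => t t' tr tr'.
pose del i k : R := ((flo k t' ord0 i)%:~R - (flo k t ord0 i)%:~R) / (H k)%:R.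
have cdel i : del i k @[k --> F] --> t' ord0 i - t ord0 i by exact: fl_cvg_dist.
apply: (@ucv_norm_le R F FU
  (fun k => v k (flo k t') - v k (flo k t) - \sum_i del i k * dq H i v k (flo k t))
  (fun k => 2 * C * ((\sum_i `|del i k|) * (\sum_i `|del i k|)))).
- apply: filterS (Fev k0) => k /= kk.
  have HH : (H k)%:R != 0 :> R by rewrite gt_eqF.
  have := @lattice_taylor v k (r.+1 * H k) (C / (H k)%:R ^+ 2) (flo k t) (flo k t').
  move=> /(_ _ _ _ _)/wrap[].
  + by rewrite divr_ge0// exprn_ge0// ltW.
  + move=> i j z zr; have := hC i j k z kk zr.
    have -> : dq H i (dq H j v) k z = (H k)%:R ^+ 2 * dif i (dif j (v k)) z.
      by rewrite /dq /dif; ring.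
    rewrite normrM ger0_norm ?exprn_ge0 ?(ltW (HR k))// => h.
    by rewrite ler_pdivlMr ?exprn_gt0// mulrC.
  + exact: flo_box.
  + exact: flo_box.
  have -> : \sum_i del i k * dq H i v k (flo k t) = \sum_i
      ((flo k t' ord0 i)%:~R - (flo k t ord0 i)%:~R) * dif i (v k) (flo k t).
    by apply: eq_bigr => i _; rewrite /del /dq; field.
  have -> : \sum_i `|(flo k t' ord0 i)%:~R - (flo k t ord0 i)%:~R| =
      (H k)%:R * \sum_i `|del i k|.
    rewrite mulr_sumr; apply: eq_bigr => i _.
    rewrite /del normrM normfV [`|(H k)%:R|]ger0_norm ?(ltW (HR k))//.
    by rewrite mulrCA mulfV ?mulr1.
  move=> h; apply: le_trans h _.
  by rewrite le_eqVlt; apply/orP; left; apply/eqP; field.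
- apply: cvgB; first by apply: cvgB; exact: fl_cvg.
  apply: ucv_sum => i; apply: cvgM => //; exact: fl_cvg.
- have cs : (\sum_i `|del i k|) @[k --> F] --> \sum_i `|t' ord0 i - t ord0 i|.
    by apply: ucv_sum => i; apply: cvg_norm.
  by rewrite expr2; apply: cvgM; [exact: cvg_cst|exact: cvgM].
Qed.

Lemma fl_differentiable v t : cb H 2 v ->
  differentiable (fl v) t /\ forall i, 'D_(basisv i) (fl v) t = fl (dq H i v) t.
Proof.
move=> cv; have [r tr] := bounded_coord t.
have [C hC] := fl_taylor cv r.+1.
apply: (@quad_differentiable _ _ _ _ C) => t' tt'; apply: hC => i.
  by apply: le_trans (tr i) _; rewrite ler_nat.
have -> : r.+1%:R = r%:R + 1 :> R by rewrite natr1.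
have := ler_normD (t ord0 i) (t' ord0 i - t ord0 i); rewrite addrC subrK.
by have := tr i; have := tt' i; lra.
Qed.

(** [lap1] is centred, so it is made of second forward differences taken at [x - ev i]. A shift by
    one step changes a value by a bounded quotient divided by [H k], which disappears in the
    limit. *)
Lemma fl_shift v i t : cb H 1 v -> fl (sh (- ev i) v) t = fl v t.
Proof.
move=> cv; have bv := cb_lb cv.
have oi : inbox 1 (- ev i) by rewrite inbox_opp; exact: ev_box.
have bs : lb H (sh (- ev i) v) by exact: lb_sh.
have bd : lb H (sh (- ev i) (dq H i v)) by apply: lb_sh => //; exact: (cv.2 i).1.
apply/esym; apply: fl_eq.
have [C hC] := fl_bound t bd.
have c1 := fl_cvg (t := t) bs; have c2 := fl_cvg (t := t) bv.
rewrite (_ : fl (sh _ _) t = fl v t)//; apply/eqP; rewrite -subr_eq0 -normr_le0.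
apply: (@ucv_norm_le R F FU (fun k => sh (- ev i) v k (flo k t) - v k (flo k t))
   (fun k => C * (k.+1%:R)^-1)).
- apply: filterS hC => k /= hk.
  have -> : sh (- ev i) v k (flo k t) - v k (flo k t) =
      - (sh (- ev i) (dq H i v) k (flo k t) / (H k)%:R).
    rewrite /sh /dq /dif subrK mulrAC mulfV ?mul1r ?opprB//.
    by rewrite gt_eqF.
  rewrite normrN normrM normfV [`|(H k)%:R|]ger0_norm ?(ltW (HR k))//.
  rewrite ler_pM ?invr_ge0 ?(ltW (HR k))// lef_pV2 ?posrE// ler_nat.
  exact: Hk.
- exact: cvgB.
- rewrite -[X in _ --> X](mulr0 C); apply: cvgM; first exact: cvg_cst.
  apply/cvgrPdist_le => e e0; apply: filterS (small_inv e0) => k /= ke.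
  by rewrite sub0r normrN ger0_norm// invr_ge0.
Qed.

(** Order 3 is asked because [fl_differentiable] consumes two orders and is applied to the first
    quotients of [u]. *)
Lemma fl_laplacian u t : cb H 3 u ->
  (differentiable (fl u) t /\ forall i, differentiable ('D_(basisv i) (fl u)) t)
  /\ laplacian (fl u) t = fl (lapq H u) t.
Proof.
move=> cu; have cu2 := cbW cu.
have D1 i : 'D_(basisv i) (fl u) = fl (dq H i u).
  by apply/funext => s; have [_ ->] := fl_differentiable s cu2.
have cd i : cb H 2 (dq H i u) by exact: (cu.2 i).
split.
  split; first by have [] := fl_differentiable t cu2.
  by move=> i; rewrite D1; have [] := fl_differentiable t (cd i).
rewrite /laplacian (eq_bigr (fun i => fl (sh (- ev i) (dq H i (dq H i u))) t)).
  apply/esym; apply: fl_eq.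
  rewrite (_ : (fun k => _) = fun k => \sum_i sh (- ev i) (dq H i (dq H i u)) k (flo k t)).
    apply: ucv_sum => i; apply: fl_cvg; apply: lb_sh => //.
      by rewrite inbox_opp; exact: ev_box.
    by have [_ /(_ i)[]] := cd i.
  apply/funext => k; rewrite /lapq /lap1 mulr_sumr; apply: eq_bigr => i _.
  by rewrite /sh /dq /dif subrK; ring.
move=> i _; rewrite D1 fl_shift; last by have [_ /(_ i)] := cd i.
by have [_ ->] := fl_differentiable t (cd i).
Qed.

Lemma fl_evalp (q : mpoly.mpoly n R) t :
  fl (fun k x => evalp q (pos H k x)) t = evalp q t.
Proof.
apply: fl_eq.
have ce : {for t, continuous (evalp q)} := smooth_continuous (smooth_evalp q) (x := t).
exact: (@continuous_cvg _ _ _ F _ _ _ _ ce (@pos_flo_cvg t)).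
Qed.

End LatticeLimits.

(** * The strong maximum principle *)

Section SecondDerivativeTest.
Context {R : realType}.

(** At the minimum [psi 0 = 0]. A negative derivative of [psi] there would make [psi] negative just
    to the right of 0, and the mean value theorem would push [phi] below its minimum. *)
Lemma second_derivative_min (phi psi : R -> R) (e : R) : 0 < e ->
  (forall s : R, `|s| < e -> is_derive s (1 : R) phi (psi s)) -> derivable psi 0 1 ->
  (forall s : R, `|s| < e -> phi 0 <= phi s) -> 0 <= 'D_1 psi 0.
Proof.
move=> e0 dphi dpsi phimin.
have itvE (s : R) : (s \in `]- e, e[%R) = (`|s| < e) by rewrite in_itv /= ltr_norml.
have psi0 : psi 0 = 0.
  have h0 : is_derive (0 : R) 1 phi 0.
    apply: (@derive1_at_min _ phi (- e) e 0).
    - by lra.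
    - by move=> s; rewrite itvE => /dphi d; exact: ex_derive.
    - by rewrite itvE normr0.
    - by move=> s; rewrite itvE => /phimin.
  have h1 : is_derive (0 : R) 1 phi (psi 0) by apply: dphi; rewrite normr0.
  by rewrite -(@derive_val _ _ _ _ _ _ _ h1) (@derive_val _ _ _ _ _ _ _ h0).
rewrite leNgt; apply/negP => neg.
have [d /= d0 dP] : exists2 d : R, 0 < d & forall h : R, `|h| < d -> h != 0 -> h^-1 * psi h < 0.
  have := @cvgr_lt _ _ _ _ _ _ dpsi 0 neg.
  rewrite near_withinE => hh.
  have [d /= d0 dP] := (@nbhs_norm0P R R _).1 (hh _); exists d => // h hd h0.
  have := dP h hd h0; rewrite /= /GRing.scale /= psi0 subr0.
  by rewrite addr0 mulr1.
pose s := Num.min d e / 2.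
have s0 : 0 < s by rewrite divr_gt0// lt_min d0 e0.
have sd : s < d.
  have : Num.min d e <= d by rewrite ge_min lexx.
  by rewrite /s; move: s0; rewrite /s; lra.
have se : s < e.
  have : Num.min d e <= e by rewrite ge_min lexx orbT.
  by rewrite /s; move: s0; rewrite /s; lra.
have cphi : {within `[0, s], continuous phi}.
  apply: derivable_within_continuous => x; rewrite in_itv /= => /andP[x0 xs].
  have hx : `|x| < e by rewrite ger0_norm//; lra.
  exact: (@ex_derive _ _ _ _ _ _ _ (dphi x hx)).
have [|c] := @MVT R phi psi 0 s s0 _ cphi.
  move=> x; rewrite in_itv /= => /andP[x0 xs]; apply: dphi.
  by rewrite gtr0_norm//; lra.
rewrite in_itv /= => /andP[c0 cs] hc.
have pc : psi c < 0.
  have := dP c; rewrite gtr0_norm// => /(_ (lt_trans cs sd)).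
  by rewrite gt_eqF// => /(_ isT); rewrite pmulr_rlt0// invr_gt0.
have := phimin s; rewrite gtr0_norm// => /(_ se).
by rewrite -subr_ge0 hc subr0 pmulr_lge0// leNgt pc.
Qed.

End SecondDerivativeTest.

Section StrongMaximum.
Context {R : realType} {n : nat}.
Implicit Types (w : 'rV[R]_n -> R) (x y t : 'rV[R]_n).

Definition twice_diff w := forall t,
  differentiable w t /\ forall i : 'I_n, differentiable ('D_(basisv i) w) t.

Lemma line_is_derive w t v (s : R) : differentiable w (s *: v + t) ->
  is_derive s (1 : R) (fun s : R => w (s *: v + t)) ('D_v w (s *: v + t)).
Proof.
move=> dw; have dv := @diff_derivable _ _ _ _ _ v dw.
have E : (fun h : R => h^-1 *: (((fun s : R => w (s *: v + t)) \o shift s) (h *: 1)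
    - w (s *: v + t))) =
  (fun h : R => h^-1 *: ((w \o shift (s *: v + t)) (h *: v) - w (s *: v + t))).
  apply/funext => h /=; congr (_ *: (w _ - _)).
  by rewrite (_ : h%:A = h) ?scalerDl ?addrA//; exact: mulr1.
by split; rewrite ?/derivable ?/derive E.
Qed.

Lemma pd2_ge0_at_min w t i : twice_diff w ->
  (\forall t' \near t, w t <= w t') -> 0 <= 'D_(basisv i) ('D_(basisv i) w) t.
Proof.
move=> dw /nbhs_normP[e /= e0 hmin].
pose v : 'rV[R]_n := basisv i.
have v0 : 0 < `|v|.
  rewrite normr_gt0; apply/eqP => /rowP/(_ i); rewrite !mxE !eqxx /=.
  by move/eqP; rewrite oner_eq0.
have hd s := line_is_derive (t := t) (v := v) (s := s) (dw _).1.
have hd2 := line_is_derive (t := t) (v := v) (s := 0) ((dw _).2 i).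
have e1 : 0 < e / `|v| by rewrite divr_gt0.
have hs s : `|s| < e / `|v| -> w (0 *: v + t) <= w (s *: v + t).
  rewrite scale0r add0r => hs; apply: hmin => /=.
  by rewrite opprD addrCA subrr addr0 normrN normrZ -ltr_pdivlMr.
have := @second_derivative_min R (fun s => w (s *: v + t))
  (fun s => 'D_v w (s *: v + t)) _ e1 (fun s _ => hd s)
  (@ex_derive _ _ _ _ _ _ _ hd2) hs.
by rewrite (@derive_val _ _ _ _ _ _ _ hd2) scale0r add0r.
Qed.

Lemma laplacian_ge0_at_min w t : twice_diff w ->
  (\forall t' \near t, w t <= w t') -> 0 <= laplacian w t.
Proof. by move=> dw hmin; apply: sumr_ge0 => i _; exact: pd2_ge0_at_min. Qed.

Lemma twice_diff_comb w f (a : R) : twice_diff w -> smooth f ->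
  twice_diff (fun t => w t - a * f t) /\
  forall t, laplacian (fun t => w t - a * f t) t = laplacian w t - a * laplacian f t.
Proof.
move=> dw sf.
have saf : smooth (fun t => a * f t) by apply: smooth_mul => //; exact: smooth_cst.
have D i : 'D_(basisv i) (fun t => w t - a * f t) =
    (fun t => 'D_(basisv i) w t - a * pd i f t).
  apply/funext => t.
  have -> : (fun t => w t - a * f t) = w - (fun t => a * f t) by [].
  rewrite deriveB; [|exact/diff_derivable/(dw t).1|exact: smooth_derivable].
  by rewrite -[X in _ - X]/(pd i (fun t => a * f t) t) pdZ.
have sap i : smooth (fun t => a * pd i f t).
  by apply: smooth_mul; [exact: smooth_cst|exact: smooth_pd].
split=> t.
  split=> [|i].
    apply: (@differentiableB _ _ _ w (fun t => a * f t)); first exact: (dw t).1.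
    exact: smooth_differentiable.
  rewrite D; apply: (@differentiableB _ _ _ _ (fun t => a * pd i f t)).
    exact: (dw t).2.
  exact: smooth_differentiable.
rewrite /laplacian mulr_sumr -sumrB; apply: eq_bigr => i _.
rewrite D.
have -> : (fun t => 'D_(basisv i) w t - a * pd i f t) =
   'D_(basisv i) w - (fun t => a * pd i f t) by [].
rewrite deriveB; [|exact/diff_derivable/(dw t).2|exact: smooth_derivable].
congr (_ - _); rewrite -[LHS]/(pd i (fun t => a * pd i f t) t) pdZ//.
exact: smooth_pd.
Qed.

(** The squared distance, which is polynomial; all radii in the statements below are therefore
    squared radii. *)
Definition sqd y x : R := \sum_i (x ord0 i - y ord0 i) ^+ 2.

Lemma sqd_ge0 y x : 0 <= sqd y x.
Proof. by apply: sumr_ge0 => i _; rewrite sqr_ge0. Qed.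

Lemma smooth_shift y i : smooth (fun x => x ord0 i - y ord0 i).
Proof. by apply: smooth_add; [exact: smooth_coord|exact: smooth_cst]. Qed.

Lemma smooth_sqd y : smooth (sqd y).
Proof. by apply: smooth_sum => i; apply: smooth_exp; exact: smooth_shift. Qed.

Lemma pd_sqd y i : pd i (sqd y) = fun x => 2 * (x ord0 i - y ord0 i).
Proof.
rewrite /sqd pd_sum; last by move=> k; apply: smooth_exp; exact: smooth_shift.
apply/funext => x; rewrite (bigD1_seq i) ?mem_index_enum ?index_enum_uniq//=.
rewrite pd_exp; last exact: smooth_shift.
rewrite pdD; [|exact: smooth_coord|exact: smooth_cst].
rewrite pd_coord pd_cst eqxx big1 => [|k ki]; first by rewrite /=; ring.
rewrite pd_exp; last exact: smooth_shift.
rewrite pdD; [|exact: smooth_coord|exact: smooth_cst].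
by rewrite pd_coord pd_cst (negbTE ki) addr0 mulr0.
Qed.

Lemma sqd_coord y x i (r : R) : sqd y x <= r -> `|x ord0 i - y ord0 i| <= r + 1.
Proof.
move=> h; have h1 : (x ord0 i - y ord0 i) ^+ 2 <= r.
  apply: le_trans h; rewrite /sqd (bigD1 i)//= lerDl sumr_ge0// => k _.
  by rewrite sqr_ge0.
have := sqr_ge0 (`|x ord0 i - y ord0 i| - 1); rewrite sqrrB1 real_normK ?num_real//.
have : 0 <= r by apply: le_trans h1; rewrite sqr_ge0.
by rewrite -mulr_natr; move: h1; lra.
Qed.

(** A negative power in place of the exponential of the classical Hopf barrier: it stays inside the
    class [smooth]. *)
Definition barrier (k : nat) y x : R := (1 + sqd y x)^-1 ^+ k.

Let s1_neq0 y x : 1 + sqd y x != 0.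
Proof. by rewrite gt_eqF// ltr_pwDl// sqd_ge0. Qed.

Lemma smooth_s1V y : smooth (fun x => (1 + sqd y x)^-1).
Proof.
apply: smooth_inv => //; apply: smooth_add; first exact: smooth_cst.
exact: smooth_sqd.
Qed.

Lemma smooth_barrier k y : smooth (barrier k y).
Proof. by apply: smooth_exp; exact: smooth_s1V. Qed.

Lemma pd_s1V y i : pd i (fun x => (1 + sqd y x)^-1) =
  fun x => - (2 * (x ord0 i - y ord0 i)) * ((1 + sqd y x)^-1 * (1 + sqd y x)^-1).
Proof.
rewrite pdV//; last first.
  by apply: smooth_add; [exact: smooth_cst|exact: smooth_sqd].
rewrite pdD; [|exact: smooth_cst|exact: smooth_sqd].
by rewrite pd_cst pd_sqd; apply/funext => x; rewrite add0r.
Qed.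

Lemma laplacian_barrier k y x :
  laplacian (barrier k.+1 y) x = 2 * k.+1%:R * (1 + sqd y x)^-1 ^+ k.+1 *
    (2 * k.+2%:R * sqd y x * (1 + sqd y x)^-1 ^+ 2 - n%:R * (1 + sqd y x)^-1).
Proof.
have P1 j i : pd i (barrier j.+1 y) = fun x =>
    - 2 * j.+1%:R * ((x ord0 i - y ord0 i) * barrier j.+2 y x).
  rewrite /barrier pd_exp; last exact: smooth_s1V.
  by apply/funext => z; rewrite pd_s1V /= [in RHS]exprS [in RHS]exprS; ring.
rewrite /laplacian (eq_bigr (fun i => - 2 * k.+1%:R * (barrier k.+2 y x
   - 2 * k.+2%:R * ((x ord0 i - y ord0 i) ^+ 2 * barrier k.+3 y x)))).
  have B2E : barrier k.+2 y x = (1 + sqd y x)^-1 ^+ k.+2 by [].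
  have B3E : barrier k.+3 y x = (1 + sqd y x)^-1 ^+ k.+3 by [].
  move: (barrier k.+2 y x) (barrier k.+3 y x) B2E B3E => B2 B3 B2E B3E.
  rewrite -mulr_sumr sumrB -mulr_sumr -mulr_suml -/(sqd y x).
  rewrite sumr_const card_ord -[_ *+ n]mulr_natr B2E B3E.
  by rewrite [_ ^+ k.+3]exprS [_ ^+ k.+2]exprS; ring.
move=> i _; rewrite -[LHS]/(pd i (pd i (barrier k.+1 y)) x) P1 pdZ; last first.
  by apply: smooth_mul; [exact: smooth_shift|exact: smooth_barrier].
rewrite pdM; [|exact: smooth_shift|exact: smooth_barrier].
rewrite P1 pdD; [|exact: smooth_coord|exact: smooth_cst].
by rewrite pd_coord pd_cst eqxx /=; ring.
Qed.

(** In [laplacian_barrier] the term carrying [sqd y x] is quadratic in the exponent and the other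
    one only linear, so on an annulus a large exponent wins. *)
Lemma laplacian_barrier_gt (c r0 r1 : R) : 0 <= c -> 0 < r0 -> exists k,
  forall y x, r0 <= sqd y x -> sqd y x <= r1 ->
  c * barrier k.+1 y x < laplacian (barrier k.+1 y) x.
Proof.
move=> c0 r00; have [r10|r1n] := lerP 0 r1; last first.
  by exists 0%N => y x h1 h2; have := sqd_ge0 y x; lra.
pose S := 1 + r1; have S1 : 1 <= S by rewrite lerDl.
(* [B] solves [B * r0 / S^2 = c + n + 1]; on the annulus [1 / S] is a lower bound for
   [z = (1 + d)^-1]. *)
pose B : R := (c + n%:R + 1) * S ^+ 2 / r0.
have B0 : 0 <= B by rewrite divr_ge0 ?(ltW r00)// mulr_ge0 ?exprn_ge0//; [rewrite !addr_ge0|lra].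
exists (Num.truncn B) => y x; set d := sqd y x => dr0 dr1.
have kB : B <= (Num.truncn B).+1%:R by apply/ltW/truncnS_gt.
set k := Num.truncn B in kB *.
rewrite laplacian_barrier -/d /barrier -/d.
set z := (1 + d)^-1.
have d0 : 0 < d by apply: lt_le_trans dr0.
have z0 : 0 < z by rewrite invr_gt0; lra.
have z1 : z <= 1 by rewrite invf_le1; lra.
have zS : S^-1 <= z by rewrite lef_pV2 ?posrE /S; lra.
have zk : 0 < z ^+ k.+1 by rewrite exprn_gt0.
have -> : 2 * k.+1%:R * z ^+ k.+1 * (2 * k.+2%:R * d * z ^+ 2 - n%:R * z) =
  z ^+ k.+1 * (2 * k.+1%:R * (2 * k.+2%:R * d * z ^+ 2 - n%:R * z)) by ring.
rewrite mulrC ltr_pM2l//.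
have SV : 0 < S^-1 by rewrite invr_gt0; lra.
have z2 : S^-1 ^+ 2 <= z ^+ 2 by rewrite lerXn2r// nnegrE ltW.
have key : c + n%:R + 1 <= k.+1%:R * d * z ^+ 2.
  have -> : c + n%:R + 1 = B * r0 * S^-1 ^+ 2.
    rewrite /B; field; apply/andP; split; rewrite gt_eqF//; lra.
  apply: ler_pM => //.
  - by rewrite mulr_ge0// ltW.
  - by rewrite exprn_ge0// ltW.
  - by apply: ler_pM => //; exact: ltW.
have k1 : 1 <= k.+1%:R :> R by rewrite ler1n.
have k2 : k.+2%:R = k.+1%:R + 1 :> R by rewrite natr1.
have nz : n%:R * z <= n%:R by rewrite ler_piMr.
have dz : 0 <= d * z ^+ 2 by rewrite mulr_ge0 ?exprn_ge0// ltW.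
have bk : c + 1 <= 2 * k.+2%:R * d * z ^+ 2 - n%:R * z.
  rewrite k2; have : 0 <= n%:R :> R by []. lra.
apply: (@lt_le_trans _ _ (c + 1)); first by lra.
apply: (le_trans bk); apply: ler_peMl.
  by apply: le_trans bk; rewrite addr_ge0.
by move: k1; move: (k.+1%:R) => K; lra.
Qed.

(** Hopf comparison on the annulus [r <= sqd y x <= 4 r] with [ep * (b - bo)], which lies below [w]
    on the inner sphere and vanishes on the outer one. At a negative interior minimum of the
    difference [g], the bounds [lap w <= c w] and [lap b > c b] make the Laplacian of [g] negative.
    Up to [2 r], well inside the outer sphere, [b > bo] gives positivity. *)
Lemma strong_maximum_step w y (r c : R) : twice_diff w -> (forall x, 0 <= w x) ->
  0 < r -> 0 <= c -> (forall x, sqd y x <= 4 * r -> laplacian w x <= c * w x) ->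
  (forall x, sqd y x <= r -> 0 < w x) -> forall x, sqd y x <= 2 * r -> 0 < w x.
Proof.
move=> dw w0 r0 c0 hw wpos x xr.
have [xr1|xr1] := lerP (sqd y x) r; first exact: wpos.
have cw : continuous w by move=> t; exact/differentiable_continuous/(dw t).1.
have cs : continuous (sqd y) := smooth_continuous (smooth_sqd y).
have ccst (a : R) : continuous (fun _ : 'rV[R]_n => a) by exact: cst_continuous.
have bdd (a : R) t : sqd y t <= a -> forall i, `|t ord0 i| <= a + 1 + `|y|.
  move=> h i; have := sqd_coord i h; have := coord_le_norm y i.
  have := ler_normD (t ord0 i - y ord0 i) (y ord0 i); rewrite subrK; lra.
have [x1 /= x1r x1min] : exists2 x1, sqd y x1 <= r & forall t, sqd y t <= r -> w x1 <= w t.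
  apply: (box_EVT_min cw _ _ (bdd r)); first exact: closed_le_fun cs (ccst r).
  by exists y => /=; rewrite /sqd big1 ?(ltW r0)// => i _; rewrite subrr expr0n.
(* [ep] is the minimum of [w] on the inner ball; as [b <= 1] and [bo > 0], the comparison function
   stays below [ep] on the inner sphere. *)
pose ep := w x1; have ep0 : 0 < ep by exact: wpos.
have [k hk] := @laplacian_barrier_gt c r (4 * r) c0 r0.
pose b := barrier k.+1 y; pose bo : R := (1 + 4 * r)^-1 ^+ k.+1.
have sb : smooth (fun x => b x - bo) by apply: smooth_add; [exact: smooth_barrier|exact: smooth_cst].
have [dg lg] := twice_diff_comb ep dw sb.
set g := (fun t => w t - ep * (b t - bo)) in dg lg.
have cg : continuous g by move=> t; exact/differentiable_continuous/(dg t).1.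
have lb t : laplacian (fun x => b x - bo) t = laplacian b t.
  apply: eq_bigr => i _; rewrite -[LHS]/(pd i (pd i (fun x => b x - bo)) t).
  have -> : pd i (fun x => b x - bo) = pd i b.
    rewrite pdD; [|exact: smooth_barrier|exact: smooth_cst].
    by rewrite pd_cst; apply/funext => z; rewrite addr0.
  by [].
have b_mono (a d : R) : 0 <= a -> a <= d -> (1 + d)^-1 ^+ k.+1 <= (1 + a)^-1 ^+ k.+1.
  move=> a0 ad; apply: lerXn2r; rewrite ?nnegrE ?invr_ge0; [lra|lra|].
  by rewrite lef_pV2 ?posrE; lra.
have b_lt (a d : R) : 0 <= a -> a < d -> (1 + d)^-1 ^+ k.+1 < (1 + a)^-1 ^+ k.+1.
  move=> a0 ad; apply: ltrXn2r => //; rewrite ?nnegrE ?invr_ge0; [lra|].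
  by rewrite ltf_pV2 ?posrE; lra.
have bo0 : 0 < bo by rewrite exprn_gt0// invr_gt0; lra.
have [x0 /= [x0r x0r4] x0min] : exists2 x0, (r <= sqd y x0 /\ sqd y x0 <= 4 * r) &
    forall t, (r <= sqd y t /\ sqd y t <= 4 * r) -> g x0 <= g t.
  apply: (@box_EVT_min _ _ g [set t | r <= sqd y t /\ sqd y t <= 4 * r] (4 * r + 1 + `|y|) cg).
  - exact: (closedI (closed_le_fun (ccst r) cs) (closed_le_fun cs (ccst (4 * r)))).
  - by exists x => /=; split; lra.
  - by move=> t [_ h]; exact: bdd.
have gx : g x0 <= g x by apply: x0min; lra.
suff g0 : 0 <= g x0.
  have : 0 < ep * (b x - bo).
    by rewrite mulr_gt0// subr_gt0; apply: b_lt; [exact: sqd_ge0|lra].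
  by move: gx; rewrite {2}/g; lra.
rewrite leNgt; apply/negP => gneg.
have nr : sqd y x0 != r.
  apply/eqP => h; have : ep <= w x0 by apply: x1min; rewrite h.
  have : b x0 <= 1.
    rewrite /b /barrier exprn_ile1// ?invr_ge0 ?invf_le1; have := sqd_ge0 y x0; lra.
  by move: gneg; rewrite /g; nra.
have n4r : sqd y x0 != 4 * r.
  apply/eqP => h; move: gneg; rewrite /g /b /barrier h -/bo subrr mulr0 subr0.
  by rewrite ltNge w0.
have rlt : r < sqd y x0 by rewrite lt_neqAle eq_sym nr.
have lt4r : sqd y x0 < 4 * r by rewrite lt_neqAle n4r.
have hmin : \forall t \near x0, g x0 <= g t.
  have n1 : \forall t \near x0, r < sqd y t by exact: (cvgr_gt _ (cs x0)).
  have n2 : \forall t \near x0, sqd y t < 4 * r by exact: (cvgr_lt _ (cs x0)).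
  by apply: filterS2 n1 n2 => t h1 h2; apply: x0min; split; exact: ltW.
have := laplacian_ge0_at_min dg hmin; rewrite lg lb => h1.
have h2 := hw x0 (ltW lt4r).
have h3 := hk y x0 (ltW rlt) (ltW lt4r); rewrite -/b in h3.
have h4 : ep * (c * b x0) < ep * laplacian b x0 by rewrite ltr_pM2l.
have : c * g x0 <= 0 by rewrite mulr_ge0_le0// ltW.
have h5 : 0 <= ep * c * bo by rewrite !mulr_ge0// ltW.
move: h1 h2 h4 h5; rewrite /g.
move: (laplacian w x0) (laplacian b x0) (w x0) (b x0) => W B w1 b1; clear; lra.
Qed.

(** Each step doubles the squared radius of a ball of positivity and uses the constant of a single
    larger ball, so [c] may depend on the radius. *)
Theorem strong_maximum w y : twice_diff w -> (forall x, 0 <= w x) ->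
  (forall r : R, exists2 c : R, 0 <= c & forall x, sqd y x <= r -> laplacian w x <= c * w x) ->
  0 < w y -> forall x, 0 < w x.
Proof.
move=> dw w0 hw wy.
have cw : {for y, continuous w} by exact/differentiable_continuous/(dw y).1.
have : \forall t \near y, 0 < w t by exact: (cvgr_gt _ cw).
move=> /nbhs_normP[e /= e0 he].
have [r0 r00 hr0] : exists2 r0 : R, 0 < r0 & forall x, sqd y x <= r0 -> 0 < w x.
  exists ((e / 2) ^+ 2); first by rewrite exprn_gt0// divr_gt0.
  move=> x hx; apply: he => /=; apply: (@le_lt_trans _ _ (e / 2)); last by lra.
  rewrite [leLHS]/Num.norm /= mx_normrE; apply/bigmax_leP; split; first by lra.
  move=> [a i] _ /=; rewrite (ord1 a) !mxE distrC.
  rewrite -(@ler_pXn2r _ 2)// ?nnegrE//; last by lra.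
  rewrite real_normK ?num_real//; apply: le_trans hx.
  by rewrite /sqd (bigD1 i)//= lerDl sumr_ge0// => j _; rewrite sqr_ge0.
have iter j : forall x, sqd y x <= 2 ^+ j * r0 -> 0 < w x.
  elim: j => [|j IH] x; first by rewrite expr0 mul1r; exact: hr0.
  have p0 : 0 < 2 ^+ j * r0 by rewrite mulr_gt0// exprn_gt0.
  have [c c0 hc] := hw (4 * (2 ^+ j * r0)).
  by rewrite exprS -mulrA; apply: (strong_maximum_step dw w0 p0 c0).
move=> x; apply: (iter (Num.truncn (sqd y x / r0)).+1).
rewrite -ler_pdivrMr//; apply: le_trans (ltW (truncnS_gt _)) _.
rewrite -natrX ler_nat ltnW// ltn_expl//.
Qed.

End StrongMaximum.

(** * Derivatives on the sphere *)

Section Affine.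
Context {R : realType} {d n : nat}.
Variables (om : 'rV[R]_n) (B : 'M[R]_(d, n)).

(** The class [smooth] has no composition rule, so the chain rule for affine maps is proved by
    induction on the class. It serves both the scalings of space and the planes underlying the
    charts. *)
Lemma smooth_affine (g : 'rV[R]_n -> R) : smooth g ->
  smooth (fun u : 'rV[R]_d => g (om + u *m B)) /\
  forall i, pd i (fun u : 'rV[R]_d => g (om + u *m B)) =
    fun u => \sum_l B i l * pd l g (om + u *m B).
Proof.
elim=> {g} [c|k|f g sf [sf' df] sg [sg' dg]|f g sf [sf' df] sg [sg' dg]|f sf [sf' df] f0].
- split; first exact: smooth_cst.
  move=> i; rewrite pd_cst; apply/funext => u.
  by rewrite big1// => l _; rewrite pd_cst mulr0.
- have E : (fun u : 'rV[R]_d => (om + u *m B) ord0 k) =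
      fun u => om ord0 k + \sum_l u ord0 l * B l k.
    by apply/funext => u; rewrite !mxE.
  have st l : smooth (fun u : 'rV[R]_d => u ord0 l * B l k).
    by apply: smooth_mul; [exact: smooth_coord|exact: smooth_cst].
  rewrite E; split; first by apply: smooth_add; [exact: smooth_cst|exact: smooth_sum].
  move=> i; rewrite pdD; [|exact: smooth_cst|exact: smooth_sum].
  rewrite pd_cst pd_sum//; apply/funext => u; rewrite add0r.
  rewrite [RHS](bigD1 k)//= pd_coord eqxx mulr1 [X in _ = _ + X]big1; last first.
    by move=> l lk; rewrite pd_coord eq_sym (negbTE lk) mulr0.
  rewrite addr0.
  rewrite (bigD1 i)//= big1 ?addr0 => [|l li].
    rewrite pdM; [|exact: smooth_coord|exact: smooth_cst].
    by rewrite pd_coord pd_cst eqxx mulr0 addr0 mul1r.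
  rewrite pdM; [|exact: smooth_coord|exact: smooth_cst].
  by rewrite pd_coord pd_cst (negbTE li) mul0r mulr0 addr0.
- split; first exact: smooth_add.
  move=> i; rewrite pdD// df dg; apply/funext => u; rewrite -big_split.
  by apply: eq_bigr => l _ /=; rewrite pdD// mulrDr.
- split; first exact: smooth_mul.
  move=> i; rewrite pdM// df dg; apply/funext => u; rewrite mulr_suml mulr_sumr -big_split.
  by apply: eq_bigr => l _ /=; rewrite pdM//; ring.
- split; first exact: smooth_inv.
  move=> i; rewrite pdV// df; apply/funext => u; rewrite -sumrN mulr_suml.
  by apply: eq_bigr => l _ /=; rewrite pdV//; ring.
Qed.

End Affine.

Section Homogeneous.
Context {R : realType} {n : nat}.
Variables (f : 'rV[R]_n -> R) (N : nat).
Hypothesis sf : smooth f.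
Hypothesis fhom : forall c t, f (c *: t) = c ^+ N * f t.
Local Notation F := (iter_partial ^~ f).

(** Powers are kept on both sides instead of divided out, so that the identity covers orders beyond
    the degree as well. *)
Lemma iter_partial_scale a c t : c ^+ size a * F a (c *: t) = c ^+ N * F a t.
Proof.
elim: a t => [|i a IH] t /=; first by rewrite mul1r fhom.
have sa : smooth (F a) := smooth_iter_partial a sf.
have E (u : 'rV[R]_n) : c *: u = 0 + u *m (c%:M : 'M[R]_n).
  by rewrite add0r mul_mx_scalar.
have [s1 d1] := smooth_affine 0 (c%:M : 'M[R]_n) sa.
have : pd i (fun u => c ^+ size a * F a (0 + u *m (c%:M : 'M[R]_n))) t =
       pd i (fun u => c ^+ N * F a u) t.
  by congr (pd i _ t); apply/funext => u; rewrite -IH E.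
rewrite pdZ// pdZ// d1 -E (bigD1 i)//= big1 ?addr0 => [|l li].
  by rewrite mxE eqxx mulr1n mulrA -exprSr.
by rewrite mxE eq_sym (negbTE li) mulr0n mul0r.
Qed.

Lemma iter_partial_hom a c t : (size a <= N)%N -> c != 0 ->
  F a (c *: t) = c ^+ (N - size a) * F a t.
Proof.
move=> aN c0; apply: (mulfI (expf_neq0 (size a) c0)).
by rewrite iter_partial_scale mulrA -exprD subnKC.
Qed.

(** For [c] nonzero the scaling identity reads [F a t = c^(size a - N) * F a (c t)], and the right
    side tends to 0 with [c]. *)
Lemma iter_partial_gt a : (N < size a)%N -> F a = fun=> 0.
Proof.
move=> Na; apply/funext => t.
have sa : smooth (F a) := smooth_iter_partial a sf.
have cF : (fun c : R => F a (c *: t)) @ 0 --> F a 0.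
  have h : (fun c : R => c *: t) @ 0 --> (0 : R) *: t.
    by apply: scalel_continuous.
  rewrite scale0r in h.
  exact: (@continuous_cvg _ _ _ _ _ _ (F a) 0 (smooth_continuous sa (x := 0)) h).
have dn (g : R -> R) (l : R) : g @ 0 --> l -> g @ 0^' --> l.
  by move=> h; apply: cvg_trans h; apply: cvg_app; exact: cvg_within.
have : (fun c : R => c ^+ (size a - N) * F a (c *: t)) @ 0^' --> 0 * F a 0.
  apply: cvgM; last exact: dn.
  apply: dn; have := @exprn_continuous R (size a - N) 0.
  by rewrite /continuous_at expr0n subn_eq0 leqNgt Na.
rewrite mul0r => h0.
have e : {near (0 : R)^', (fun=> F a t) =1
    (fun c : R => c ^+ (size a - N) * F a (c *: t))}.
  rewrite near_withinE; apply: filterE => c /= c0.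
  apply: (mulfI (expf_neq0 N c0)); rewrite mulrA -exprD subnKC 1?ltnW//.
  by rewrite iter_partial_scale.
have h1 := cvg_trans (near_eq_cvg e) (cvg_cst (F a t)).
by rewrite -(cvg_lim (@Rhausdorff R) (h1 _ _)) (cvg_lim (@Rhausdorff R) h0).
Qed.

(** Derivatives are indexed by ordered lists, with mixed ones counted repeatedly. Adding one
    direction then maps lists of length [l] exactly onto those of length [l + 1], which is what
    makes the Laplacian of [G_l] produce [G_(l+1)]. *)
Fixpoint seqs l : seq (seq 'I_n) :=
  if l is l'.+1 then [seq i :: a | i <- enum 'I_n, a <- seqs l'] else [:: [::]].

Lemma size_seqs l a : a \in seqs l -> size a = l.
Proof.
elim: l a => [|l IH] a /=; first by rewrite inE => /eqP ->.
by case/allpairsP => -[i b] /= [_ /IH <- ->].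
Qed.

Lemma mem_seqs a : a \in seqs (size a).
Proof.
elim: a => [|i a IH] /=; first by rewrite inE.
by apply/allpairsP; exists (i, a) => /=; rewrite mem_enum.
Qed.

Lemma sum_seqsS (V : nmodType) l (h : seq 'I_n -> V) :
  \sum_(a <- seqs l.+1) h a = \sum_i \sum_(a <- seqs l) h (i :: a).
Proof. by rewrite /= big_allpairs_dep big_enum. Qed.

End Homogeneous.

Section Sphere.
Context {R : realType} {n : nat}.

Lemma dotv_ge0 (t : 'rV[R]_n) : 0 <= dotv t t.
Proof. by apply: sumr_ge0 => i _; rewrite -expr2 sqr_ge0. Qed.

Lemma smooth_dotv : smooth (fun t : 'rV[R]_n => dotv t t).
Proof. by apply: smooth_sum => i; apply: smooth_mul; exact: smooth_coord. Qed.

Lemma dotv_coord (t : 'rV[R]_n) i : t ord0 i ^+ 2 <= dotv t t.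
Proof.
rewrite /dotv (bigD1 i)//= -expr2 lerDl sumr_ge0// => k _.
by rewrite -expr2 sqr_ge0.
Qed.

Lemma dotvZ c (t : 'rV[R]_n) : dotv (c *: t) (c *: t) = c ^+ 2 * dotv t t.
Proof. by rewrite /dotv mulr_sumr; apply: eq_bigr => i _; rewrite !mxE; ring. Qed.

Lemma polar (t : 'rV[R]_n) : 0 < dotv t t ->
  exists om, unit_sphere n om /\ t = enorm t *: om /\ 0 < enorm t.
Proof.
move=> t0; have r0 : 0 < enorm t by rewrite sqrtr_gt0.
exists ((enorm t)^-1 *: t); split.
  rewrite /unit_sphere /= dotvZ exprVn sqr_sqrtr ?dotv_ge0// mulVf// gt_eqF//.
by rewrite scalerA mulfV ?scale1r// gt_eqF.
Qed.

Lemma sphere_closed : closed (unit_sphere n : set 'rV[R]_n).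
Proof.
apply: closed_eq_fun; first exact: (smooth_continuous smooth_dotv).
exact: cst_continuous.
Qed.

Lemma sphere_coord (t : 'rV[R]_n) : unit_sphere n t -> forall i, `|t ord0 i| <= 1.
Proof.
move=> h i; have := dotv_coord t i; rewrite h => h2.
by rewrite -(@ler_pXn2r _ 2)// ?nnegrE// real_normK ?num_real// expr1n.
Qed.

Lemma sphere_nonempty : (0 < n)%N -> (unit_sphere n : set 'rV[R]_n) !=set0.
Proof.
case: n => // k _; exists (delta_mx 0 ord0); rewrite /unit_sphere /= /dotv.
rewrite (bigD1 ord0)//= mxE !eqxx mulr1 big1 ?addr0// => i i0.
by rewrite mxE (negbTE i0) andbF mulr0.
Qed.

Lemma sphere_lower (g : 'rV[R]_n -> R) : (0 < n)%N -> smooth g ->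
  (forall om, unit_sphere n om -> 0 < g om) ->
  exists2 c, 0 < c & forall om, unit_sphere n om -> c <= g om.
Proof.
move=> n0 sg gpos.
have [t0 t0S h] := box_EVT_min (smooth_continuous sg) sphere_closed
  (sphere_nonempty n0) sphere_coord.
by exists (g t0) => //; exact: gpos.
Qed.

Lemma sphere_upper (g : 'rV[R]_n -> R) : (0 < n)%N -> smooth g ->
  exists c, forall om, unit_sphere n om -> g om <= c.
Proof.
move=> n0 sg.
have [t0 t0S h] := box_EVT_max (smooth_continuous sg) sphere_closed
  (sphere_nonempty n0) sphere_coord.
by exists (g t0).
Qed.

Lemma homogeneous_upper (g : 'rV[R]_n -> R) s : (0 < n)%N -> smooth g ->
  (forall c t, g (c *: t) = c ^+ (2 * s) * g t) ->
  exists2 C, 0 <= C & forall t, g t <= C * (1 + dotv t t) ^+ s.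
Proof.
move=> n0 sg ghom; have [c hc] := sphere_upper n0 sg.
exists (`|c| + `|g 0|); first by rewrite addr_ge0.
move=> t; have w1 : 1 <= (1 + dotv t t) ^+ s.
  by rewrite exprn_ege1// lerDl dotv_ge0.
have [t0|t0] := ltrP 0 (dotv t t); last first.
  have -> : t = 0.
    apply/rowP => i; have := dotv_coord t i; rewrite mxE => h.
    have : t ord0 i ^+ 2 <= 0 by apply: le_trans h t0.
    by rewrite real_exprn_even_le0 ?num_real//= => /eqP.
  apply: (@le_trans _ _ (`|c| + `|g 0|)).
    by rewrite (le_trans (ler_norm _))// lerDr.
  by rewrite ler_peMr ?addr_ge0// exprn_ege1// lerDl dotv_ge0.
have [om [omS [tE r0]]] := polar t0.
rewrite {1}tE ghom exprM sqr_sqrtr ?dotv_ge0//.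
apply: (@le_trans _ _ (dotv t t ^+ s * `|c|)).
  rewrite ler_wpM2l ?exprn_ge0 ?dotv_ge0//.
  by apply: le_trans (ler_norm _); exact: hc.
rewrite mulrC; apply: ler_pM => //; rewrite ?exprn_ge0 ?dotv_ge0 ?lerDl//.
by apply: lerXn2r; rewrite ?nnegrE ?addr_ge0 ?dotv_ge0// lerDr.
Qed.

End Sphere.

(** * From derivatives in a chart to derivatives in the ambient space *)

Section Chart.
Context {R : realType} {n : nat}.
Variables (q : mpoly.mpoly n R) (m : nat) (om : 'rV[R]_n) (B : 'M[R]_(n.-1, n)).
Hypothesis qhom : homogeneous (2 * m) q.
Local Notation F := (iter_partial ^~ (evalp q)).

(* Functions of [u] that are smooth combinations of the derivatives of [q] of
   order at most [k] along the affine plane [om + u B]. *)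
Inductive chart_comb (k : nat) : ('rV[R]_(n.-1) -> R) -> Prop :=
| chart_comb0 : chart_comb k (fun=> 0)
| chart_combD rho a g : smooth rho -> (size a <= k)%N -> chart_comb k g ->
    chart_comb k (fun u => rho u * F a (om + u *m B) + g u).

Lemma smooth_F a : smooth (fun u : 'rV[R]_(n.-1) => F a (om + u *m B)).
Proof. by have [] := smooth_affine om B (smooth_iter_partial a (smooth_evalp q)). Qed.

Lemma chart_comb_smooth k g : chart_comb k g -> smooth g.
Proof.
elim=> [|rho a h srho _ _ sh]; first exact: smooth_cst.
by apply: smooth_add => //; apply: smooth_mul => //; exact: smooth_F.
Qed.

Lemma chart_comb_sum k (I : Type) (s : seq I) (rho : I -> 'rV[R]_(n.-1) -> R)
    (a : I -> seq 'I_n) g :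
  (forall l, smooth (rho l)) -> (forall l, (size (a l) <= k)%N) -> chart_comb k g ->
  chart_comb k (fun u => \sum_(l <- s) rho l u * F (a l) (om + u *m B) + g u).
Proof.
move=> srho ak cg; elim: s => [|l s IH].
  rewrite (_ : (fun u => _) = g)//.
  by apply/funext => u; rewrite big_nil add0r.
rewrite (_ : (fun u => _) = fun u => rho l u * F (a l) (om + u *m B) +
   (\sum_(l <- s) rho l u * F (a l) (om + u *m B) + g u)); first exact: chart_combD.
by apply/funext => u; rewrite big_cons addrA.
Qed.

Lemma chart_comb_pd k g i : chart_comb k g -> chart_comb k.+1 (pd i g).
Proof.
elim=> [|rho a h srho ak ch IH]; first by rewrite pd_cst; exact: chart_comb0.
have sh := chart_comb_smooth ch.
rewrite pdD//; last by apply: smooth_mul => //; exact: smooth_F.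
rewrite pdM//; last exact: smooth_F.
have [_ ->] := smooth_affine om B (smooth_iter_partial a (smooth_evalp q)).
rewrite (_ : (fun t => _) = fun t => pd i rho t * F a (om + t *m B) +
  (\sum_(l <- enum 'I_n) (rho t * B i l) * F (l :: a) (om + t *m B) + pd i h t)).
  apply: chart_combD; [exact: smooth_pd|exact: leqW|].
  apply: chart_comb_sum => //= l; apply: smooth_mul => //; exact: smooth_cst.
apply/funext => t; rewrite -addrA; congr (_ + (_ + _)).
by rewrite mulr_sumr big_enum; apply: eq_bigr => l _; rewrite mulrA.
Qed.

(** Even homogeneity pulls the square root out of the chart as the smooth factor [(1 + |u|^2)^(-m)].
    A chart derivative at the origin is then a combination of ambient derivatives at [om] of no
    higher order, and one of these must be nonzero. *)
Lemma chart_nonvanishing idx :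
  iter_partial idx (fun u => evalp q (sphere_chart om B u)) 0 != 0 ->
  exists2 a, (size a <= size idx)%N & F a om != 0.
Proof.
have w0 (u : 'rV[R]_(n.-1)) : 0 < 1 + dotv u u by rewrite ltr_pwDl// dotv_ge0.
have gE : (fun u => evalp q (sphere_chart om B u)) =
   fun u => (1 + dotv u u)^-1 ^+ m * F [::] (om + u *m B) + 0.
  apply/funext => u; rewrite /sphere_chart (evalp_homogeneous _ _ qhom) addr0.
  congr (_ * _); rewrite exprM; congr (_ ^+ m).
  by rewrite exprVn sqr_sqrtr// ltW.
have cc : chart_comb (size idx)
    (iter_partial idx (fun u => evalp q (sphere_chart om B u))).
  rewrite gE; elim: idx => [|i idx IH] /=; last exact: chart_comb_pd.
  apply: (@chart_combD _ (fun u => (1 + dotv u u)^-1 ^+ m) [::] (fun=> 0)) => //;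
    last exact: chart_comb0.
  apply: smooth_exp; apply: smooth_inv => [|u]; last by rewrite gt_eqF.
  by apply: smooth_add; [exact: smooth_cst|exact: smooth_dotv].
elim: cc => [|rho a g _ ak _ IH]; first by rewrite eqxx.
rewrite mul0mx addr0; have [h|h] := eqVneq (F a om) 0; last by exists a.
by rewrite h mulr0 add0r; exact: IH.
Qed.

End Chart.

(** * The supersolution *)

Section Scalar.
Context {R : realType}.

(** Here [x l] stands for the square root of [G_l/D], and each bracket for a lower bound on the
    Laplacian of [G_l/D] in units of [mm]: a gain from the next order, a loss from its own.
    Induction on [N]: either the orders up to [N] carry mass [tau^2], and the old bound pays for the
    new loss [C * x N]; or [x N <= tau], the loss is small, and the gain from [x N.+1] prevails. The
    first conclusion, a small deficit valid without any mass, controls the old terms in the second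
    case. *)
Lemma scalar_absorption (C : R) N : 0 <= C -> forall sig eta : R, 0 < sig -> 0 < eta ->
  exists (ep : nat -> R) (A c0 : R), [/\ forall l, 0 < ep l, 0 <= A, 0 < c0 &
  forall x : nat -> R, (forall l, 0 <= x l <= 1) ->
    - (eta * c0) <= A * x 0%N + \sum_(l < N) ep l * (2 * x l.+1 ^+ 2 - C * x l) /\
    (sig <= \sum_(l < N.+1) x l ^+ 2 ->
     c0 <= A * x 0%N + \sum_(l < N) ep l * (2 * x l.+1 ^+ 2 - C * x l))].
Proof.
move=> C0; elim: N => [|N IH] sig eta sig0 eta0.
  exists (fun=> 1), 1, sig; split=> // x x01; rewrite big_ord0 addr0 mul1r big_ord1.
  have /andP[x0 x1] := x01 0%N; split=> [|h].
    by apply: le_trans x0; rewrite oppr_le0 mulr_ge0// ltW.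
  by apply: le_trans h _; rewrite expr2 ler_piMr.
(* The new weight is [c * mu], with [mu] so small that the new loss is at most [c / 2]; the new
   lower bound will be [c * nu]. *)
pose mu : R := (2 * (C + 1))^-1.
have mu0 : 0 < mu by rewrite invr_gt0; lra.
have muC : mu * C <= 1 / 2.
  have : mu * (2 * (C + 1)) = 1 by rewrite mulVf// gt_eqF//; lra.
  by move: mu0; lra.
pose nu : R := Num.min (1 / 2) (mu * sig / 2).
have nu0 : 0 < nu by rewrite lt_min; apply/andP; split; [lra|rewrite divr_gt0// mulr_gt0].
have nu1 : nu <= 1 / 2 by rewrite ge_min lexx.
have nu2 : nu <= mu * sig / 2 by rewrite ge_min lexx orbT.
(* [tau] and, below, [eta'] each use up at most half of the allowed deficit [eta * nu], and both
   stay small against the gain, which is proportional to [sig]. *)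
pose tau : R := Num.min 1 (Num.min (sig / 2 / (2 + C)) (eta * nu / 2 / (mu * (C + 1)))).
have C2 : 0 < 2 + C by lra.
have muC1 : 0 < mu * (C + 1) by rewrite mulr_gt0//; lra.
have tau0 : 0 < tau.
  rewrite !lt_min ltr01 /=; apply/andP; split; do 2 apply: divr_gt0 => //.
  exact: mulr_gt0.
have tau1 : tau <= 1 by rewrite ge_min lexx.
have tau2 : (2 + C) * tau <= sig / 2.
  by rewrite mulrC -ler_pdivlMr// ge_min ge_min lexx orbT.
have tau3 : mu * (C + 1) * tau <= eta * nu / 2.
  by rewrite mulrC -ler_pdivlMr// ge_min ge_min lexx !orbT.
pose eta' : R := Num.min (eta * nu / 2) (mu * sig / 2).
have eta'0 : 0 < eta' by rewrite lt_min; apply/andP; split; rewrite divr_gt0// mulr_gt0.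
have eta'1 : eta' <= eta * nu / 2 by rewrite ge_min lexx.
have eta'2 : eta' <= mu * sig / 2 by rewrite ge_min lexx orbT.
have t2 : 0 < tau ^+ 2 by rewrite exprn_gt0.
have [ep [A [c [ep0 A0 c0 hS]]]] := IH (tau ^+ 2) eta' t2 eta'0.
exists (fun l => if l == N then c * mu else ep l), A, (c * nu); split => //.
- by move=> l; case: ifP => // _; rewrite mulr_gt0.
- by rewrite mulr_gt0.
move=> x x01; have [hS1 hS2] := hS x x01.
rewrite big_ord_recr /= eqxx.
rewrite (eq_bigr (fun l : 'I_N => ep l * (2 * x l.+1 ^+ 2 - C * x l))) => [|l _]; last first.
  by rewrite ltn_eqF.
rewrite addrA [\sum_(l < N.+2) _]big_ord_recr /=.
move: hS1 hS2; set S' := A * _ + _; set T := \sum_(l < N.+1) x l ^+ 2 => hS1 hS2.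
have /andP[xN0 xN1] := x01 N; have /andP[y0 y1] := x01 N.+1.
have y2 : 0 <= x N.+1 ^+ 2 by rewrite sqr_ge0.
have cmu : 0 < c * mu by rewrite mulr_gt0.
have ecn : 0 <= eta * (c * nu) by rewrite !mulr_ge0// ltW.
have [hT|hT] := lerP (tau ^+ 2) T.
  have {}hS2 := hS2 hT.
  have h1 : c * mu * (C * x N) <= c / 2.
    have : mu * C * x N <= 1 / 2 by apply: le_trans muC; rewrite ler_piMr// mulr_ge0// ltW.
    by move=> /(ler_wpM2l (ltW c0)); lra.
  have h2 : 0 <= c * mu * x N.+1 ^+ 2 by rewrite mulr_ge0// ltW.
  have h3 : c * nu <= c * (1 / 2) by rewrite ler_pM2l.
  have h4 : c * nu <= S' + c * mu * (2 * x N.+1 ^+ 2 - C * x N) by lra.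
  split=> //; apply: le_trans h4; apply: (@le_trans _ _ 0); first by rewrite oppr_le0.
  by rewrite mulr_ge0// ltW.
have xt : x N <= tau.
  rewrite -(@ler_pXn2r _ 2)// ?nnegrE// ?(ltW tau0)//; apply: le_trans (ltW hT).
  by rewrite /T big_ord_recr /= lerDr sumr_ge0// => l _; rewrite sqr_ge0.
have h1 : c * (mu * (C * x N)) <= c * (eta * nu / 2).
  rewrite ler_pM2l//; apply: le_trans tau3; rewrite -mulrA ler_pM2l//.
  by rewrite ler_pM//; lra.
have h2 : 0 <= c * mu * x N.+1 ^+ 2 by rewrite mulr_ge0// ltW.
have h3 : c * eta' <= c * (eta * nu / 2) by rewrite ler_pM2l.
split; first by lra.
move=> hs.
have ts : tau ^+ 2 <= tau by rewrite expr2 ler_piMr// ltW.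
have Cx : C * x N <= C * tau by rewrite ler_wpM2l.
have h4 : 3 / 2 * sig <= 2 * x N.+1 ^+ 2 - C * x N by lra.
have h5 : c * mu * (3 / 2 * sig) <= c * mu * (2 * x N.+1 ^+ 2 - C * x N) by rewrite ler_pM2l.
have h6 : c * eta' <= c * (mu * sig / 2) by rewrite ler_pM2l.
have h7 : c * nu <= c * (mu * sig / 2) by rewrite ler_pM2l.
have h8 : 0 <= c * mu * sig by rewrite !mulr_ge0// ltW.
move: hS1 h5 h6 h7 h8; clear; lra.
Qed.

Lemma norm_sum_size (I : eqType) (s : seq I) (u : I -> R) (c : R) :
  (forall a, a \in s -> `|u a| <= c) -> `|\sum_(a <- s) u a| <= (size s)%:R * c.
Proof.
elim: s => [|a s IH] h; first by rewrite big_nil normr0 mul0r.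
rewrite big_cons (le_trans (ler_normD _ _))//= -natr1 mulrDl mul1r addrC.
rewrite lerD ?h ?mem_head// IH// => b bs; apply: h.
by rewrite inE bs orbT.
Qed.

End Scalar.

Section Weights.
Context {R : realType} {n : nat}.
Implicit Types (t : 'rV[R]_n) (i : 'I_n).

Definition wgt t : R := 1 + dotv t t.
(** The logarithmic derivative of [wgt]. It is bounded by 1, so differentiating a power of [wgt]
    costs only a constant factor. *)
Definition bet i t : R := 2 * t ord0 i * (wgt t)^-1.

Lemma wgt_ge1 t : 1 <= wgt t. Proof. by rewrite lerDl dotv_ge0. Qed.
Lemma wgt_gt0 t : 0 < wgt t. Proof. exact: lt_le_trans (wgt_ge1 t). Qed.
Lemma wgt_neq0 t : wgt t != 0. Proof. by rewrite gt_eqF// wgt_gt0. Qed.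

Lemma smooth_wgt : smooth wgt.
Proof. by apply: smooth_add; [exact: smooth_cst|exact: smooth_dotv]. Qed.

Lemma smooth_wgtV : smooth (fun t => (wgt t)^-1).
Proof. by apply: smooth_inv; [exact: smooth_wgt|exact: wgt_neq0]. Qed.

Lemma smooth_bet i : smooth (bet i).
Proof.
apply: smooth_mul; last exact: smooth_wgtV.
by apply: smooth_mul; [exact: smooth_cst|exact: smooth_coord].
Qed.

Lemma pd_wgt i : pd i wgt = fun t => 2 * t ord0 i.
Proof.
rewrite (_ : wgt = fun t => 1 + sqd 0 t); last first.
  apply/funext => t; rewrite /wgt /dotv /sqd; congr (_ + _).
  by apply: eq_bigr => k _; rewrite mxE subr0 expr2.
rewrite pdD; [|exact: smooth_cst|exact: smooth_sqd].
by rewrite pd_cst pd_sqd; apply/funext => t; rewrite mxE subr0 add0r.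
Qed.

Lemma pd_wgtV i : pd i (fun t => (wgt t)^-1) = fun t => - bet i t * (wgt t)^-1.
Proof.
rewrite pdV ?pd_wgt; [|exact: smooth_wgt|exact: wgt_neq0].
by apply/funext => t; rewrite /bet; ring.
Qed.

Lemma pd_bet i : pd i (bet i) = fun t => 2 * (wgt t)^-1 - bet i t ^+ 2.
Proof.
have s2 : smooth (fun t : 'rV[R]_n => 2 * t ord0 i).
  by apply: smooth_mul; [exact: smooth_cst|exact: smooth_coord].
rewrite pdM ?pd_wgtV ?pdZ ?pd_coord//; [|exact: smooth_coord|exact: smooth_wgtV].
by apply/funext => t; rewrite eqxx /bet /=; ring.
Qed.

Lemma bet_le1 i t : `|bet i t| <= 1.
Proof.
rewrite /bet normrM normfV [`|wgt t|]ger0_norm ?(ltW (wgt_gt0 t))//.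
rewrite ler_pdivrMr ?wgt_gt0// mul1r /wgt.
have := dotv_coord t i; have := sqr_ge0 (`|t ord0 i| - 1).
rewrite sqrrB1 real_normK ?num_real// -mulr_natr normrM ger0_norm//.
lra.
Qed.

Lemma wgtV_le1 t : (wgt t)^-1 <= 1.
Proof. by rewrite invf_le1 ?wgt_gt0// wgt_ge1. Qed.

Lemma wgtV_gt0 t : 0 < (wgt t)^-1.
Proof. by rewrite invr_gt0 wgt_gt0. Qed.

Lemma bet_sq_le1 i t : bet i t ^+ 2 <= 1.
Proof. by rewrite -real_normK ?num_real// exprn_ile1// bet_le1. Qed.

Lemma pd_bet_le2 i t : `|pd i (bet i) t| <= 2.
Proof.
rewrite pd_bet; have := wgtV_le1 t; have := wgtV_gt0 t.
have := bet_sq_le1 i t; have := sqr_ge0 (bet i t).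
by rewrite ler_norml => *; apply/andP; split; lra.
Qed.

End Weights.

Section PointwiseBounds.
Context {R : realType}.
Variables (K k b b' E P Q S M Y : R).
Hypotheses (k0 : 0 <= k) (kK : k <= K) (b1 : `|b| <= 1) (b'2 : `|b'| <= 2).
Hypotheses (M1 : 1 <= M) (E0 : 0 <= E) (EY : E <= Y).
Hypotheses (PY : `|P| <= M * Y) (QY : `|Q| <= M ^+ 2 * Y).

Let Y0 : 0 <= Y. Proof. exact: le_trans EY. Qed.
Let K0 : 0 <= K. Proof. exact: le_trans kK. Qed.
Let MY : Y <= M * Y. Proof. by rewrite ler_peMl. Qed.
Let M0 : 0 <= M. Proof. by apply: le_trans M1. Qed.
Let MMY : M * Y <= M ^+ 2 * Y.
Proof. by rewrite expr2 -mulrA ler_peMl// mulr_ge0. Qed.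

(** The letters stand for the quantities at one point: [E], [P] for [Eq] and [Pq], [b] and [b'] for
    [bet] and its derivative, [S] and [Q] for the square and the mixed term in the second
    derivative, [M] for [Mq], and [Y] for [Xq * dl]. *)
Lemma first_derivative_bound : `|k * b * E + 2 * P| <= (K + 2) * (M * Y).
Proof.
rewrite [(K + 2) * _]mulrDl; apply: le_trans (ler_normD _ _) _; apply: lerD.
  rewrite !normrM (ger0_norm k0) (ger0_norm E0) -mulrA.
  apply: ler_pM => //; first by rewrite mulr_ge0.
  by apply: le_trans MY; rewrite -[leRHS]mul1r; apply: ler_pM.
by rewrite normrM ger0_norm// ler_wpM2l.
Qed.

Lemma second_derivative_bound :
  `|k * b' * E + k * b * (k * b * E + 2 * P) + 2 * (k * b * P + (S + Q)) - 2 * S|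
    <= (K ^+ 2 + 6 * K + 2) * (M ^+ 2 * Y).
Proof.
have -> : k * b' * E + k * b * (k * b * E + 2 * P) + 2 * (k * b * P + (S + Q)) - 2 * S
   = k * (b' * E) + (k * k) * ((b * b) * E) + 4 * (k * (b * P)) + 2 * Q by ring.
have EYY : E <= M ^+ 2 * Y by apply: le_trans EY _; apply: le_trans MY _.
have Z0 : 0 <= M ^+ 2 * Y by rewrite mulr_ge0// exprn_ge0.
have h1 : `|k * (b' * E)| <= K * (2 * (M ^+ 2 * Y)).
  rewrite !normrM (ger0_norm k0) (ger0_norm E0).
  by apply: ler_pM => //; [rewrite mulr_ge0|apply: ler_pM].
have h2 : `|(k * k) * ((b * b) * E)| <= (K * K) * (M ^+ 2 * Y).
  rewrite !normrM (ger0_norm k0) (ger0_norm E0).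
  apply: ler_pM => //; rewrite ?mulr_ge0//; first exact: ler_pM.
  rewrite -[leRHS]mul1r; apply: ler_pM => //; rewrite ?mulr_ge0//.
  by rewrite -[leRHS]mul1r; apply: ler_pM.
have h3 : `|4 * (k * (b * P))| <= 4 * (K * (M ^+ 2 * Y)).
  rewrite !normrM (ger0_norm k0) ger0_norm// ler_wpM2l//.
  apply: ler_pM; rewrite ?mulr_ge0//.
  rewrite -[leRHS]mul1r; apply: ler_pM => //; exact: le_trans MMY.
have h4 : `|2 * Q| <= 2 * (M ^+ 2 * Y) by rewrite normrM ger0_norm// ler_wpM2l.
have -> : (K ^+ 2 + 6 * K + 2) * (M ^+ 2 * Y) =
   K * (2 * (M ^+ 2 * Y)) + (K * K) * (M ^+ 2 * Y) + 4 * (K * (M ^+ 2 * Y)) + 2 * (M ^+ 2 * Y).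
  by ring.
apply: le_trans (ler_normD _ _) _; apply: (lerD _ h4).
apply: le_trans (ler_normD _ _) _; apply: (lerD _ h3).
by apply: le_trans (ler_normD _ _) _; exact: lerD.
Qed.

End PointwiseBounds.

Section Quotients.
Context {R : realType} {n : nat}.
Variables (f : 'rV[R]_n -> R) (N s : nat) (kap : R).
Hypothesis sf : smooth f.
Hypothesis fzero : forall a, (N < size a)%N -> iter_partial a f = fun=> 0.
Hypothesis kap1 : 1 <= kap.
Local Notation F := (iter_partial ^~ f).
Implicit Types (t : 'rV[R]_n) (i : 'I_n) (a : seq 'I_n).

(** The scale of the Laplacians to be gained. The power [s] matches the growth of [p], and the
    constant [kap] is later taken large enough to beat [Lam * p] and the error terms. *)
Definition mm t : R := kap ^+ 2 * wgt t ^+ s.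

Lemma mm_ge1 t : 1 <= mm t.
Proof. by rewrite /mm -[leLHS]mulr1 ler_pM ?exprn_ege1 ?wgt_ge1. Qed.

Let mm0 t : 0 < mm t. Proof. exact: lt_le_trans (mm_ge1 t). Qed.

Lemma smooth_mm : smooth mm.
Proof.
apply: smooth_mul; first exact: smooth_cst.
by apply: smooth_exp; exact: smooth_wgt.
Qed.

Lemma pd_mmX i e : pd i (fun t => mm t ^+ e) =
  fun t => (s * e)%:R * bet i t * mm t ^+ e.
Proof.
have D1 : pd i mm = fun t => s%:R * bet i t * mm t.
  rewrite pdZ; last by apply: smooth_exp; exact: smooth_wgt.
  rewrite pd_exp ?pd_wgt; last exact: smooth_wgt.
  apply/funext => t; rewrite /mm /bet; case: (s) => [|s'] /=; first by rewrite !mul0r mulr0.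
  by rewrite [wgt t ^+ s'.+1]exprS; field; exact: wgt_neq0.
rewrite pd_exp ?D1; last exact: smooth_mm.
apply/funext => t; case: e => [|e] /=; first by rewrite muln0 !mul0r.
by rewrite natrM exprS; ring.
Qed.

Definition Eq a t : R := mm t ^+ (N - size a) * (F a t * F a t).
Definition kq a : R := (s * (N - size a))%:R.
Definition Pq i a t : R := mm t ^+ (N - size a) * (F a t * F (i :: a) t).

Let sF a : smooth (F a). Proof. exact: smooth_iter_partial. Qed.
Let smX e : smooth (fun t => mm t ^+ e).
Proof. by apply: smooth_exp; exact: smooth_mm. Qed.

Lemma smooth_Eq a : smooth (Eq a).
Proof. by apply: smooth_mul => //; exact: smooth_mul. Qed.

Lemma pd_Eq i a : pd i (Eq a) = fun t => kq a * bet i t * Eq a t + 2 * Pq i a t.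
Proof.
rewrite pdM ?pd_mmX ?pdM//; last exact: smooth_mul.
by apply/funext => t; rewrite /Eq /Pq /kq -[F (i :: a)]/(pd i (F a)); ring.
Qed.

Lemma pd_Pq i a : pd i (Pq i a) = fun t => kq a * bet i t * Pq i a t +
  (mm t ^+ (N - size a) * (F (i :: a) t * F (i :: a) t)
   + mm t ^+ (N - size a) * (F a t * F (i :: i :: a) t)).
Proof.
rewrite pdM ?pd_mmX ?pdM//; last exact: smooth_mul.
apply/funext => t; rewrite /Pq /kq.
rewrite -[F (i :: i :: a)]/(pd i (F (i :: a))) -[F (i :: a)]/(pd i (F a)); ring.
Qed.

Lemma pd2_Eq i a t : pd i (pd i (Eq a)) t =
  kq a * pd i (bet i) t * Eq a t
  + kq a * bet i t * (kq a * bet i t * Eq a t + 2 * Pq i a t)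
  + 2 * (kq a * bet i t * Pq i a t +
     (mm t ^+ (N - size a) * (F (i :: a) t * F (i :: a) t)
   + mm t ^+ (N - size a) * (F a t * F (i :: i :: a) t))).
Proof.
have sP : smooth (Pq i a) by apply: smooth_mul => //; exact: smooth_mul.
have sk : smooth (fun t => kq a * bet i t).
  by apply: smooth_mul; [exact: smooth_cst|exact: smooth_bet].
have sE := smooth_Eq a.
rewrite pd_Eq pdD; [|exact: smooth_mul|by apply: smooth_mul => //; exact: smooth_cst].
rewrite pdZ// pd_Pq pdM// pdZ; last exact: smooth_bet.
by rewrite pd_Eq.
Qed.

Definition Dq t : R := 1 + \sum_(l < N.+1) \sum_(a <- seqs l) Eq a t.
Definition Mq t : R := Num.sqrt (mm t).
Definition Xq a t : R := Mq t ^+ (N - size a) * `|F a t|.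

Lemma Mq_sq t : Mq t ^+ 2 = mm t.
Proof. by rewrite sqr_sqrtr// ltW. Qed.

Lemma Mq_ge1 t : 1 <= Mq t.
Proof. by rewrite -sqrtr1 ler_wsqrtr// mm_ge1. Qed.

Let Mq0 t : 0 < Mq t. Proof. exact: lt_le_trans (Mq_ge1 t). Qed.

Lemma Xq_ge0 a t : 0 <= Xq a t.
Proof. by rewrite mulr_ge0// exprn_ge0// ltW. Qed.

Lemma Xq_sq a t : Xq a t ^+ 2 = Eq a t.
Proof.
by rewrite exprMn real_normK ?num_real// -exprM mulnC exprM Mq_sq /Eq expr2.
Qed.

Lemma Eq_ge0 a t : 0 <= Eq a t. Proof. by rewrite -Xq_sq sqr_ge0. Qed.

Definition Gq l t : R := \sum_(a <- seqs l) Eq a t.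

Lemma Gq_ge0 l t : 0 <= Gq l t.
Proof. by apply: sumr_ge0 => a _; exact: Eq_ge0. Qed.

Lemma Dq_ge1 t : 1 <= Dq t.
Proof. by rewrite lerDl sumr_ge0// => l _; exact: Gq_ge0. Qed.

Let Dq0 t : 0 < Dq t. Proof. exact: lt_le_trans (Dq_ge1 t). Qed.

Lemma Gq_le_Dq l t : (l <= N)%N -> Gq l t <= Dq t.
Proof.
rewrite -ltnS => lN; rewrite /Dq (bigD1 (Ordinal lN))//= -/(Gq l t) addrCA lerDl.
by rewrite addr_ge0// sumr_ge0// => k _; exact: Gq_ge0.
Qed.

Lemma Eq_le_Gq a t : Eq a t <= Gq (size a) t.
Proof.
rewrite /Gq (big_rem a) ?mem_seqs//= lerDl.
by apply: sumr_ge0 => b _; exact: Eq_ge0.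
Qed.

Definition dl t : R := Num.sqrt (Dq t).

Lemma dl_sq t : dl t ^+ 2 = Dq t. Proof. by rewrite sqr_sqrtr// ltW. Qed.
Lemma dl_gt0 t : 0 < dl t. Proof. by rewrite sqrtr_gt0. Qed.

Lemma Xq_zero a t : (N < size a)%N -> Xq a t = 0.
Proof. by move=> h; rewrite /Xq fzero// normr0 mulr0. Qed.

Lemma Xq_le_dl a t : Xq a t <= dl t.
Proof.
have [h|h] := leqP (size a) N; last by rewrite Xq_zero// ltW// dl_gt0.
rewrite -(@ler_pXn2r _ 2)// ?nnegrE ?Xq_ge0 ?(ltW (dl_gt0 t))//.
by rewrite Xq_sq dl_sq; apply: le_trans (Eq_le_Gq a t) (Gq_le_Dq t h).
Qed.

Lemma Xdl_ge0 a t : 0 <= Xq a t * dl t.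
Proof. by apply: mulr_ge0; [exact: Xq_ge0|exact/ltW/dl_gt0]. Qed.

Lemma mm_next a t : (size a < N)%N ->
  mm t ^+ (N - size a) = Mq t ^+ (N - size a) * (Mq t * Mq t ^+ (N - (size a).+1)).
Proof.
by move=> h; rewrite -exprS subnSK// -Mq_sq -exprM -exprD addnn mul2n.
Qed.

Lemma Pq_norm i a t : `|Pq i a t| <= Mq t * (Xq a t * dl t).
Proof.
(* If [size a >= N], the next derivative vanishes identically, so the truncated exponents never
   matter. *)
have [h|h] := ltnP (size a) N; last first.
  rewrite /Pq [F (i :: a)]fzero ?ltnS// !mulr0 normr0.
  by apply: mulr_ge0; [exact: ltW|exact: Xdl_ge0].
have -> : `|Pq i a t| = Mq t * (Xq a t * Xq (i :: a) t).
  rewrite /Pq mm_next// /Xq /= !normrM !(@ger0_norm _ (_ ^+ _)) ?exprn_ge0 ?(ltW (Mq0 t))//.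
  rewrite (ger0_norm (ltW (Mq0 t))); ring.
rewrite ler_wpM2l ?(ltW (Mq0 t))// ler_wpM2l ?Xq_ge0//; exact: Xq_le_dl.
Qed.

Lemma Qq_norm i a t :
  `|mm t ^+ (N - size a) * (F a t * F (i :: i :: a) t)| <= Mq t ^+ 2 * (Xq a t * dl t).
Proof.
have [h|h] := ltnP (size a).+1 N; last first.
  rewrite [F (i :: i :: a)]fzero ?ltnS// !mulr0 normr0.
  by apply: mulr_ge0; [rewrite exprn_ge0// ltW|exact: Xdl_ge0].
have -> : `|mm t ^+ (N - size a) * (F a t * F (i :: i :: a) t)| =
    Mq t ^+ 2 * (Xq a t * Xq (i :: i :: a) t).
  rewrite mm_next ?(ltnW h)// -(subnSK h) exprS.
  rewrite /Xq /= !normrM !(@ger0_norm _ (_ ^+ _)) ?exprn_ge0 ?(ltW (Mq0 t))//.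
  rewrite (ger0_norm (ltW (Mq0 t))); ring.
rewrite ler_wpM2l ?exprn_ge0 ?(ltW (Mq0 t))// ler_wpM2l ?Xq_ge0//; exact: Xq_le_dl.
Qed.

(** The source of the gain: since the weight drops by one power per derivative, the squared next
    derivative is [Eq (i :: a)] with one factor [mm] to spare. *)
Lemma Sq_eq i a t :
  mm t ^+ (N - size a) * (F (i :: a) t * F (i :: a) t) = mm t * Xq (i :: a) t ^+ 2.
Proof.
have [h|h] := ltnP (size a) N; last first.
  by rewrite Xq_zero ?ltnS// [F (i :: a)]fzero ?ltnS// !mulr0 expr0n mulr0.
by rewrite Xq_sq /Eq /= -(subnSK h) exprS -mulrA.
Qed.

Definition Kq : R := (s * N)%:R.
Definition C1q : R := Kq ^+ 2 + 6 * Kq + 2.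

Let C1q0 : 0 <= C1q. Proof. by rewrite /C1q !addr_ge0// ?exprn_ge0// mulr_ge0. Qed.

Let kqK a : kq a <= Kq. Proof. by rewrite ler_nat leq_mul2l leq_subr orbT. Qed.

Let EqY a t : Eq a t <= Xq a t * dl t.
Proof. by rewrite -Xq_sq expr2 ler_wpM2l ?Xq_ge0// Xq_le_dl. Qed.

Lemma pd_Eq_norm i a t : `|pd i (Eq a) t| <= (Kq + 2) * (Mq t * (Xq a t * dl t)).
Proof.
rewrite pd_Eq; apply: first_derivative_bound => //.
- exact: bet_le1.
- exact: Mq_ge1.
- exact: Eq_ge0.
- exact: Pq_norm.
Qed.

(** Apart from the gain, every term carries a factor [Xq a]. The error is therefore small where the
    order-[l] part is small, not merely bounded, as the absorption argument requires. *)
Lemma pd2_Eq_norm i a t :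
  `|pd i (pd i (Eq a)) t - 2 * (mm t * Xq (i :: a) t ^+ 2)|
   <= C1q * (mm t * (Xq a t * dl t)).
Proof.
rewrite pd2_Eq Sq_eq -[X in _ <= C1q * (X * _)]Mq_sq; apply: second_derivative_bound => //.
- exact: bet_le1.
- exact: pd_bet_le2.
- exact: Mq_ge1.
- exact: Eq_ge0.
- exact: Pq_norm.
- exact: Qq_norm.
Qed.

Definition K0q : R := \sum_(l < N.+1) (size (@seqs n l))%:R.

Let K0q0 : 0 <= K0q. Proof. exact: sumr_ge0. Qed.

Lemma size_seqs_le l : (l <= N)%N -> (size (@seqs n l))%:R <= K0q.
Proof.
by rewrite -ltnS => lN; rewrite /K0q (bigD1 (Ordinal lN))//= lerDl sumr_ge0.
Qed.

Lemma smooth_Gq l : smooth (Gq l).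
Proof. by apply: smooth_sum => a; exact: smooth_Eq. Qed.

Lemma smooth_Dq : smooth Dq.
Proof.
apply: smooth_add; first exact: smooth_cst.
by apply: smooth_sum => l; exact: smooth_Gq.
Qed.

Lemma pd_Gq i l : pd i (Gq l) = fun t => \sum_(a <- seqs l) pd i (Eq a) t.
Proof. by rewrite /Gq pd_sum//; exact: smooth_Eq. Qed.

Lemma pd2_Gq i l : pd i (pd i (Gq l)) = fun t => \sum_(a <- seqs l) pd i (pd i (Eq a)) t.
Proof. by rewrite pd_Gq pd_sum// => a; apply: smooth_pd; exact: smooth_Eq. Qed.

Lemma pd_Dq i : pd i Dq = fun t => \sum_(l < N.+1) pd i (Gq l) t.
Proof.
rewrite /Dq pdD; [|exact: smooth_cst|by apply: smooth_sum => l; exact: smooth_Gq].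
rewrite pd_cst pd_sum; last by move=> l; exact: smooth_Gq.
by apply/funext => t; rewrite add0r.
Qed.

Lemma pd2_Dq i : pd i (pd i Dq) = fun t => \sum_(l < N.+1) pd i (pd i (Gq l)) t.
Proof. by rewrite pd_Dq pd_sum// => l; apply: smooth_pd; exact: smooth_Gq. Qed.

Definition gq l t : R := Gq l t * (Dq t)^-1.
Definition xq l t : R := Num.sqrt (gq l t).

Lemma gq_ge0 l t : 0 <= gq l t.
Proof. by rewrite mulr_ge0 ?Gq_ge0// invr_ge0 ltW. Qed.

Lemma xq_sq l t : xq l t ^+ 2 = gq l t.
Proof. by rewrite sqr_sqrtr// gq_ge0. Qed.

Lemma xq_ge0 l t : 0 <= xq l t. Proof. exact: sqrtr_ge0. Qed.

Lemma gq_le1 l t : (l <= N)%N -> gq l t <= 1.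
Proof. by move=> lN; rewrite /gq ler_pdivrMr// mul1r Gq_le_Dq. Qed.

Lemma xq_le1 l t : (l <= N)%N -> xq l t <= 1.
Proof. by move=> lN; rewrite -sqrtr1 ler_wsqrtr// gq_le1. Qed.

Lemma Gq_gq l t : Gq l t = gq l t * Dq t.
Proof. by rewrite /gq mulfVK// gt_eqF. Qed.

Lemma Xq_le_xq a t : Xq a t * dl t <= xq (size a) t * Dq t.
Proof.
rewrite -dl_sq expr2 mulrA ler_wpM2r ?(ltW (dl_gt0 t))//.
have y0 : 0 <= xq (size a) t * dl t.
  by apply: mulr_ge0; [exact: xq_ge0|exact/ltW/dl_gt0].
rewrite -(@ler_pXn2r _ 2)// ?nnegrE ?Xq_ge0//.
by rewrite Xq_sq exprMn xq_sq dl_sq -Gq_gq Eq_le_Gq.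
Qed.

Lemma pd_Gq_norm i l t : (l <= N)%N ->
  `|pd i (Gq l) t| <= (size (@seqs n l))%:R * ((Kq + 2) * (Mq t * (xq l t * Dq t))).
Proof.
move=> lN; rewrite pd_Gq; apply: norm_sum_size => a /size_seqs al.
apply: le_trans (pd_Eq_norm i a t) _; rewrite ler_wpM2l ?addr_ge0//.
by rewrite ler_wpM2l ?(ltW (Mq0 t))// -al Xq_le_xq.
Qed.

Lemma pd2_Gq_norm i l t : (l <= N)%N ->
  `|pd i (pd i (Gq l)) t - 2 * (mm t * \sum_(a <- seqs l) Xq (i :: a) t ^+ 2)|
   <= (size (@seqs n l))%:R * (C1q * (mm t * (xq l t * Dq t))).
Proof.
move=> lN; rewrite pd2_Gq !mulr_sumr -sumrB.
apply: norm_sum_size => a /size_seqs al.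
apply: le_trans (pd2_Eq_norm i a t) _; rewrite ler_wpM2l//.
by rewrite ler_wpM2l ?(ltW (mm0 t))// -al Xq_le_xq.
Qed.

Lemma pd_Dq_norm i t : `|pd i Dq t| <= K0q * ((Kq + 2) * (Mq t * Dq t)).
Proof.
rewrite pd_Dq /K0q mulr_suml; apply: le_trans (ler_norm_sum _ _ _) _.
apply: ler_sum => l _; have lN : (l <= N)%N by rewrite -ltnS.
apply: le_trans (pd_Gq_norm i t lN) _; rewrite ler_wpM2l// ler_wpM2l ?addr_ge0//.
by rewrite ler_wpM2l ?(ltW (Mq0 t))// ler_piMl ?xq_le1// ltW.
Qed.

Lemma pd2_Dq_norm i t : `|pd i (pd i Dq) t| <= K0q * ((C1q + 2) * (mm t * Dq t)).
Proof.
rewrite pd2_Dq /K0q mulr_suml; apply: le_trans (ler_norm_sum _ _ _) _.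
apply: ler_sum => l _; have lN : (l <= N)%N by rewrite -ltnS.
have h1 := pd2_Gq_norm i t lN.
have h2 : `|2 * (mm t * \sum_(a <- seqs l) Xq (i :: a) t ^+ 2)| <=
    (size (@seqs n l))%:R * (2 * (mm t * Dq t)).
  rewrite !mulr_sumr; apply: norm_sum_size => a _.
  rewrite normrM ger0_norm// ler_wpM2l// normrM (ger0_norm (ltW (mm0 t))).
  rewrite ler_wpM2l ?(ltW (mm0 t))// ger0_norm ?sqr_ge0// -dl_sq.
  by apply: lerXn2r; rewrite ?nnegrE ?Xq_ge0 ?(ltW (dl_gt0 t))// Xq_le_dl.
have h3 : (size (@seqs n l))%:R * (C1q * (mm t * (xq l t * Dq t))) <=
   (size (@seqs n l))%:R * (C1q * (mm t * Dq t)).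
  rewrite ler_wpM2l// ler_wpM2l// ler_wpM2l ?(ltW (mm0 t))//.
  by rewrite ler_piMl ?xq_le1// ltW.
have := ler_normD (pd i (pd i (Gq l)) t - 2 * (mm t * \sum_(a <- seqs l) Xq (i :: a) t ^+ 2))
   (2 * (mm t * \sum_(a <- seqs l) Xq (i :: a) t ^+ 2)).
rewrite subrK => h4; apply: le_trans h4 _; apply: le_trans (lerD h1 h2) _.
by apply: le_trans (lerD h3 (lexx _)) _; rewrite -mulrDr -mulrDl.
Qed.

Lemma smooth_gq l : smooth (gq l).
Proof.
apply: smooth_mul; first exact: smooth_Gq.
by apply: smooth_inv => [|t]; [exact: smooth_Dq|rewrite gt_eqF].
Qed.

Definition K1q : R := 2 * (K0q * (Kq + 2)).
Definition Cq : R := K0q * C1q + K1q ^+ 2 + K0q * (C1q + 2).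

Lemma K1q_ge0 : 0 <= K1q. Proof. by rewrite !mulr_ge0// addr_ge0. Qed.
Lemma Cq_ge0 : 0 <= Cq.
Proof. by rewrite /Cq !addr_ge0// ?mulr_ge0// ?sqr_ge0// addr_ge0. Qed.

(** Derivatives of the quotient are read off from the product [G = g D], which avoids the quotient
    rule. *)
Let pdGgq i l : pd i (Gq l) = fun t => pd i (gq l) t * Dq t + gq l t * pd i Dq t.
Proof.
have E : Gq l = fun t => gq l t * Dq t by apply/funext => t; exact: Gq_gq.
by rewrite {1}E pdM//; [exact: smooth_gq|exact: smooth_Dq].
Qed.

Let xD0 l t : 0 <= xq l t * Dq t.
Proof. by apply: mulr_ge0; [exact: xq_ge0|exact: ltW]. Qed.
Let Kq2 : 0 <= Kq + 2. Proof. by rewrite addr_ge0. Qed.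

Lemma pd_gq_norm i l t : (l <= N)%N -> `|pd i (gq l) t| <= K1q * (Mq t * xq l t).
Proof.
move=> lN; rewrite -(ler_pM2r (Dq0 t)) -{1}(ger0_norm (ltW (Dq0 t))) -normrM.
have -> : pd i (gq l) t * Dq t = pd i (Gq l) t - gq l t * pd i Dq t.
  by rewrite pdGgq addrK.
apply: le_trans (ler_normB _ _) _.
have h1 : `|pd i (Gq l) t| <= K0q * ((Kq + 2) * (Mq t * (xq l t * Dq t))).
  apply: le_trans (pd_Gq_norm i t lN) _; apply: ler_wpM2r; last exact: size_seqs_le.
  by apply: mulr_ge0 => //; apply: mulr_ge0; [exact: ltW|exact: xD0].
have h2 : `|gq l t * pd i Dq t| <= xq l t * (K0q * ((Kq + 2) * (Mq t * Dq t))).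
  rewrite normrM; apply: ler_pM => //; last exact: pd_Dq_norm.
  rewrite (ger0_norm (gq_ge0 _ _)) -xq_sq expr2 ler_piMl ?xq_ge0//.
  exact: xq_le1.
apply: le_trans (lerD h1 h2) _; rewrite /K1q.
by rewrite le_eqVlt; apply/orP; left; apply/eqP; ring.
Qed.

Lemma pd2_gq_ge i l t : (l <= N)%N ->
  2 * (mm t * \sum_(a <- seqs l) Xq (i :: a) t ^+ 2) - Cq * (mm t * xq l t) * Dq t
   <= pd i (pd i (gq l)) t * Dq t.
Proof.
have lin1 (a b c : R) : a = a + b + (b + c) - 2 * b - c by ring.
have lin2 (a b c x y z w : R) :
    - a <= x - y -> z <= b -> w <= c -> y - (a + b + c) <= x - z - w by lra.
move=> lN.
(* [G = g D] differentiated twice and solved for the term with the second derivative of [g]. *)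
have -> : pd i (pd i (gq l)) t * Dq t = pd i (pd i (Gq l)) t
    - 2 * (pd i (gq l) t * pd i Dq t) - gq l t * pd i (pd i Dq) t.
  have sg := smooth_gq l; have sD := smooth_Dq.
  rewrite [pd i (Gq l)]pdGgq pdD; last 2 first.
  - by apply: smooth_mul => //; exact: smooth_pd.
  - by apply: smooth_mul => //; exact: smooth_pd.
  have e1 := pdM i (smooth_pd i sg) sD; have e2 := pdM i sg (smooth_pd i sD).
  by rewrite e1 e2; exact: lin1.
have h1 : `|pd i (pd i (Gq l)) t - 2 * (mm t * \sum_(a <- seqs l) Xq (i :: a) t ^+ 2)|
    <= K0q * (C1q * (mm t * (xq l t * Dq t))).
  apply: le_trans (pd2_Gq_norm i t lN) _; apply: ler_wpM2r; last exact: size_seqs_le.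
  by apply: mulr_ge0 => //; apply: mulr_ge0; [exact: ltW|exact: xD0].
have h2 : `|2 * (pd i (gq l) t * pd i Dq t)| <= K1q ^+ 2 * (mm t * xq l t) * Dq t.
  have -> : K1q ^+ 2 * (mm t * xq l t) * Dq t =
      2 * ((K1q * (Mq t * xq l t)) * (K0q * ((Kq + 2) * (Mq t * Dq t)))).
    by rewrite -Mq_sq /K1q; ring.
  rewrite !normrM (@ger0_norm _ 2)// ler_wpM2l//.
  by apply: ler_pM => //; [exact: pd_gq_norm|exact: pd_Dq_norm].
have h3 : `|gq l t * pd i (pd i Dq) t| <= xq l t * (K0q * ((C1q + 2) * (mm t * Dq t))).
  rewrite normrM; apply: ler_pM => //; last exact: pd2_Dq_norm.
  rewrite (ger0_norm (gq_ge0 _ _)) -xq_sq expr2 ler_piMl ?xq_ge0//.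
  exact: xq_le1.
move: h1 h2 h3; rewrite !ler_norml /Cq => /andP[h1 _] /andP[_ h2] /andP[_ h3].
have -> : (K0q * C1q + K1q ^+ 2 + K0q * (C1q + 2)) * (mm t * xq l t) * Dq t =
  K0q * (C1q * (mm t * (xq l t * Dq t))) + K1q ^+ 2 * (mm t * xq l t) * Dq t +
  xq l t * (K0q * ((C1q + 2) * (mm t * Dq t))) by ring.
exact: lin2 h1 h2 h3.
Qed.

(** Summing over directions turns the squares of the derivatives of order [l + 1] into [G_(l+1)];
    the result is the bracket of [scalar_absorption] times [mm], with a constant independent of
    [kap]. *)
Lemma laplacian_gq_ge l t : (l < N)%N ->
  mm t * (2 * xq l.+1 t ^+ 2 - n%:R * Cq * xq l t) <= laplacian (gq l) t.
Proof.
move=> lN; rewrite laplacianE -(ler_pM2r (Dq0 t)) mulr_suml.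
apply: le_trans (ler_sum _ (fun i _ => pd2_gq_ge i t (ltnW lN))).
rewrite sumrB -!mulr_sumr.
have -> : \sum_i \sum_(a <- seqs l) Xq (i :: a) t ^+ 2 = xq l.+1 t ^+ 2 * Dq t.
  rewrite xq_sq -Gq_gq /Gq sum_seqsS; apply: eq_bigr => i _.
  by apply: eq_bigr => a _; rewrite Xq_sq.
rewrite sumr_const card_ord -[_ *+ n]mulr_natr.
by rewrite le_eqVlt; apply/orP; left; apply/eqP; ring.
Qed.

Lemma sum_xq_ge t : 2 <= Dq t -> 1 / 2 <= \sum_(l < N.+1) xq l t ^+ 2.
Proof.
move=> D2; rewrite (eq_bigr (fun l : 'I_N.+1 => Gq l t / Dq t)) => [|l _]; last by rewrite xq_sq.
rewrite -mulr_suml.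
have -> : \sum_(l < N.+1) Gq l t = Dq t - 1 by rewrite /Dq addrC addKr.
by rewrite ler_pdivlMr//; lra.
Qed.

(** Recovers [f] from the zeroth ratio: [f = x_0 dl / M^N]. So [f] is large where [x_0] is not
    small, provided [D] is large. *)
Lemma f_xq t : 0 <= f t -> f t * mm t ^+ N = xq 0 t * (Mq t ^+ N * dl t).
Proof.
move=> f0; have hx : xq 0 t * dl t = Mq t ^+ N * f t.
  apply/eqP; rewrite -(@eqrXn2 _ 2)// ?mulr_ge0 ?xq_ge0 ?exprn_ge0 ?(ltW (dl_gt0 t)) ?(ltW (Mq0 t))//.
  have -> : (Mq t ^+ N * f t) ^+ 2 = mm t ^+ N * (f t * f t).
    by rewrite -Mq_sq -exprM mul2n -addnn exprD; ring.
  by rewrite exprMn xq_sq dl_sq -Gq_gq /Gq /= big_seq1 /Eq /= subn0.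
by rewrite mulrCA hx -Mq_sq -exprM mul2n -addnn exprD; ring.
Qed.

End Quotients.

(** * Construction of the supersolution *)

Section Supersolution.
Context {R : realType} {n : nat}.
Variables (f : 'rV[R]_n -> R) (N s j : nat).
Hypothesis n0 : (0 < n)%N.
Hypothesis sf : smooth f.
Hypothesis fhom : forall c t, f (c *: t) = c ^+ N * f t.
Hypothesis f0 : forall t, 0 <= f t.
Local Notation F := (iter_partial ^~ f).
Hypothesis fnv : forall om, unit_sphere n om ->
  exists2 a, (size a <= j)%N & F a om != 0.
Hypothesis jN : (j + s * (j + 2) < N)%N.

Let fzero a : (N < size a)%N -> F a = fun=> 0.
Proof. exact: iter_partial_gt. Qed.

(** Compactness bounds the total over all orders from below; by pigeonhole some order carries the
    share [1 / (j + 1)] of it. *)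
Lemma sphere_derivative_lower : exists2 c : R, 0 < c & forall om, unit_sphere n om ->
  exists2 l, (l <= j)%N & c <= \sum_(a <- seqs l) F a om ^+ 2.
Proof.
pose Lo om := \sum_(l < j.+1) \sum_(a <- seqs l) F a om ^+ 2.
have sLo : smooth Lo.
  apply: smooth_sum => l; apply: smooth_sum => a; apply: smooth_exp.
  exact: smooth_iter_partial.
have [|c c0 hc] := sphere_lower n0 sLo.
  move=> om /fnv[a aj aom]; have aj' : (size a < j.+1)%N by [].
  rewrite /Lo (bigD1 (Ordinal aj'))//= (big_rem a) ?mem_seqs//= -addrA.
  rewrite ltr_pwDl ?exprn_even_gt0//.
  rewrite addr_ge0//; apply: sumr_ge0 => b _; rewrite ?sqr_ge0//.
  by apply: sumr_ge0 => ? _; rewrite sqr_ge0.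
exists (c / j.+1%:R); first by rewrite divr_gt0.
move=> om omS; apply: contrapT => H.
have : Lo om < c.
  apply: (@lt_le_trans _ _ (\sum_(l < j.+1) c / j.+1%:R)); last first.
    rewrite sumr_const card_ord -[_ *+ _]mulr_natr mulfVK//.
  rewrite /Lo; apply: ltr_sum => [|l _].
    by apply/hasP; exists ord0; rewrite ?mem_index_enum.
  rewrite ltNge; apply/negP => h; apply: H; exists l => //.
  by rewrite -ltnS.
by rewrite ltNge hc.
Qed.

(** With [rho = |t|^2], the part of order [l] is [mm^(N-l) rho^(N-l)] times a quantity bounded
    below. It must beat [mm^(N-l) mm^(l+2)], and [mm^(l+2)] is [O(rho^(s (l+2)))]. The strict
    inequality [jN] leaves one spare power of [rho] to absorb all constants. *)
Lemma Dq_growth (kap B0 : R) : 1 <= kap -> 0 <= B0 -> exists R0 : R,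
  forall t, R0 <= dotv t t -> B0 * mm s kap t ^+ (N + 2) <= Dq f N s kap t.
Proof.
move=> kap1 B00; have [c c0 hc] := sphere_derivative_lower.
(* The factor [2 ^+ s] comes from [wgt t <= 2 rho], valid once [rho >= 1]. *)
pose Q : R := kap ^+ 2 * 2 ^+ s.
have kap21 : 1 <= kap ^+ 2 by rewrite exprn_ege1.
have Q1 : 1 <= Q by rewrite /Q -[leLHS]mulr1 ler_pM ?exprn_ege1// ler1n.
have Q0 : 0 < Q by apply: lt_le_trans Q1.
exists (1 + B0 * Q ^+ (j + 2) / c) => t tR.
have BQ : 0 <= B0 * Q ^+ (j + 2) / c by rewrite divr_ge0 ?(ltW c0)// mulr_ge0// exprn_ge0// ltW.
set rho := dotv t t in tR *.
have rho1 : 1 <= rho by move: tR BQ; lra.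
have rhoB : B0 * Q ^+ (j + 2) <= c * rho.
  rewrite [leRHS]mulrC -ler_pdivrMr//; move: tR; lra.
have rho0 : 0 < rho by apply: lt_le_trans rho1.
have [om [omS [tE r0]]] := polar rho0.
have [l lj hl] := hc om omS.
have lN : (l <= N)%N by move: lj jN; clear; lia.
have m1 := mm_ge1 s kap1 t; have m0 : 0 < mm s kap t by apply: lt_le_trans m1.
have mQ : mm s kap t <= Q * rho ^+ s.
  rewrite /mm /Q -mulrA ler_wpM2l ?exprn_ge0//; first by apply: le_trans kap1.
  rewrite -exprMn; apply: lerXn2r; rewrite ?nnegrE ?mulr_ge0 ?(ltW rho0)//.
    exact/ltW/wgt_gt0.
  by rewrite /wgt -/rho; move: rho1; lra.
have GE : Gq f N s kap l t = mm s kap t ^+ (N - l) * rho ^+ (N - l) *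
    \sum_(a <- seqs l) F a om ^+ 2.
  rewrite /Gq mulr_sumr big_seq [RHS]big_seq; apply: eq_bigr => a /size_seqs al.
  rewrite /Eq al {2 3}tE !(iter_partial_hom sf fhom) ?al// ?gt_eqF//.
  have -> : rho ^+ (N - l) = enorm t ^+ (N - l) * enorm t ^+ (N - l).
    by rewrite -exprD addnn -mul2n exprM sqr_sqrtr ?dotv_ge0.
  by ring.
apply: le_trans (Gq_le_Dq f s kap1 t lN); rewrite GE.
have -> : (N + 2 = (N - l) + (l + 2))%N by move: lN; clear; lia.
rewrite exprD mulrCA -mulrA ler_wpM2l ?exprn_ge0 ?(ltW m0)//.
have h1 : mm s kap t ^+ (l + 2) <= Q ^+ (j + 2) * rho ^+ (N - l - 1).
  apply: (@le_trans _ _ ((Q * rho ^+ s) ^+ (l + 2))).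
    apply: lerXn2r => //; rewrite nnegrE; first exact: ltW.
    by apply: mulr_ge0; [exact: ltW|rewrite exprn_ge0// ltW].
  rewrite exprMn -exprM; apply: ler_pM; rewrite ?exprn_ge0 ?(ltW Q0) ?(ltW rho0)//.
    by rewrite ler_weXn2l// leq_add2r.
  rewrite ler_weXn2l//.
  have : (s * (l + 2) <= s * (j + 2))%N by rewrite leq_mul2l leq_add2r lj orbT.
  by move: jN lj; clear; lia.
apply: (@le_trans _ _ (rho ^+ (N - l) * c)); last first.
  by rewrite ler_wpM2l ?exprn_ge0 ?(ltW rho0).
have -> : (N - l = (N - l - 1).+1)%N.
  by move: jN lj; clear; lia.
rewrite exprSr -mulrA [rho * c]mulrC subn1 /=.
apply: le_trans (ler_wpM2l B00 h1) _; rewrite mulrA mulrC subn1.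
by rewrite ler_wpM2l ?exprn_ge0 ?(ltW rho0).
Qed.

Variables (p : 'rV[R]_n -> R) (Cp Lam : R).
Hypotheses (Cp0 : 0 <= Cp) (Lam0 : 0 <= Lam).
Hypothesis pCp : forall t, p t <= Cp * wgt t ^+ s.

Theorem supersolution : exists (Z : 'rV[R]_n -> R) (R0 : R),
  [/\ smooth Z, forall t, 0 < Z t, forall t, Z t <= 2 * (wgt t)^-1 &
      forall t, R0 <= dotv t t ->
        (wgt t)^-1 <= - laplacian Z t + f t * Z t - Lam * p t * Z t].
Proof.
have lin (a b x y z u : R) :
    x <= - a + b -> y <= z -> u + z + 1 <= x -> 1 <= - a - u + b - y by lra.
pose C := n%:R * @Cq R n N s; have C0 : 0 <= C by rewrite mulr_ge0// Cq_ge0.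
pose K1 := @K1q R n N s; have K10 : 0 <= K1 by exact: K1q_ge0.
have half0 : 0 < 1 / 2 :> R by lra.
have [ep [A [c0 [ep0 A0 c00 hS]]]] := scalar_absorption N C0 half0 (@ltr01 R).
(* Normalisation: dividing by [Se] makes the weights sum to at most 1, which keeps [Phi] between 1
   and 2. *)
pose Se := 1 + \sum_(l < N) ep l.
have Se1 : 1 <= Se by rewrite lerDl sumr_ge0// => l _; exact: ltW.
have Se0 : 0 < Se by apply: lt_le_trans Se1.
pose e l := ep l / Se; pose A' := A / Se; pose c1 := c0 / Se.
have e0 l : 0 <= e l by rewrite divr_ge0// ltW.
have esum : \sum_(l < N) e l <= 1.
  by rewrite -mulr_suml ler_pdivrMr// mul1r /Se lerDr.
have A'0 : 0 <= A' by rewrite divr_ge0// ltW.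
have c10 : 0 < c1 by rewrite divr_gt0.
have hS' (x : nat -> R) : (forall l, 0 <= x l <= 1) ->
    1 / 2 <= \sum_(l < N.+1) x l ^+ 2 ->
    c1 <= A' * x 0%N + \sum_(l < N) e l * (2 * x l.+1 ^+ 2 - C * x l).
  move=> x01 hx; have [_ /(_ hx) h] := hS x x01.
  have -> : A' * x 0%N + \sum_(l < N) e l * (2 * x l.+1 ^+ 2 - C * x l) =
     (A * x 0%N + \sum_(l < N) ep l * (2 * x l.+1 ^+ 2 - C * x l)) / Se.
    rewrite mulrDl mulr_suml mulrAC; congr (_ + _).
    by apply: eq_bigr => l _; rewrite mulrAC.
  by rewrite ler_pM2r// invr_gt0.
(* [T] collects what must be beaten: [2 * K1] per direction from the cross terms with the gradient
   of [1 / wgt], 4 from its second derivatives, [2 * Lam * Cp] from [p], and 1 for the right-hand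
   side. *)
pose T := n%:R * (2 * K1 + 4) + 2 * Lam * Cp + 1.
have T1 : 1 <= T by rewrite lerDr addr_ge0// ?mulr_ge0// addr_ge0// mulr_ge0.
have T0 : 0 < T by apply: lt_le_trans T1.
(* Not circular: [C] and [K1], hence also [ep], [A] and [c1], are independent of [kap]. *)
pose kap := 1 + T / c1.
have kap1 : 1 <= kap by rewrite lerDl divr_ge0// ltW.
have kap0 : 0 < kap by apply: lt_le_trans kap1.
have kapT : T <= c1 * kap by rewrite /kap mulrDr mulr1 mulrCA mulfV ?gt_eqF// mulr1 lerDr ltW.
(* The summand 2 gives [Dq >= 2], needed for the ratios to carry mass [1 / 2]; the summand [A' ^ 2]
   gives [dl >= A' M^(N+2)]. *)
have [R0 hR0] := Dq_growth kap1 (addr_ge0 (sqr_ge0 A') (ler0n R 2)).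
pose g l := gq f N s kap l; have sg l : smooth (g l) by exact: smooth_gq.
pose Phi t := 2 - \sum_(l < N) e l * g l t.
have seg l : smooth (fun t => e l * g l t) by apply: smooth_mul => //; exact: smooth_cst.
have sS : smooth (fun t => \sum_(l < N) e l * g l t) by apply: smooth_sum => l; exact: seg.
have sPhi : smooth Phi.
  by apply: smooth_add; [exact: smooth_cst|exact: smooth_opp].
have Phi_pd i : pd i Phi = fun t => - \sum_(l < N) e l * pd i (g l) t.
  rewrite /Phi pdD; [|exact: smooth_cst|exact: smooth_opp].
  rewrite pd_cst pdN// pd_sum; last by move=> l; exact: seg.
  apply/funext => t; rewrite add0r; congr (- _); apply: eq_bigr => l _.
  by rewrite pdZ.
have Phi_lap t : laplacian Phi t = - \sum_(l < N) e l * laplacian (g l) t.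
  rewrite laplacianE; under eq_bigr => i _.
    rewrite Phi_pd pdN; last first.
      apply: smooth_sum => l; apply: smooth_mul; first exact: smooth_cst.
      exact: smooth_pd.
    rewrite pd_sum; last first.
      move=> l; apply: smooth_mul; first exact: smooth_cst.
      exact: smooth_pd.
    over.
  rewrite sumrN exchange_big; congr (- _); apply: eq_bigr => l _ /=.
  rewrite laplacianE mulr_sumr; apply: eq_bigr => i _.
  by rewrite pdZ//; exact: smooth_pd.
have ge0 l t : 0 <= g l t by exact: gq_ge0.
have gle1 l t : (l <= N)%N -> g l t <= 1 by move=> h; exact: gq_le1.
have Phi1 t : 1 <= Phi t.
  have : \sum_(l < N) e l * g l t <= 1.
    apply: le_trans esum; apply: ler_sum => l _; rewrite ler_piMr// gle1//.
    exact: ltnW.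
  by rewrite /Phi; lra.
have Phi2 t : Phi t <= 2.
  have : 0 <= \sum_(l < N) e l * g l t by apply: sumr_ge0 => l _; rewrite mulr_ge0.
  by rewrite /Phi; lra.
have Phi_pd_le i t : `|pd i Phi t| <= K1 * Mq s kap t.
  rewrite Phi_pd normrN; apply: le_trans (ler_norm_sum _ _ _) _.
  have Mg : 0 <= K1 * Mq s kap t by rewrite mulr_ge0// (le_trans ler01)// Mq_ge1.
  apply: (@le_trans _ _ (\sum_(l < N) e l * (K1 * Mq s kap t))).
    apply: ler_sum => l _; rewrite normrM ger0_norm// ler_wpM2l//.
    have lN : (l <= N)%N by exact: ltnW.
    apply: le_trans (pd_gq_norm s sf fzero kap1 i t lN) _.
    rewrite mulrA ler_piMr//; exact: xq_le1.
  by rewrite -mulr_suml ler_piMl.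
pose h (t : 'rV[R]_n) : R := (wgt t)^-1.
have sh : smooth h by exact: smooth_wgtV.
pose Z t := Phi t * h t.
have sb i : smooth (fun t => - bet i t * h t).
  by apply: smooth_mul => //; apply: smooth_opp; exact: smooth_bet.
have pdh i : pd i h = fun t => - bet i t * h t by exact: pd_wgtV.
(* All derivatives of [h = 1 / wgt] are multiples of [h], so [h] factors out and the final
   inequality can be proved before multiplying by it. *)
have Z_pd2 i t : pd i (pd i Z) t = h t * (pd i (pd i Phi) t - 2 * (bet i t * pd i Phi t)
    + Phi t * (2 * bet i t ^+ 2 - 2 * h t)).
  rewrite pdM// pdh.
  rewrite pdD; [|by apply: smooth_mul => //; exact: smooth_pd|exact: smooth_mul].
  rewrite pdM//; last exact: smooth_pd.
  rewrite pdM// pdM//; last by apply: smooth_opp; exact: smooth_bet.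
  rewrite pdN ?pd_bet; last exact: smooth_bet.
  by rewrite !pdh /h; ring.
exists Z, R0; split.
- exact: smooth_mul.
- by move=> t; rewrite mulr_gt0 ?wgtV_gt0//; apply: lt_le_trans (Phi1 t).
- by move=> t; rewrite ler_wpM2r// ltW// wgtV_gt0.
move=> t tR; have hD := hR0 t tR.
set M := Mq s kap t; set mu := mm s kap t.
have mu1 : 1 <= mu := mm_ge1 s kap1 t; have mu0 : 0 < mu by apply: lt_le_trans mu1.
have M1 : 1 <= M := Mq_ge1 s kap1 t; have M0 : 0 < M by apply: lt_le_trans M1.
have h0 : 0 < h t := wgtV_gt0 t; have h1 : h t <= 1 := wgtV_le1 t.
have w1 : 1 <= wgt t ^+ s by rewrite exprn_ege1// wgt_ge1.
(* The bound by 1 is available only for [l <= N], while [scalar_absorption] takes a total sequence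
   with values in [[0, 1]]. *)
pose x l := if (l <= N)%N then xq f N s kap l t else 0.
have x01 l : 0 <= x l <= 1.
  by rewrite /x; case: ifP => h'; rewrite ?lexx ?ler01 ?andbT// xq_ge0 xq_le1.
have D2 : 2 <= Dq f N s kap t.
  apply: le_trans hD; rewrite -[leLHS]mulr1; apply: ler_pM => //.
    by rewrite lerDr sqr_ge0.
  exact: exprn_ege1.
have xs : 1 / 2 <= \sum_(l < N.+1) x l ^+ 2.
  rewrite (eq_bigr (fun l : 'I_N.+1 => xq f N s kap l t ^+ 2)); first exact: sum_xq_ge.
  by move=> l _; rewrite /x -ltnS ltn_ord.
have key := hS' x x01 xs.
have sumE : \sum_(l < N) e l * (2 * x l.+1 ^+ 2 - C * x l) * mu <=
    \sum_(l < N) e l * laplacian (g l) t.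
  apply: ler_sum => l _; rewrite -mulrA ler_wpM2l// mulrC /x ltn_ord (ltnW (ltn_ord l)).
  exact: laplacian_gq_ge.
(* From [f = x_0 dl / M^N] and [dl >= A' M^(N+2)]: the potential pays for the term [A' x_0] in units
   of [mu = M^2]. *)
have fx : A' * x 0%N * mu <= f t.
  have dlA : A' * M ^+ (N + 2) <= dl f N s kap t.
    rewrite -(@ler_pXn2r _ 2)// ?nnegrE; last 2 first.
    - by apply: mulr_ge0 => //; apply: exprn_ge0; exact: ltW.
    - exact/ltW/dl_gt0.
    rewrite dl_sq//; apply: le_trans hD; rewrite exprMn -exprM mulnC exprM Mq_sq//.
    by apply: ler_wpM2r; [apply: exprn_ge0; exact: ltW|rewrite lerDl].
  have MN : 0 < M ^+ N by apply: exprn_gt0.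
  rewrite -(ler_pM2r (exprn_gt0 N mu0)) (f_xq N s kap1 (f0 t)) /x /=.
  have muN : mu ^+ N = M ^+ N * M ^+ N by rewrite -exprD addnn -mul2n exprM Mq_sq.
  have muM : mu = M ^+ 2 by rewrite Mq_sq.
  have -> : A' * xq f N s kap 0 t * mu * mu ^+ N =
     xq f N s kap 0 t * (M ^+ N * (A' * M ^+ (N + 2))).
    by rewrite muN muM exprD; ring.
  apply: ler_wpM2l; first exact: xq_ge0.
  by apply: ler_wpM2l; [exact: ltW|].
have main : c1 * mu <= - laplacian Phi t + f t * Phi t.
  rewrite Phi_lap opprK; apply: le_trans (ler_wpM2r (ltW mu0) key) _.
  rewrite mulrDl mulr_suml addrC; apply: lerD; first exact: sumE.
  by apply: le_trans fx _; rewrite ler_peMr.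
have Zlap : laplacian Z t <= h t * (laplacian Phi t + n%:R * (2 * (K1 * M) + 4)).
  rewrite laplacianE (eq_bigr _ (fun i _ => Z_pd2 i t)) -mulr_sumr ler_wpM2l ?(ltW h0)//.
  have -> : n%:R * (2 * (K1 * M) + 4) = \sum_(i < n) (2 * (K1 * M) + 4).
    by rewrite sumr_const card_ord mulr_natl.
  rewrite laplacianE -big_split; apply: ler_sum => i _ /=.
  rewrite -addrA lerD2l; apply: lerD.
    have : `|bet i t * pd i Phi t| <= K1 * M.
      rewrite normrM -[leRHS]mul1r; apply: ler_pM => //; exact: bet_le1.
    by rewrite ler_norml => /andP[? _]; lra.
  have b2 := bet_sq_le1 i t; have b0 := sqr_ge0 (bet i t).
  apply: (@le_trans _ _ (Phi t * 2)).
    by apply: ler_wpM2l; [exact: le_trans (Phi1 t)|lra].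
  by have := Phi2 t; lra.
have pP : Lam * p t * Phi t <= Lam * (Cp * wgt t ^+ s) * 2.
  apply: (@le_trans _ _ (Lam * (Cp * wgt t ^+ s) * Phi t)).
    apply: ler_wpM2r; first exact: le_trans (Phi1 t).
    by rewrite ler_wpM2l.
  apply: ler_wpM2l => //; rewrite !mulr_ge0//; exact: le_trans w1.
have Mk : M <= kap * wgt t ^+ s.
  rewrite -(@ler_pXn2r _ 2)// ?nnegrE ?(ltW M0) ?mulr_ge0 ?(ltW kap0)//; last exact: le_trans w1.
  rewrite Mq_sq// /mm exprMn ler_wpM2l ?exprn_ge0 ?(ltW kap0)// expr2 ler_peMl//.
  exact: le_trans w1.
have muE : mu = kap * (kap * wgt t ^+ s) by rewrite /mu /mm expr2 mulrA.
have kw : 1 <= kap * wgt t ^+ s by rewrite -[leLHS]mulr1; apply: ler_pM.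
have wk : wgt t ^+ s <= kap * wgt t ^+ s.
  by rewrite ler_peMl//; apply: le_trans w1.
have fin : n%:R * (2 * (K1 * M) + 4) + Lam * (Cp * wgt t ^+ s) * 2 + 1 <= c1 * mu.
  have -> : c1 * mu = (c1 * kap) * (kap * wgt t ^+ s) by rewrite muE mulrA.
  apply: (@le_trans _ _ (T * (kap * wgt t ^+ s))); last first.
    by apply: ler_wpM2r kapT; apply: le_trans kw.
  move: Mk kw wk; set W := kap * wgt t ^+ s; set w := wgt t ^+ s => Mk kw wk.
  have -> : T * W = n%:R * (2 * (K1 * W) + 4 * W) + Lam * (Cp * W) * 2 + W.
    by rewrite /T; ring.
  apply: lerD => //; apply: lerD.
    apply: ler_wpM2l => //; apply: lerD; last by rewrite ler_peMr.
    by apply: ler_wpM2l => //; apply: ler_wpM2l.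
  by apply: ler_wpM2r => //; apply: ler_wpM2l => //; apply: ler_wpM2l.
have : h t * 1 <= h t * (- laplacian Phi t - n%:R * (2 * (K1 * M) + 4) + f t * Phi t
    - Lam * p t * Phi t).
  rewrite ler_wpM2l ?(ltW h0)//.
  exact: lin main pP fin.
rewrite mulr1 => hh; apply: le_trans hh _; rewrite /Z.
by move: Zlap; rewrite /Z; move: (laplacian _ t) (laplacian _ t) => a b; lra.
Qed.

End Supersolution.

(** * Ground states on fine lattices and their limits *)

Section Consistency.
Context {R : realType}.

Lemma mvt_norm_le (g dg : R -> R) (h M a : R) :
  (forall s, is_derive s (1 : R) g (dg s)) ->
  0 <= a <= h -> (forall s, `|s| <= h -> `|dg s| <= M) -> `|g a - g 0| <= M * h.
Proof.
move=> gd /andP[a0 ah] dgM.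
have M0 : 0 <= M by apply: le_trans (normr_ge0 _) (dgM 0 _); rewrite normr0 (le_trans a0).
have cg : {within `[0, a], continuous g}.
  apply: derivable_within_continuous => x xI.
  exact: (@ex_derive _ _ _ _ _ _ _ (gd x)).
have [c cI ->] := @MVT_segment R g dg 0 a a0 (fun x _ => gd x) cg.
move: cI; rewrite in_itv /= => /andP[c0 ca]; rewrite subr0 normrM (ger0_norm a0).
by rewrite ler_pM ?dgM// ger0_norm// (le_trans ca).
Qed.

(** The mean value theorem is applied in turn to [g2], to [phi1] and to [phi], whose derivative is
    [phi1]. A third-derivative bound with error [h^3] is enough, since after division by [h^2] it
    still tends to 0. *)
Lemma second_difference (g0 g1 g2 g3 : R -> R) (h M : R) : 0 <= h ->
  (forall s, is_derive s (1 : R) g0 (g1 s)) ->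
  (forall s, is_derive s (1 : R) g1 (g2 s)) ->
  (forall s, is_derive s (1 : R) g2 (g3 s)) ->
  (forall s, `|s| <= h -> `|g3 s| <= M) ->
  `|g0 h + g0 (- h) - 2 * g0 0 - h ^+ 2 * g2 0| <= 2 * M * h ^+ 3.
Proof.
move=> h0 d0 d1 d2 g3M.
have neg (u v : R -> R) : (forall s, is_derive s (1 : R) u (v s)) ->
    forall s, is_derive s (1 : R) (u \o -%R) (- v (- s)).
  move=> uv s; have dN : is_derive s (1 : R) -%R (- 1) by exact: is_deriveNid.
  have eN := @ex_derive _ _ _ _ _ _ _ dN.
  have eu := @ex_derive _ _ _ _ _ _ _ (uv (- s)).
  split; first by apply/derivable1_diffP/differentiable_comp; exact/derivable1_diffP.
  rewrite -derive1E (derive1_comp eN eu) !derive1E.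
  rewrite (@derive_val _ _ _ _ _ _ _ dN) (@derive_val _ _ _ _ _ _ _ (uv (- s))).
  by rewrite mulrN1.
have n0 := neg _ _ d0; have n1 := neg _ _ d1.
have hh : 0 <= h <= h by rewrite h0 lexx.
have b2 s : `|s| <= h -> `|g2 s - g2 0| <= M * h.
  move=> sh; case: (lerP 0 s) => s0.
    apply: (@mvt_norm_le g2 g3) => //; rewrite s0 /=; move: sh; rewrite ger0_norm//.
  have n2 := neg _ _ d2.
  have := @mvt_norm_le (g2 \o -%R) (fun s => - g3 (- s)) h M (- s) n2.
  rewrite /= opprK oppr0; apply; first by move: sh; rewrite ltr0_norm// => ->; rewrite oppr_ge0 ltW.
  by move=> x xh; rewrite normrN g3M ?normrN.
pose phi1 s := g1 s - g1 (- s) - 2 * s * g2 0.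
have dphi1 s : is_derive s (1 : R) phi1 (g2 s + g2 (- s) - 2 * g2 0).
  have := d1 s; have := n1 s => a b.
  rewrite (_ : phi1 = g1 - (g1 \o -%R) - (2 * g2 0) \*: (@id R)).
    by apply: is_derive_eq; rewrite opprK /GRing.scale/= mulr1.
  by apply/funext => x; rewrite /phi1 /= !fctE /= -[_ *: x]/(_ * x); ring.
have b1 s : 0 <= s <= h -> `|phi1 s| <= 2 * M * h * h.
  move=> sh; have := mvt_norm_le dphi1 sh.
  have -> : phi1 0 = 0 by rewrite /phi1 oppr0; ring.
  rewrite subr0.
  apply=> x xh; have -> : g2 x + g2 (- x) - 2 * g2 0 = (g2 x - g2 0) + (g2 (- x) - g2 0) by ring.
  have -> : 2 * M * h = M * h + M * h by ring.
  by apply: le_trans (ler_normD _ _) _; apply: lerD; apply: b2; rewrite ?normrN.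
pose phi s := g0 s + g0 (- s) - s ^+ 2 * g2 0.
have dphi s : is_derive s (1 : R) phi (phi1 s).
  have := d0 s; have := n0 s => a b.
  rewrite (_ : phi = g0 + (g0 \o -%R) - g2 0 \*: (@id R * @id R)).
    by apply: is_derive_eq; rewrite /phi1 /GRing.scale/=; ring.
  by apply/funext => x; rewrite /phi /= !fctE /= -[_ *: (x * x)]/(_ * (x * x)); ring.
have -> : g0 h + g0 (- h) - 2 * g0 0 - h ^+ 2 * g2 0 = phi h - phi 0.
  by rewrite /phi oppr0; ring.
have -> : 2 * M * h ^+ 3 = 2 * M * h * h * h by ring.
have [c /= cI E] : exists2 c, c \in `[0, h]%R & phi h - phi 0 = phi1 c * (h - 0).
  apply: MVT_segment => //; apply: derivable_within_continuous => x _.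
  exact: (@ex_derive _ _ _ _ _ _ _ (dphi x)).
by rewrite E subr0 normrM (ger0_norm h0) ler_wpM2r// b1// -in_itv.
Qed.

Context {n : nat}.
Implicit Types (Z : 'rV[R]_n -> R).

Lemma bounded_on_box Z (r : R) : continuous Z ->
  exists M, forall t : 'rV[R]_n, (forall i, `|t ord0 i| <= r) -> `|Z t| <= M.
Proof.
move=> cZ; pose C : set 'rV[R]_n := [set t | forall i, `|t ord0 i| <= r].
have [C0|C0] := pselect (C !=set0); last first.
  by exists 0 => t tr; case: C0; exists t.
have clC : closed C by apply: compact_closed; [exact: norm_hausdorff|exact: compact_box].
have [||t0 _ h] := @box_EVT_max _ _ (fun t => `|Z t|) C r _ clC C0.
- by move=> t; apply: (@continuous_comp _ _ _ Z Num.norm); [exact: cZ|exact: norm_continuous].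
- by [].
by exists `|Z t0|.
Qed.

Local Notation posH H := (pos (R := R) (n := n) (fun=> H) 0).

Lemma pos_ev H (x : 'rV[int]_n) i (c : int) :
  posH H (x + c *: ev i) = (c%:~R / H%:R) *: basisv i + posH H x.
Proof.
apply/rowP => j; rewrite !mxE /= rmorphD rmorphM /= mulrDl addrC; congr (_ + _).
by case: eqP => _; rewrite ?mulr1 ?mulr0 ?mul0r.
Qed.

Lemma lattice_consistency Z (r : nat) (e : R) : smooth Z -> 0 < e ->
  exists H0 : nat, forall H, (H0 <= H)%N -> forall x, inbox (r * H) x ->
  `|H%:R ^+ 2 * lap1 (fun y => Z (posH H y)) x - laplacian Z (posH H x)| <= e.
Proof.
move=> sZ e0.
have /choice[M hM] : forall i, exists M, forall t : 'rV[R]_n, (forall j, `|t ord0 j| <= r%:R + 1) ->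
    `|pd i (pd i (pd i Z)) t| <= M.
  by move=> i; apply/bounded_on_box/smooth_continuous; do 3 apply: smooth_pd.
pose S := \sum_i 2 * `|M i|.
have S0 : 0 <= S by apply: sumr_ge0 => i _; rewrite mulr_ge0.
exists (Num.truncn (S / e)).+1 => H hH x xr.
have H0 : (0 < H)%N by apply: leq_trans hH.
have HR : 0 < H%:R :> R by rewrite ltr0n.
have SH : S / H%:R <= e.
  rewrite ler_pdivrMr// mulrC -ler_pdivrMr//; apply: le_trans (ltW (truncnS_gt _)) _.
  by rewrite ler_nat.
apply: le_trans SH; rewrite laplacianE /lap1 mulr_sumr -sumrB /S mulr_suml.
apply: le_trans (ler_norm_sum _ _ _) _; apply: ler_sum => i _.
pose t := posH H x; pose v : 'rV[R]_n := basisv i; pose h : R := H%:R^-1.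
have h0 : 0 <= h by rewrite invr_ge0.
have h1 : h <= 1 by rewrite invf_le1// ler1n.
have dl W : smooth W -> forall s, is_derive s (1 : R) (fun s => W (s *: v + t)) (pd i W (s *: v + t)).
  by move=> sW s; apply: line_is_derive; exact: smooth_differentiable.
have M3 s : `|s| <= h -> `|pd i (pd i (pd i Z)) (s *: v + t)| <= `|M i|.
  move=> sh; apply: le_trans (ler_norm _); apply: hM => j; rewrite !mxE addrC.
  apply: le_trans (ler_normD _ _) _; apply: lerD.
    rewrite normrM (ger0_norm h0) /h ler_pdivrMr//.
    by move/inboxP : xr => /(_ j); rewrite -(ler_int R) intr_norm -natrM.
  rewrite normrM; apply: le_trans (ler_piMr (normr_ge0 _) _) (le_trans sh h1).
  by case: (_ && _); rewrite ?normr1 ?normr0.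
have := second_difference h0 (dl _ sZ) (dl _ (smooth_pd i sZ))
  (dl _ (smooth_pd i (smooth_pd i sZ))) M3.
rewrite scale0r add0r => k2.
have -> : x + ev i = x + 1 *: ev i by rewrite scale1r.
have -> : x - ev i = x + (-1) *: ev i by rewrite scaleN1r.
rewrite !pos_ev -/t mulN1r mul1r -/h -/v.
have Hh : H%:R * h = 1 by rewrite mulfV ?gt_eqF.
have -> : H%:R ^+ 2 * (Z (h *: v + t) + Z (- h *: v + t) - 2 * Z t) - pd i (pd i Z) t =
  H%:R ^+ 2 * (Z (h *: v + t) + Z (- h *: v + t) - 2 * Z t - h ^+ 2 * pd i (pd i Z) t).
  by rewrite -[X in _ - X]mul1r -(expr1n _ 2) -{3}Hh; ring.
rewrite normrM ger0_norm ?exprn_ge0//; apply: le_trans (ler_wpM2l _ k2) _; first exact: exprn_ge0.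
have -> : H%:R ^+ 2 * (2 * `|M i| * h ^+ 3) = 2 * `|M i| * h * (H%:R * h) ^+ 2 by ring.
by rewrite Hh expr1n mulr1.
Qed.

End Consistency.

Section DiscreteGroundState.
Context {R : realType} {n : nat}.
Local Notation posH H := (pos (R := R) (n := n) (fun=> H) 0).
Implicit Types (q p Z : 'rV[R]_n -> R) (t : 'rV[R]_n) (x : 'rV[int]_n).

Lemma localized_test_function q p t0 (rho c Q delta : R) (N H : nat) :
  0 < rho ->
  (forall t, (forall i, `|t ord0 i - t0 ord0 i| <= rho) -> c <= p t /\ q t <= Q) ->
  20 <= rho * H%:R -> (forall i, (`|t0 ord0 i| + rho) * H%:R <= N%:R) -> delta <= 1 ->
  exists v : 'rV[int]_n -> R,
  [/\ forall x, ~~ inbox N x -> v x = 0, forall x, 0 <= v x, exists x, 0 < v x,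
      forall x, 0 < v x -> c <= p (posH H x) &
      forall x, 0 < v x -> - (H%:R ^+ 2) * lap1 v x + (q (posH H x) + delta) * v x
        <= (9 * n%:R * (2 / rho) ^+ 2 + Q + 1) * v x].
Proof.
move=> r0 loc rH hN d1.
have lin (fl y s r : R) : fl <= s -> s < fl + 1 -> 2 * `|y - fl| < r -> 20 <= r ->
    `|y - s| <= r.
  move=> f1 f2 h rr20; have : `|y - s| <= `|y - fl| + 1; last by lra.
  have -> : y - s = (y - fl) + (fl - s) by ring.
  by apply: le_trans (ler_normD _ _) _; rewrite lerD2l ler_norml; apply/andP; split; lra.
have H0 : 0 < H%:R :> R.
  by rewrite ltNge; apply/negP => h; have : rho * H%:R <= 0; [rewrite mulr_ge0_le0// ltW|lra].
pose k0 : 'rV[int]_n := \row_i Num.floor (t0 ord0 i * H%:R).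
(* The support has half-width [rho / 2] in physical units, half of what is allowed; the other half
   covers the rounding of the centre [k0]. The assumption [20 <= rho * H] also yields
   [a <= 1 / 10]. *)
pose a := 2 / (rho * H%:R).
have a0 : 0 < a by rewrite divr_gt0// mulr_gt0.
have a1 : a <= 1 / 10 by rewrite ler_pdivrMr ?mulr_gt0//; lra.
have near x i : 0 < bumps a k0 x -> `|(x ord0 i)%:~R / H%:R - t0 ord0 i| <= rho.
  move=> /bumps_gt0/(_ i); rewrite normrM (ger0_norm (ltW a0)) /a mulrAC ltr_pdivrMr ?mulr_gt0//.
  rewrite mul1r => h.
  have -> : (x ord0 i)%:~R / H%:R - t0 ord0 i = ((x ord0 i)%:~R - t0 ord0 i * H%:R) / H%:R.
    by rewrite mulrBl mulfK// gt_eqF.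
  rewrite normrM normfV (ger0_norm (ltW H0)) ler_pdivrMr//.
  have f1 := floor_le_tmp (t0 ord0 i * H%:R); have f2 := floorD1_gt (t0 ord0 i * H%:R).
  move: f2 h; rewrite rmorphD /= !mxE rmorphB /= => f2 h.
  exact: lin f1 f2 h rH.
exists (bumps a k0); split.
- move=> x xN; apply/eqP; rewrite eq_le bumps_ge0 andbT leNgt; apply: contra xN => h.
  apply/inboxP => i; rewrite -(ler_int R) intr_norm; apply: le_trans (hN i).
  rewrite -ler_pdivrMr//; have := near x i h; have := ler_normD ((x ord0 i)%:~R / H%:R - t0 ord0 i) (t0 ord0 i).
  by rewrite subrK normrM normfV (ger0_norm (ltW H0)); lra.
- exact: bumps_ge0.
- exists k0; apply: prodr_gt0 => i _.
  by rewrite bump_gt0 subrr mulr0 normr0.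
- by move=> x h; apply: (loc _ _).1 => i; rewrite mxE; exact: near.
move=> x h; have := bumps_lap a0 a1 h; have h0 := bumps_ge0 a k0 x.
move=> /(ler_wpM2l (exprn_ge0 2 (ltW H0))).
have -> : H%:R ^+ 2 * (9 * n%:R * a ^+ 2 * bumps a k0 x) = 9 * n%:R * (2 / rho) ^+ 2 * bumps a k0 x.
  rewrite /a; field; rewrite !gt_eqF//.
have qQ : q (posH H x) <= Q by apply: (loc _ _).2 => i; rewrite mxE; exact: near.
have : (q (posH H x) + delta) * bumps a k0 x <= (Q + 1) * bumps a k0 x.
  by rewrite ler_wpM2r// lerD.
clear; move: (lap1 _ _) (q _) (bumps _ _ _) (H%:R ^+ 2) (n%:R) ((2/rho)^+2) => l qq b hh nn s.
lra.
Qed.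

(** At a maximum point of [u / Z], [u] touches [tau * Z] from below, so its lattice Laplacian is at
    most [tau] times that of [Z]. Outside the ball this contradicts the supersolution inequality,
    [delta > 0] giving strictness. Outside the box [u = 0], so the comparison also holds at
    neighbours there. *)
Lemma comparison_at_infinity q p Z (R0 Lam lam delta : R) (r H : nat)
    (u : 'rV[int]_n -> R) :
  (0 < H)%N -> (forall t, 0 <= p t) -> (forall t, 0 < Z t) -> 0 < delta -> lam <= Lam ->
  (forall t, R0 <= dotv t t -> (wgt t)^-1 <= - laplacian Z t + q t * Z t - Lam * p t * Z t) ->
  (forall x, inbox (r * H) x ->
    `|H%:R ^+ 2 * lap1 (fun y => Z (posH H y)) x - laplacian Z (posH H x)|
       <= (1 + n%:R * r%:R ^+ 2)^-1) ->
  (forall x, 0 <= u x) -> (forall x, ~~ inbox (r * H) x -> u x = 0) -> (exists x, 0 < u x) ->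
  (forall x, inbox (r * H) x ->
    - (H%:R ^+ 2) * lap1 u x + (q (posH H x) + delta) * u x = lam * p (posH H x) * u x) ->
  exists (tau : R) x1, [/\ 0 < tau, u x1 = tau * Z (posH H x1),
    inbox (r * H) x1 /\ dotv (posH H x1) (posH H x1) < R0 & forall x, u x <= tau * Z (posH H x)].
Proof.
move=> H0 p0 Z0 d0 lL super cons u0 uout [xp uxp] eqn.
have HR : 0 < H%:R :> R by rewrite ltr0n.
have xpB : inbox (r * H) xp by apply: contraT => /uout uE; move: uxp; rewrite uE ltxx.
have [x1 [x1B _ hmax]] := @box_argmax _ _ (r * H) predT (fun x => u x / Z (posH H x))
  (ex_intro2 _ _ xp xpB isT).
pose tau := u x1 / Z (posH H x1).
have tau0 : 0 < tau.
  by apply: lt_le_trans (hmax xp xpB isT); rewrite divr_gt0.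
have uE : u x1 = tau * Z (posH H x1) by rewrite mulfVK ?gt_eqF.
have ule x : u x <= tau * Z (posH H x).
  have [xB|/uout->] := boolP (inbox (r * H) x); last by rewrite mulr_ge0// ltW.
  by rewrite -ler_pdivrMr//; exact: hmax.
exists tau, x1; split=> //; split=> //; rewrite ltNge; apply/negP => /super.
set t := posH H x1 => sup.
have lapu : lap1 u x1 <= tau * lap1 (fun y => Z (posH H y)) x1.
  rewrite /lap1 mulr_sumr; apply: ler_sum => i _; rewrite uE.
  have := ule (x1 + ev i); have := ule (x1 - ev i); rewrite -/t.
  by clear; lra.
(* In the box [wgt] is at most [1 + n r^2], so the discretisation error is absorbed by the term
   [1 / wgt] of the supersolution inequality. *)
have w0 : (1 + n%:R * r%:R ^+ 2)^-1 <= (wgt t)^-1.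
  have D0 : 0 < 1 + n%:R * r%:R ^+ 2 :> R by rewrite ltr_wpDr// mulr_ge0// exprn_ge0.
  rewrite lef_pV2 ?posrE ?wgt_gt0//.
  rewrite /wgt lerD2l (_ : n%:R * _ = \sum_(i < n) r%:R ^+ 2); last first.
    by rewrite sumr_const card_ord mulr_natl.
  apply: ler_sum => i _; rewrite -expr2 -[leLHS]ger0_norm ?sqr_ge0// normrX; apply: lerXn2r; rewrite ?nnegrE//.
  rewrite !mxE normrM normfV (ger0_norm (ltW HR)) ler_pdivrMr//.
  by move/inboxP : x1B => /(_ i); rewrite -(ler_int R) intr_norm -natrM.
have := cons x1 x1B; rewrite -/t ler_norml => /andP[_ c2].
have HZ : H%:R ^+ 2 * lap1 (fun y => Z (posH H y)) x1 <= q t * Z t - Lam * p t * Z t.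
  move: c2 sup w0; clear; lra.
have HU : H%:R ^+ 2 * lap1 u x1 <= tau * (q t * Z t - Lam * p t * Z t).
  apply: le_trans (ler_wpM2l (ltW tau0) HZ); rewrite mulrCA ler_wpM2l// exprn_ge0// ltW.
have lp : lam * p t * (tau * Z t) <= Lam * p t * (tau * Z t).
  by apply: ler_wpM2r; [rewrite mulr_ge0// ltW|rewrite ler_wpM2r].
have dZ : 0 < delta * (tau * Z t) by apply: mulr_gt0 => //; exact: mulr_gt0.
have := eqn x1 x1B; rewrite -/t uE.
move: HU lp dZ; clear; lra.
Qed.

Lemma discrete_ground_state q p Z t0 (R0 Lam rho c Q : R) (r k : nat) :
  (forall t, 0 <= q t) -> (forall t, 0 <= p t) -> smooth Z -> (forall t, 0 < Z t) ->
  (forall t, R0 <= dotv t t -> (wgt t)^-1 <= - laplacian Z t + q t * Z t - Lam * p t * Z t) ->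
  0 < rho -> 0 < c ->
  (forall t, (forall i, `|t ord0 i - t0 ord0 i| <= rho) -> c <= p t /\ q t <= Q) ->
  (9 * n%:R * (2 / rho) ^+ 2 + Q + 1) / c <= Lam ->
  (forall i, `|t0 ord0 i| + rho <= r%:R) ->
  exists (H : nat) (lam : R) u x1, [/\ (k < H)%N, 0 < lam <= Lam,
    forall x, 0 <= u x <= Z (posH H x),
    u x1 = Z (posH H x1) /\ dotv (posH H x1) (posH H x1) < R0 &
    forall x, inbox (r * H) x ->
      H%:R ^+ 2 * lap1 u x = (q (posH H x) + k.+1%:R^-1 - lam * p (posH H x)) * u x].
Proof.
move=> q0 p0 sZ Z0 super r0 c0 loc LamE t0r.
pose w0 : R := (1 + n%:R * r%:R ^+ 2)^-1.
have w00 : 0 < w0 by rewrite invr_gt0 ltr_wpDr// mulr_ge0// exprn_ge0.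
have [H0 hH0] := lattice_consistency r sZ w00.
(* Three demands on the mesh: consistency for [Z] in the whole box, [k < H], and room for the test
   function. *)
pose H := (H0 + k.+1 + (Num.truncn (20 / rho)).+1)%N.
have kH : (k < H)%N by rewrite /H -addnA addnCA leq_addr.
have HH : (0 < H)%N by apply: leq_ltn_trans kH.
have HR : 0 < H%:R :> R by rewrite ltr0n.
have HR2 : 0 < H%:R ^+ 2 :> R by rewrite exprn_gt0.
pose d : R := k.+1%:R^-1; have d0 : 0 < d by rewrite invr_gt0.
have d1 : d <= 1 by rewrite invf_le1// ler1n.
have rH : 20 <= rho * H%:R.
  rewrite mulrC -ler_pdivrMr//; apply: le_trans (ltW (truncnS_gt _)) _.
  by rewrite ler_nat leq_addl.
have hN i : (`|t0 ord0 i| + rho) * H%:R <= (r * H)%:R by rewrite natrM ler_wpM2r.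
have [v [vout v0 vpos vc vL]] := localized_test_function r0 loc rH hN d1.
have [|lam [u [[lam0 u0] uout upos eqn lamE]]] :=
  @lattice_ground_state R n (r * H) _ _ _ _ HR2 d0 (fun x => q0 (posH H x)) (fun x => p0 (posH H x)).
  have [x vx] := vpos; exists x; last exact: lt_le_trans c0 (vc x vx).
  by apply: contraT => /vout vE; move: vx; rewrite vE ltxx.
have lL : lam <= Lam by apply: le_trans LamE; exact: (lamE v).
have cons x : inbox (r * H) x ->
    `|H%:R ^+ 2 * lap1 (fun y => Z (posH H y)) x - laplacian Z (posH H x)| <= w0.
  by apply: hH0; rewrite /H -addnA leq_addr.
have [tau [x1 [tau0 ux1 [x1B x1R] ule]]] :=
  comparison_at_infinity HH p0 Z0 d0 lL super cons u0 uout upos eqn.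
exists H, lam, (fun x => u x / tau), x1; split=> //.
- by rewrite lam0.
- by move=> x; rewrite divr_ge0 ?(ltW tau0)//= ler_pdivrMr// mulrC.
- by rewrite ux1 mulrAC mulfV ?gt_eqF// mul1r.
move=> x xB; have -> : lap1 (fun x => u x / tau) x = lap1 u x / tau.
  by rewrite /lap1 mulr_suml; apply: eq_bigr => i _; ring.
rewrite !mulrA; congr (_ / _); have := eqn x xB; rewrite -/d.
by move: (lap1 u x) (H%:R ^+ 2) => l h; clear; lra.
Qed.

End DiscreteGroundState.

Section EntireSolution.
Context {R : realType} {n : nat}.
Local Notation posH H := (pos (R := R) (n := n) (fun=> H) 0).
Implicit Types (Z : 'rV[R]_n -> R) (t : 'rV[R]_n) (x : 'rV[int]_n).

Lemma rV_cvg (F : set_system nat) {FF : Filter F} (a : nat -> 'rV[R]_n) (l : 'rV[R]_n) :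
  (forall i, a k ord0 i @[k --> F] --> l ord0 i) -> a @ F --> l.
Proof.
move=> h; apply/cvgrPdist_le => e e0.
have := @filter_forall _ _ (fun i k => `|l ord0 i - a k ord0 i| <= e) F FF.
move=> /(_ (fun i => (@cvgrPdist_le _ _ _ _ _ _ _).1 (h i) e e0)).
apply: filterS => k hk; rewrite [leLHS]/Num.norm /= mx_normrE.
apply/bigmax_leP; split; first exact: ltW.
by move=> [b i] _ /=; rewrite (ord1 b) !mxE; exact: hk.
Qed.

Lemma lattice_limit (q p : mpoly.mpoly n R) Z (R0 Lam : R) (K : nat) :
  continuous Z -> (forall t, 0 < Z t) -> (forall t, Z t <= 2) ->
  (forall k : nat, exists (H : nat) (lam : R) u x1, [/\ (k < H)%N, 0 < lam <= Lam,
    forall x, 0 <= u x <= Z (posH H x),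
    u x1 = Z (posH H x1) /\ dotv (posH H x1) (posH H x1) < R0 &
    forall x, inbox ((k + K) * H) x -> H%:R ^+ 2 * lap1 u x =
      (evalp q (posH H x) + k.+1%:R^-1 - lam * evalp p (posH H x)) * u x]) ->
  exists (lam : R) (f : 'rV[R]_n -> R), [/\ 0 <= lam, twice_diff f,
    forall t, laplacian f t = (evalp q t - lam * evalp p t) * f t,
    forall t, 0 <= f t <= Z t & exists t, 0 < f t].
Proof.
have lin (a b : R) : a ^+ 2 <= b -> a <= 1 + b.
  move=> ab; have := sqr_ge0 (a - 1); have := sqr_ge0 a; rewrite sqrrB1 -mulr_natl.
  by move: ab; move: (a ^+ 2) => c; lra.
move=> cZ Z0 Z2 hyp.
have /choice[D hD] : forall k : nat, exists D : nat * R * ('rV[int]_n -> R) * 'rV[int]_n,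
  [/\ (k < D.1.1.1)%N, 0 < D.1.1.2 <= Lam,
    forall x, 0 <= D.1.2 x <= Z (posH D.1.1.1 x),
    D.1.2 D.2 = Z (posH D.1.1.1 D.2) /\ dotv (posH D.1.1.1 D.2) (posH D.1.1.1 D.2) < R0 &
    forall x, inbox ((k + K) * D.1.1.1) x -> D.1.1.1%:R ^+ 2 * lap1 D.1.2 x =
      (evalp q (posH D.1.1.1 x) + k.+1%:R^-1 - D.1.1.2 * evalp p (posH D.1.1.1 x)) * D.1.2 x].
  by move=> k; have [H [lam [u [x1 h]]]] := hyp k; exists (H, lam, u, x1).
pose H k := (D k).1.1.1; pose lm k := (D k).1.1.2; pose u k := (D k).1.2; pose y k := (D k).2.
have Hk k : (k < H k)%N by have [] := hD k.
have H0 k : (0 < H k)%N by apply: leq_ltn_trans (Hk k).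
have HR k : 0 < (H k)%:R :> R by rewrite ltr0n.
(* An ultrafilter finer than convergence to infinity, so that it contains all tails. *)
have [F [FU oF]] := @ultraFilterLemma _ \oo eventually_filter.
have Fev k0 : F [set k | (k0 <= k)%N] by apply: oF; exact: nbhs_infty_ge.
have bu : lb H u.
  move=> r; exists 2, 0%N => k _ x _; have [_ _ /(_ x)/andP[h1 h2] _ _] := hD k.
  by rewrite ger0_norm//; exact: le_trans h2 (Z2 _).
have lm0 k : 0 < lm k by have [_ /andP[]] := hD k.
have lmL k : `|lm k| <= Lam by have [_ /andP[_ h] _ _ _] := hD k; rewrite ger0_norm// ltW.
pose d k : R := k.+1%:R^-1.
have d1 k : `|d k| <= 1 by rewrite ger0_norm ?invr_ge0// invf_le1// ler1n.
have cd : d @ F --> (0 : R).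
  apply/cvgrPdist_le => e e0; apply: filterS (small_inv Fev e0) => k /= ke.
  by rewrite sub0r normrN ger0_norm// invr_ge0.
have [lam hlam] := ultra_cvg (filterS (fun k _ => lmL k) (@filterT _ F _)).
pose Q k x := evalp q (pos H k x); pose P k x := evalp p (pos H k x).
pose V k x := Q k x + (d k + - lm k * P k x).
have cQ m : cb H m Q by exact: cb_evalp.
have cP m : cb H m P by exact: cb_evalp.
have cV m : cb H m V.
  apply: cb_add; first exact: cQ; apply: cb_add; first exact: (cb_cst _ _ d1).
  by apply: cb_mul (cP m) => //; apply: (@cb_cst _ _ _ _ _ Lam) => k; rewrite normrN.
have eV : loc_eq H (fun k x => V k x * u k x) (lapq H u).
  move=> r; exists r => k rk x xr; have [_ _ _ _ E] := hD k.
  rewrite /lapq E; last first.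
    by apply: inboxW xr; rewrite leq_mul2r (leq_trans rk (leq_addr _ _)) orbT.
  by rewrite /V /Q /P /d addrA mulNr.
have cu : cb H 3 u by have := cb_regularity H0 bu cV eV; exact.
pose f := fl F H u.
have cvf t : u k (flo H k t) @[k --> F] --> f t by apply: fl_cvg.
exists lam, f; split.
- by apply: (ucv_le _ (cvg_cst 0) hlam); apply: filterS (@filterT _ F _) => k _; exact: ltW.
- by move=> t; have [] := fl_laplacian (FU := FU) Hk Fev t cu.
- move=> t; have [_ ->] := fl_laplacian (FU := FU) Hk Fev t cu; apply: fl_eq.
  have lim1 (g : mpoly.mpoly n R) : evalp g (pos H k (flo H k t)) @[k --> F] --> evalp g t.
    rewrite -(@fl_evalp R n F FU H Hk Fev g t).
    apply: (@fl_cvg R n F FU H Hk Fev (fun k x => evalp g (pos H k x))).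
    exact: cb_lb (cb_evalp _ 0 _).
  have c1 : V k (flo H k t) * u k (flo H k t) @[k --> F] --> (evalp q t - lam * evalp p t) * f t.
    rewrite -[evalp q t - _]/(_ + - _) -(add0r (- _)) -mulNr.
    apply: cvgM (cvf t); apply: cvgD; first exact: lim1.
    by apply: cvgD cd _; apply: cvgM (lim1 p); exact: cvgN.
  apply: cvg_trans c1; apply: near_eq_cvg.
  have [r tr] := bounded_coord t; have [k0 hk] := eV r.+1.
  apply: filterS (Fev k0) => k /= kk; apply: hk => //; exact: flo_box.
- move=> t; have uz k x : 0 <= u k x <= Z (pos H k x) by have [_ _ h _ _] := hD k; exact: h.
  have cz : Z (pos H k (flo H k t)) @[k --> F] --> Z t.
    have ce : {for t, continuous Z} := cZ t.
    exact: (@continuous_cvg _ _ _ F _ _ _ _ ce (@pos_flo_cvg R n F FU H Hk Fev t)).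
  apply/andP; split.
    apply: (ucv_le _ (cvg_cst 0) (cvf t)); apply: filterS (@filterT _ F _) => k _.
    by have /andP[] := uz k (flo H k t).
  apply: (ucv_le _ (cvf t) cz); apply: filterS (@filterT _ F _) => k _.
  by have /andP[] := uz k (flo H k t).
(* The contact points stay in a fixed ball and converge along the ultrafilter to some [ts]; [f] is
   nonzero because [f ts = Z ts]. *)
have yR k i : `|pos H k (y k) ord0 i| <= 1 + `|R0|.
  have [_ _ _ [_ hy] _] := hD k.
  have : (pos H k (y k) ord0 i) ^+ 2 <= `|R0|.
    apply: le_trans (ler_norm _); apply: le_trans (ltW hy).
    rewrite /dotv (bigD1 i)//= expr2 lerDl sumr_ge0// => j _.
    by rewrite -expr2 sqr_ge0.
  by rewrite -[X in X <= _ -> _]ger0_norm ?sqr_ge0// normrX; exact: lin.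
have /choice[l hl] : forall i, exists l : R, pos H k (y k) ord0 i @[k --> F] --> l.
  by move=> i; apply: ultra_cvg; apply: filterS (@filterT _ F _) => k _; exact: yR.
pose ts : 'rV[R]_n := \row_i l i.
have cts : pos H k (y k) @[k --> F] --> ts by apply: rV_cvg => i; rewrite mxE.
have cZy : Z (pos H k (y k)) @[k --> F] --> Z ts.
  have ce : {for ts, continuous Z} := cZ ts.
  exact: (@continuous_cvg _ _ _ F _ _ _ _ ce cts).
exists ts; suff -> : f ts = Z ts by exact: Z0.
apply/eqP; rewrite -subr_eq0 -normr_le0.
have [r tr] := bounded_coord ts.
(* A cube containing both the contact points and the lattice points approximating [ts]. Difference
   quotients of [u] are bounded there, so [lattice_lip] compares the values of [u] at the two. *)
pose r1 := maxn r.+1 (Num.truncn (1 + `|R0|)).+1.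
have [C [k0 [C0 hC]]] := lb_uniform (fun i => (cu.2 i).1) r1.
have diff0 i : pos H k (flo H k ts) ord0 i - pos H k (y k) ord0 i @[k --> F] --> (0 : R).
  rewrite -(subrr (ts ord0 i)); apply: cvgB; last by rewrite mxE; exact: hl.
  apply/cvgrPdist_le => e e0; apply: filterS (small_inv Fev e0) => k /= ke.
  by apply: le_trans ke; exact: flo_dist.
apply: (@ucv_norm_le R F FU (fun k => u k (flo H k ts) - Z (pos H k (y k)))
  (fun k => C * \sum_i `|pos H k (flo H k ts) ord0 i - pos H k (y k) ord0 i|)).
- apply: filterS (Fev k0) => k /= kk; have [_ _ _ [uy _] _] := hD k; rewrite -uy -/(u k).
  have b1 : inbox (r1 * H k) (flo H k ts).
    by apply: inboxW (flo_box Hk k tr); rewrite leq_mul2r leq_maxl orbT.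
  have b2 : inbox (r1 * H k) (y k).
    apply/inboxP => i; rewrite -(ler_int R) intr_norm -[leRHS]/((r1 * H k)%:R) natrM -ler_pdivrMr//.
    have := yR k i; rewrite !mxE normrM normfV [`|(H k)%:R|]ger0_norm ?(ltW (HR k))// => h.
    apply: le_trans h _; apply: le_trans (ltW (truncnS_gt _)) _.
    by rewrite ler_nat leq_maxr.
  have := @lattice_lip R n (u k) (C / (H k)%:R) _ _ b2 _ b1.
  have -> : (C / (H k)%:R) * (\sum_l `|flo H k ts 0 l - y k 0 l|)%:~R =
     C * \sum_i `|pos H k (flo H k ts) ord0 i - pos H k (y k) ord0 i|.
    rewrite -mulrA; congr (_ * _); rewrite rmorph_sum mulr_sumr; apply: eq_bigr => i _.
    rewrite !mxE -mulrBl normrM normfV [`|(H k)%:R|]ger0_norm ?(ltW (HR k))// mulrC.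
    by rewrite /= intr_norm rmorphB.
  apply=> z i zb _; rewrite ler_pdivlMr// mulrC.
  by have := hC i k kk z zb; rewrite /dq normrM ger0_norm// ltW.
- exact: cvgB.
- rewrite -[X in _ --> X](mulr0 C); apply: cvgM; first exact: cvg_cst.
  rewrite -[X in _ --> X](_ : \sum_(i < n) `|(0 : R)| = 0); last by rewrite big1// => i _; rewrite normr0.
  by apply: ucv_sum => i; apply: cvg_norm.
Qed.

End EntireSolution.

(** * Positivity and conclusion *)

Section Positivity.
Context {R : realType} {n : nat}.
Implicit Types (w f : 'rV[R]_n -> R) (t : 'rV[R]_n).

Lemma twice_diff_affine w (a b : R) : twice_diff w ->
  twice_diff (fun t => a * w t + b) /\
  forall t, laplacian (fun t => a * w t + b) t = a * laplacian w t.
Proof.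
move=> dw.
have dab (g : 'rV[R]_n -> R) c t : differentiable g t -> differentiable (fun t => a * g t + c) t.
  move=> dg; apply: (@differentiableD _ _ _ (fun t => a * g t) (fun=> c)) => //.
  exact: (@differentiableZ _ _ _ g).
have D (g : 'rV[R]_n -> R) c i : (forall t, differentiable g t) ->
    'D_(basisv i) (fun t => a * g t + c) = (fun t => a * 'D_(basisv i) g t + 0).
  move=> dg; apply/funext => t.
  have -> : (fun t => a * g t + c) = (fun t => a *: g t) + (cst c) by [].
  have dv : derivable g t (basisv i) by exact/diff_derivable.
  rewrite deriveD ?derive_cst ?addr0; [|exact: derivableZ|exact: derivable_cst].
  by rewrite deriveZ.
have dw1 t := (dw t).1; have dw2 i t := (dw t).2 i.
split=> t; first by split=> [|i]; rewrite ?D//; exact: dab.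
rewrite /laplacian mulr_sumr; apply: eq_bigr => i _; rewrite (D w b i dw1).
by have /(congr1 (fun h => h t)) /= := D _ 0 i (dw2 i); rewrite addr0.
Qed.

Lemma sqd_bounded_coord (y t : 'rV[R]_n) (r : R) i : sqd y t <= r ->
  `|t ord0 i| <= `|y| + 1 + `|r|.
Proof.
move=> h; have h1 : (t ord0 i - y ord0 i) ^+ 2 <= `|r|.
  apply: le_trans (ler_norm r); apply: le_trans h.
  by rewrite /sqd (bigD1 i)//= lerDl sumr_ge0// => j _; rewrite sqr_ge0.
have h2 : `|t ord0 i - y ord0 i| <= 1 + `|r|.
  apply: (@le_trans _ _ (1 + `|t ord0 i - y ord0 i| ^+ 2)).
    move: (`|_|) => a; have := sqr_ge0 (a - 1); have := sqr_ge0 a.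
    by rewrite sqrrB1 -mulr_natl; move: (a ^+ 2) => b; lra.
  by rewrite lerD2l -normrX ger0_norm ?sqr_ge0.
have := coord_le_norm y i; have := ler_normD (t ord0 i - y ord0 i) (y ord0 i).
by rewrite subrK; move: h2; lra.
Qed.

Lemma positive_solution f (V : 'rV[R]_n -> R) : twice_diff f -> continuous V -> (forall t, 0 <= f t) ->
  (forall t, laplacian f t = V t * f t) -> (exists t, 0 < f t) -> forall t, 0 < f t.
Proof.
move=> df cV f0 eqn [y fy]; apply: (strong_maximum (y := y)) => // r.
have [M hM] := bounded_on_box (`|y| + 1 + `|r|) cV; exists `|M| => // x xr.
rewrite eqn ler_wpM2r//; apply: le_trans (ler_norm _) _; apply: le_trans (ler_norm M).
by apply: hM => i; exact: sqd_bounded_coord xr.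
Qed.

(** The decay makes the set [f 0 <= f] bounded, so [f] attains its maximum. Then [f t1 - f] is
    nonnegative and superharmonic, zero at [t1] but positive far out, against the strong maximum
    principle. *)
Lemma no_decaying_subharmonic f : (0 < n)%N -> twice_diff f -> (forall t, 0 < f t) ->
  (forall t, 0 <= laplacian f t) -> ~ (forall t, f t <= 2 * (wgt t)^-1).
Proof.
move=> n0 df f0 lap0 dec.
have cf : continuous f by move=> t; exact/differentiable_continuous/(df t).1.
have fwgt t (a : R) : 0 < a -> a <= f t -> wgt t <= 2 / a.
  by move=> a0 af; rewrite ler_pdivlMr// mulrC -ler_pdivlMr ?wgt_gt0//; exact: le_trans (dec t).
have [||| t1 t1C hmax] := @box_EVT_max R n f [set t | f 0 <= f t] (2 / f 0) cf.
- by apply: (closed_le_fun (f := fun=> f 0)) => // t; exact: cst_continuous.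
- by exists 0 => /=.
- move=> t /= /(fwgt _ _ (f0 0)) h i; apply: le_trans h; rewrite /wgt.
  apply: le_trans (_ : 1 + t ord0 i ^+ 2 <= _); last by rewrite lerD2l dotv_coord.
  rewrite -[X in _ <= _ + X]ger0_norm ?sqr_ge0// normrX; move: (`|_|) => a.
  have := sqr_ge0 (a - 1); have := sqr_ge0 a.
  by rewrite sqrrB1 -mulr_natl; move: (a ^+ 2) => b; lra.
have fmax t : f t <= f t1.
  have [h|h] := lerP (f 0) (f t); first exact: hmax.
  exact: le_trans (ltW h) t1C.
pose w t := -1 * f t + f t1; have [dw lw] := twice_diff_affine (-1) (f t1) df.
have w0 t : 0 <= w t by rewrite /w mulN1r addrC subr_ge0.
have [om omS] := sphere_nonempty (R := R) n0.
(* With [a = 2 / f t1], [wgt t2 = 1 + a^2 > a], hence [f t2 <= 2 / wgt t2 < f t1]. *)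
pose t2 := (2 / f t1) *: om.
have w2 : 0 < w t2.
  rewrite /w mulN1r addrC subr_gt0 ltNge; apply/negP => /(fwgt _ _ (f0 t1)).
  rewrite /wgt /t2 dotvZ omS mulr1.
  have : 0 < 2 / f t1 by rewrite divr_gt0.
  move: (2 / f t1) => a a0; have := sqr_ge0 (a - 1); have := sqr_ge0 a.
  by rewrite sqrrB1 -mulr_natl; move: (a ^+ 2) => b; lra.
have := strong_maximum dw w0 _ w2 t1; rewrite /w mulN1r addNr ltxx => absurd.
suff : false by []; apply: absurd => r; exists 0 => // x _.
by rewrite mul0r lw mulN1r oppr_le0.
Qed.

End Positivity.

Lemma nonvanishing_derivatives (R : realType) (n m s : nat) (q : mpoly.mpoly n R) :
  (s < m)%N -> homogeneous (2 * m) q ->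
  ((forall omega, unit_sphere n omega -> evalp q omega != 0)
    \/
    (exists j : nat,
        (exists omega, unit_sphere n omega /\ evalp q omega = 0) /\
        max_vanishing_order q j /\
        ((2 * s%:R - 2 * m%:R + j%:R) / j%:R + s%:R < (0 : R)))) ->
  exists2 j, (j + s * (j + 2) < 2 * m)%N & forall om : 'rV[R]_n, unit_sphere n om ->
    exists2 a, (size a <= j)%N & iter_partial a (evalp q) om != 0.
Proof.
move=> sm qhom [qS|[j [_ [[hmax _] hj]]]].
  (* Case (a) is the case of order 0: the condition becomes [2 s < 2 m], and the empty list of
     derivatives is the witness. *)
  by exists 0%N => [|om /qS h]; [lia|exists [::]].
(* Division by zero yields 0, so for [j = 0] the inequality would read [s < 0]. For positive [j] it
   is multiplied through to [2 s - 2 m + j + s j < 0]. *)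
have j0 : (0 < j)%N.
  rewrite lt0n; apply/eqP => j0; move: hj; rewrite j0 invr0 mulr0 add0r.
  by rewrite ltNge ler0n.
exists j => [|om omS].
  rewrite -(ltr_nat R) !natrD !natrM natrD.
  have jR : 0 < j%:R :> R by rewrite ltr0n.
  have := etrans (ltr_pM2r jR _ _) hj; rewrite mul0r mulrDl mulfVK ?gt_eqF//.
  by clear; move: (j%:R) (s%:R) (m%:R) => a b c; lra.
have [q0|q0] := eqVneq (evalp q om) 0; last by exists [::].
have [k [[B [_ [[idx [sidx hidx]] _]]] kj]] := hmax om omS q0.
have [a ah aF] := chart_nonvanishing qhom hidx; exists a => //.
by apply: leq_trans ah _; rewrite sidx.
Qed.

Lemma positive_on_box (R : realType) (n : nat) (p : 'rV[R]_n -> R) (t1 : 'rV[R]_n) :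
  continuous p -> 0 < p t1 -> exists2 rho, 0 < rho &
    forall t : 'rV[R]_n, (forall i, `|t ord0 i - t1 ord0 i| <= rho) -> p t1 / 2 <= p t.
Proof.
move=> cp p1; have h2 : p t1 / 2 < p t1 by lra.
have /nbhs_normP[e /= e0 he] : \forall t \near t1, p t1 / 2 < p t.
  exact: (@cvgr_gt _ _ _ _ _ _ (cp t1) _ h2).
exists (e / 2) => [|t ht]; first by rewrite divr_gt0.
apply/ltW/he; rewrite /= distrC; apply: (@le_lt_trans _ _ (e / 2)); last by lra.
rewrite [leLHS]/Num.norm /= mx_normrE; apply/bigmax_leP; split=> [|[a i] _ /=].
  by rewrite divr_ge0// ltW.
by rewrite (ord1 a) !mxE; exact: ht.
Qed.

Theorem theorem3p2 (R : realType) (n m s : nat) (q p : mpoly.mpoly n R) :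
  (1 <= n)%N ->
  (s < m)%N ->
  homogeneous (2 * m) q -> (forall t, 0 <= evalp q t) ->
  homogeneous (2 * s) p -> (forall t, 0 <= evalp p t) -> p != 0 ->
  ( (* (a) *) (forall omega, unit_sphere n omega -> evalp q omega != 0)
    \/
    (* (b) *) (exists j : nat,
        (exists omega, unit_sphere n omega /\ evalp q omega = 0) /\
        max_vanishing_order q j /\
        ((2 * s%:R - 2 * m%:R + j%:R) / j%:R + s%:R < (0 : R)))) ->
  exists (lambda : R), 0 < lambda /\
  exists f : 'rV[R]_n -> R,
    (forall t, differentiable f t /\
       forall i : 'I_n, differentiable ('D_(basisv i) f) t) /\
    (forall t, - laplacian f t + (evalp q t - lambda * evalp p t) * f t = 0) /\
    (forall t, 0 < f t) /\ f 0 = 1 /\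
    exists C : R, forall t,
      0 < f t < C * (1 + enorm t) ^+ ((m + 1) * (n - 1)).
Proof.
move=> n0 sm qhom q0 phom p0 pn0 cases.
have [j jm nonvan] := nonvanishing_derivatives sm qhom cases.
have sq := smooth_evalp q; have sp := smooth_evalp p.
have hq c t : evalp q (c *: t) = c ^+ (2 * m) * evalp q t by exact: evalp_homogeneous.
have hp c t : evalp p (c *: t) = c ^+ (2 * s) * evalp p t by exact: evalp_homogeneous.
have [Cp Cp0 pCp] := homogeneous_upper n0 sp hp.
have [t1 pt1] := evalp_neq0 pn0.
have p1 : 0 < evalp p t1 by rewrite lt_neqAle eq_sym pt1 p0.
have cp : continuous (evalp p) := smooth_continuous sp.
have cq : continuous (evalp q) := smooth_continuous sq.
have [rho r0 hrho] := positive_on_box cp p1.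
have [Q hQ] := bounded_on_box (`|t1| + rho) cq.
have c0 : 0 < evalp p t1 / 2 by rewrite divr_gt0.
(* The eigenvalue bound from the test function near [t1]. It depends neither on the mesh nor on the
   box, so one supersolution serves all [k]; the absolute value only ensures the sign. *)
pose Lam := `|(9 * n%:R * (2 / rho) ^+ 2 + Q + 1) / (evalp p t1 / 2)|.
have [Z [R0 [sZ Z0 Zw super]]] := supersolution n0 sq hq q0 nonvan jm Cp0 (normr_ge0 _ : 0 <= Lam) pCp.
(* The offset [K] makes the box of every index, including 0, contain the support of the test
   function. *)
pose K := (Num.truncn (`|t1| + rho)).+1.
have t1K (k : nat) i : `|t1 ord0 i| + rho <= (k + K)%:R.
  apply: (@le_trans _ _ K%:R); last by rewrite ler_nat leq_addl.
  by apply: le_trans (ltW (truncnS_gt _)); rewrite lerD2r coord_le_norm.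
have loc (t : 'rV[R]_n) : (forall i, `|t ord0 i - t1 ord0 i| <= rho) ->
    evalp p t1 / 2 <= evalp p t /\ evalp q t <= Q.
  move=> ht; split; first exact: hrho.
  apply: le_trans (ler_norm _) (hQ t _) => i.
  have := ler_normD (t ord0 i - t1 ord0 i) (t1 ord0 i); rewrite subrK => h.
  by apply: le_trans h _; rewrite addrC lerD// coord_le_norm.
have Z2 t : Z t <= 2.
  by apply: le_trans (Zw t) _; rewrite ler_piMr// wgtV_le1.
have [lam [f [lam0 df lf fZ fpos]]] := lattice_limit (smooth_continuous sZ) Z0 Z2
  (fun k => discrete_ground_state k q0 p0 sZ Z0 super r0 c0 loc (ler_norm _) (t1K k)).
have f0 : forall t, 0 < f t.
  apply: (positive_solution (V := fun t => evalp q t - lam * evalp p t)) lf fpos => //.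
    apply: smooth_continuous; apply: smooth_add => //; apply: smooth_opp.
    by apply: smooth_mul => //; exact: smooth_cst.
  by move=> t; have /andP[] := fZ t.
have fw t : f t <= 2 * (wgt t)^-1 by have /andP[_ h] := fZ t; exact: le_trans h (Zw t).
have {}lam0 : 0 < lam.
  rewrite lt_neqAle lam0 andbT; apply/eqP => lamE.
  apply: (no_decaying_subharmonic n0 df f0 _ fw) => t.
  by rewrite lf -lamE mul0r subr0 mulr_ge0// ltW.
exists lam; split=> //; have [dg lg] := twice_diff_affine (f 0)^-1 0 df.
exists (fun t => (f 0)^-1 * f t + 0); split=> //; split.
  by move=> t; rewrite lg lf addr0; ring.
have g0 t : 0 < (f 0)^-1 * f t + 0 by rewrite addr0 mulr_gt0// invr_gt0.
split=> //; split; first by rewrite addr0 mulVf// gt_eqF.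
(* The solution before normalisation is at most 2, hence strictly below 3, and the polynomial factor
   is at least 1. *)
exists ((f 0)^-1 * 3) => t; rewrite g0 addr0 -mulrA ltr_pM2l ?invr_gt0//=.
apply: (@lt_le_trans _ _ 3); last first.
  by rewrite ler_peMr// exprn_ege1// lerDl sqrtr_ge0.
have f2 : f t <= 2 by have /andP[_ h] := fZ t; exact: le_trans h (Z2 t).
by apply: le_lt_trans f2 _; lra.
Qed.
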